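(* Assume Hypotheses 4 and 5 (stated in the context) for some integer $r\ge 2$. If $\Gamma=\{(h_0(z),z): z\in K_0\}$ is positively invariant under the flow of the system $\dot a=f(a,z)$, $\dot z=g(a,z)$, then $h_0:K_0\to\mathbb{R}^n$ is $C^r$, and its first through $r$-th derivatives are bounded on $K_0$.
   Context: System $\dot a=f(a,z)$, $\dot z=g(a,z)$ with $(a,z)\in\mathbb{R}^n\times\mathbb{R}^m$, $x=(a,z)$; Euclidean inner product $\langle\cdot,\cdot\rangle$, Euclidean norm and induced operator norm $\|\cdot\|$. A set $\Gamma$ is positively invariant if for every $x\in\Gamma$ the solution $\Phi(t,x)$ exists for all $t\ge0$ and $\Phi(t,\Gamma)\subseteq\Gamma$ for $t\ge0$. Hypothesis 4: $K_0$ is an open, convex subset of $\mathbb{R}^m$; $h_0:K_0\to\mathbb{R}^n$ is $C^1$, and there exists $\eta>0$ with $\|Dh_0(z)\|<\eta$ for all $z\in K_0$. Hypothesis 5: There is an open neighborhood $U_0$ of $\{(h_0(z),z):z\in K_0\}$ on which $f,g$ are $C^r$ ($r\ge2$) with all their first through $r$-th derivatives bounded on $U_0$; and there exist a continuous positive function $\alpha:U_0\to\mathbb{R}$, a continuous nonnegative function $\ell:U_0\to\mathbb{R}$, and a constant $c_r>0$ such that for all $x\in U_0$: $\langle a',D_af(x)a'\rangle\ge\alpha(x)\|a'\|^2$ for all $a'\in\mathbb{R}^n$; $\langle z',D_zg(x)z'\rangle\le\ell(x)\|z'\|^2$ for all $z'\in\mathbb{R}^m$; and $\alpha(x)\ge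 r\ell(x)+(r+1)\eta\|D_ag(x)\|+c_r$. *)

(* Defs.v *)
From mathcomp Require Import all_boot.
From Stdlib Require Import Reals ClassicalEpsilon.
Set Implicit Arguments.
Unset Strict Implicit.
Unset Printing Implicit Defensive.
Open Scope R_scope.

Definition vec (p : nat) := 'I_p -> R.

Definition vadd p (x y : vec p) : vec p := fun k => x k + y k.
Definition vsub p (x y : vec p) : vec p := fun k => x k - y k.
Definition vscale p (t : R) (x : vec p) : vec p := fun k => t * x k.

Definition inner p (x y : vec p) : R := \big[Rplus/R0]_(k < p) (x k * y k).
Definition vnorm p (x : vec p) : R := sqrt (inner x x).

Definition matapp p q (M : 'I_q -> 'I_p -> R) (v : vec p) : vec q :=
  fun k => \big[Rplus/R0]_(i < p) (M k i * v i).

Definition opnorm p q (M : 'I_q -> 'I_p -> R) : R :=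
  epsilon (inhabits R0)
    (fun s => is_lub (fun t => exists v : vec p, vnorm v <= 1 /\ t = vnorm (matapp M v)) s).

Definition is_open p (U : vec p -> Prop) : Prop :=
  forall x, U x -> exists eps, 0 < eps /\
    forall y, vnorm (vsub y x) < eps -> U y.

Definition is_convex p (K : vec p -> Prop) : Prop :=
  forall x y t, K x -> K y -> 0 <= t <= 1 ->
    K (vadd (vscale (1 - t) x) (vscale t y)).

Definition cont_on p (U : vec p -> Prop) (f : vec p -> R) : Prop :=
  forall x, U x -> forall eps, 0 < eps -> exists delta, 0 < delta /\
    forall y, vnorm (vsub y x) < delta -> Rabs (f y - f x) < eps.

Definition bounded_on p (U : vec p -> Prop) (f : vec p -> R) : Prop :=
  exists B, forall x, U x -> Rabs (f x) <= B.

Definition shift_coord p (x : vec p) (i : 'I_p) (t : R) : vec p :=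
  fun k => if k == i then x k + t else x k.

Definition has_partial p (f : vec p -> R) (i : 'I_p) (x : vec p) (l : R) : Prop :=
  derivable_pt_lim (fun t => f (shift_coord x i t)) 0 l.

(* The partial derivative d_i f (x) (its unique value when it exists). *)
Definition pd p (i : 'I_p) (f : vec p -> R) (x : vec p) : R :=
  epsilon (inhabits R0) (fun l => has_partial f i x l).

(* CrB k U f : f is C^k on the open set U (all partial derivatives of
   order <= k exist on U and are continuous there), and all partial
   derivatives of orders 1..k are bounded on U. *)
Fixpoint CrB (k : nat) p (U : vec p -> Prop) (f : vec p -> R) : Prop :=
  match k with
  | O => cont_on U f
  | S k' => cont_on U f /\
      forall i : 'I_p,
        (forall x, U x -> exists l, has_partial f i x l) /\
        bounded_on U (pd i f) /\
        CrB k' U (pd i f)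
  end.

Fixpoint Ck (k : nat) p (U : vec p -> Prop) (f : vec p -> R) : Prop :=
  match k with
  | O => cont_on U f
  | S k' => cont_on U f /\
      forall i : 'I_p,
        (forall x, U x -> exists l, has_partial f i x l) /\
        Ck k' U (pd i f)
  end.

Definition apart n m (x : vec (n + m)) : vec n := fun i => x (lshift m i).
Definition zpart n m (x : vec (n + m)) : vec m := fun j => x (rshift n j).
Definition join n m (a : vec n) (z : vec m) : vec (n + m) :=
  fun k => match fintype.split k with inl i => a i | inr j => z j end.

Definition Da_f n m (f : vec (n + m) -> vec n) (x : vec (n + m)) : 'I_n -> 'I_n -> R :=
  fun k i => pd (lshift m i) (fun y => f y k) x.
Definition Dz_g n m (g : vec (n + m) -> vec m) (x : vec (n + m)) : 'I_m -> 'I_m -> R :=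
  fun k j => pd (rshift n j) (fun y => g y k) x.
Definition Da_g n m (g : vec (n + m) -> vec m) (x : vec (n + m)) : 'I_m -> 'I_n -> R :=
  fun k i => pd (lshift m i) (fun y => g y k) x.
Definition Dh n m (h : vec m -> vec n) (z : vec m) : 'I_n -> 'I_m -> R :=
  fun k j => pd j (fun w => h w k) z.

Definition field n m (f : vec (n + m) -> vec n) (g : vec (n + m) -> vec m)
  (x : vec (n + m)) : vec (n + m) := join (f x) (g x).

Definition forward_solution p (F : vec p -> vec p) (x0 : vec p) (phi : R -> vec p) : Prop :=
  (forall k, phi 0 k = x0 k) /\
  (forall eps, 0 < eps -> exists delta, 0 < delta /\
     forall s, 0 <= s < delta -> vnorm (vsub (phi s) (phi 0)) < eps) /\
  (forall t, 0 < t -> forall k, derivable_pt_lim (fun s => phi s k) t (F (phi t) k)).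

Definition pos_invariant p (F : vec p -> vec p) (Gamma : vec p -> Prop) : Prop :=
  forall x0, Gamma x0 ->
    exists phi : R -> vec p, forward_solution F x0 phi /\
      forall t, 0 <= t -> Gamma (phi t).

Definition graph n m (K0 : vec m -> Prop) (h0 : vec m -> vec n) (x : vec (n + m)) : Prop :=
  K0 (zpart x) /\ forall i, apart x i = h0 (zpart x) i.

(* Main.v *)
(** Let [X = D h0], [G z = g (h0 z, z)]. Along the reduced flow [z' = G z] the array [Y]
of [k]-th derivatives of [h0] satisfies an equation whose linearisation in [Y] expands at
rate at least [alpha - k ell - (k+1) eta |D_a g|], while tangent vectors of the reduced
flow grow at rate at most [ell + eta |D_a g|]; for [k < r] the first rate exceeds the
second by [c_r]. This gap makes cones [|dY| > L |dz|] forward invariant and expanding,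
which the boundedness of [Y] forbids: hence [Y] is Lipschitz. The same argument applied to
differences of difference quotients of [Y], which are bounded by the Lipschitz constant,
shows that these quotients converge locally uniformly: [Y] is [C^1] with bounded
derivatives. Differentiating along trajectories gives the equation for order [k + 1].
Neither the smoothness of the flow nor the solvability of the variational equation is
needed, since only finite differences of the given trajectories are compared. *)

Require Import Defs.
From HB Require Import structures.
From mathcomp Require Import all_boot.
From Stdlib Require Import Reals ClassicalEpsilon FunctionalExtensionality Lra Psatz.
Set Implicit Arguments.
Unset Strict Implicit.
Unset Printing Implicit Defensive.
Open Scope R_scope.

(** * Finite sums and Euclidean norms *)

(** A normally expanding graph is usually regularised by a contraction run backwards in time.
    Positive invariance supplies forward trajectories only, so each contraction is replaced by its
    forward counterpart: a discrepancy is amplified until it contradicts an a priori bound. The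
    coefficients of the gap condition come from a count. At order [k], one [eta |D_a g|] is lost in
    the normal coefficient [D_a f - X D_a g], each of the [k] tangent indices subtracts one tangent
    rate [ell + eta |D_a g|], and the comparison with base displacements takes one rate more. For
    [k = r - 1] the total is [r ell + (r + 1) eta |D_a g|]. Order 1 is special: [X] solves the
    Riccati equation [X' = D_a f X + D_z f - X (D_a g X + D_z g)], and its increments cannot be
    assumed small. Exact secant coefficients, estimated through [|X| <= eta] alone, take the place
    of a linearisation. From order 2 on the equation is affine in the top-order array. The Riccati
    equation itself comes from order 0: invariance makes [h0] differentiable along trajectories,
    with derivative [f]. *)

Lemma RplusA : associative Rplus.
Proof. by move=> x y z; ring. Qed.

HB.instance Definition _ :=
  Monoid.isComLaw.Build R R0 Rplus RplusA Rplus_comm Rplus_0_l.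
HB.instance Definition _ :=
  Monoid.isMulLaw.Build R R0 Rmult Rmult_0_l Rmult_0_r.
HB.instance Definition _ :=
  Monoid.isAddLaw.Build R Rmult Rplus Rmult_plus_distr_r Rmult_plus_distr_l.

Notation "\sum_ i F" := (\big[Rplus/R0]_i F%R) : R_scope.
Notation "\sum_ ( i : T ) F" := (\big[Rplus/R0]_(i : T) F%R) : R_scope.

Section Sums.
Variables (I J : finType).
Implicit Types (F H : I -> R).

Lemma sum_ext F H : (forall i, F i = H i) -> \sum_i F i = \sum_i H i.
Proof. by move=> E; apply: eq_bigr => i _. Qed.

Lemma sum_plus F H : \sum_i (F i + H i) = \sum_i F i + \sum_i H i.
Proof. by rewrite big_split. Qed.

Lemma sum_scal c F : \sum_i (c * F i) = c * \sum_i F i.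
Proof. by rewrite big_distrr. Qed.

Lemma sum_scalr c F : \sum_i (F i * c) = (\sum_i F i) * c.
Proof. by rewrite big_distrl. Qed.

Lemma sum_opp F : \sum_i (- F i) = - \sum_i F i.
Proof.
rewrite -[RHS]Rmult_1_l -Ropp_mult_distr_r Ropp_mult_distr_l -sum_scal.
by apply: sum_ext => i; ring.
Qed.

Lemma sum_minus F H : \sum_i (F i - H i) = \sum_i F i - \sum_i H i.
Proof. by rewrite /Rminus -sum_opp -sum_plus. Qed.

Lemma sum_ge0 F : (forall i, 0 <= F i) -> 0 <= \sum_i F i.
Proof. by move=> H; apply: big_ind => //; [lra | move=> x y; lra]. Qed.

Lemma sum_le F H : (forall i, F i <= H i) -> \sum_i F i <= \sum_i H i.
Proof.
move=> E; suff : 0 <= \sum_i (H i - F i) by rewrite sum_minus; lra.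
by apply: sum_ge0 => i; have := E i; lra.
Qed.

Lemma sum_zero F : (forall i, F i = 0) -> \sum_i F i = 0.
Proof. by move=> E; apply: big1 => i _. Qed.

Lemma sum_const c : \sum_(i : I) c = INR #|I| * c.
Proof.
rewrite big_const.
elim: #|I| => [|k IH]; first by rewrite /=; ring.
by rewrite iterS IH S_INR; ring.
Qed.

Lemma sum_abs F : Rabs (\sum_i F i) <= \sum_i Rabs (F i).
Proof.
apply: (big_ind2 (fun x y => Rabs x <= y)).
- by rewrite Rabs_R0; lra.
- by move=> x1 x2 y1 y2 h1 h2; apply: Rle_trans (Rabs_triang _ _) _; lra.
- by move=> i _; lra.
Qed.

Lemma sum_delta (k : I) F : \sum_i (if i == k then F i else 0) = F k.
Proof. by rewrite -big_mkcond big_pred1_eq. Qed.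

Lemma sum_term_le F k : (forall i, 0 <= F i) -> F k <= \sum_i F i.
Proof.
move=> H; rewrite -(sum_delta k F); apply: sum_le => i.
by case: eqP => // _; apply: Rle_refl.
Qed.

Lemma sum_exchange (F : I -> J -> R) :
  \sum_i \sum_j F i j = \sum_j \sum_i F i j.
Proof. exact: exchange_big. Qed.

Lemma sum_pair (F : I * J -> R) : \sum_p F p = \sum_i \sum_j F (i, j).
Proof. by rewrite pair_bigA; apply: eq_bigr => -[]. Qed.

End Sums.

Definition dot (I : finType) (x y : I -> R) : R := \sum_i (x i * y i).
Definition nsq (I : finType) (x : I -> R) : R := dot x x.
Definition nrm (I : finType) (x : I -> R) : R := sqrt (nsq x).
Definition mulmv (I J : finType) (M : I -> J -> R) (v : J -> R) : I -> R :=
  fun i => \sum_j (M i j * v j).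

Section Norm.
Variable I : finType.
Implicit Types (x y : I -> R).

Lemma nsq_ge0 x : 0 <= nsq x.
Proof. by apply: sum_ge0 => i; apply: Rle_0_sqr. Qed.

Lemma nrm_ge0 x : 0 <= nrm x.
Proof. exact: sqrt_pos. Qed.

Lemma nrm_sqr x : nrm x * nrm x = nsq x.
Proof. exact: sqrt_sqrt (nsq_ge0 x). Qed.

Lemma nrm_coord x i : Rabs (x i) <= nrm x.
Proof.
rewrite -sqrt_Rsqr_abs; apply: sqrt_le_1; [exact: Rle_0_sqr|exact: nsq_ge0|].
exact: (sum_term_le (F := fun i => x i * x i) i) (fun i => Rle_0_sqr (x i)).
Qed.

Lemma nsq_coord x i : x i * x i <= nsq x.
Proof. exact: (sum_term_le (F := fun i => x i * x i) i) (fun i => Rle_0_sqr (x i)). Qed.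

Lemma dotC x y : dot x y = dot y x.
Proof. by apply: sum_ext => i; ring. Qed.

Lemma dotDr x y z : dot x (fun i => y i + z i) = dot x y + dot x z.
Proof. by rewrite -sum_plus; apply: sum_ext => i; ring. Qed.

Lemma dotBr x y z : dot x (fun i => y i - z i) = dot x y - dot x z.
Proof. by rewrite -sum_minus; apply: sum_ext => i; ring. Qed.

Lemma dotBl x y z : dot (fun i => x i - y i) z = dot x z - dot y z.
Proof. by rewrite dotC dotBr dotC (dotC z y). Qed.

Lemma dotDl x y z : dot (fun i => x i + y i) z = dot x z + dot y z.
Proof. by rewrite dotC dotDr dotC (dotC z y). Qed.

Lemma dotZr x c y : dot x (fun i => c * y i) = c * dot x y.
Proof. by rewrite -sum_scal; apply: sum_ext => i; ring. Qed.

Lemma dotZl x c y : dot (fun i => c * x i) y = c * dot x y.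
Proof. by rewrite dotC dotZr dotC. Qed.

Lemma nsqZ c x : nsq (fun i => c * x i) = c * c * nsq x.
Proof. by rewrite /nsq dotZl dotZr; ring. Qed.

Lemma nrmZ c x : nrm (fun i => c * x i) = Rabs c * nrm x.
Proof.
rewrite /nrm nsqZ sqrt_mult; [|exact: Rle_0_sqr|exact: nsq_ge0].
by rewrite -/(Rsqr c) sqrt_Rsqr_abs.
Qed.

Lemma nsqD x y : nsq (fun i => x i + y i) = nsq x + 2 * dot x y + nsq y.
Proof. by rewrite /nsq dotDr ![dot (fun _ => _ + _) _]dotC !dotDr (dotC y x); ring. Qed.

Lemma nsqB x y : nsq (fun i => x i - y i) = nsq x - 2 * dot x y + nsq y.
Proof. by rewrite /nsq dotBr ![dot (fun _ => _ - _) _]dotC !dotBr (dotC y x); ring. Qed.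

Lemma nrm_eq0_dot x y : nrm x = 0 -> dot x y = 0.
Proof.
move=> H; apply: sum_zero => i.
have := nrm_coord x i; rewrite H => h.
have -> : x i = 0 by move: h; have := Rabs_pos (x i); split_Rabs; lra.
ring.
Qed.

(** Both signs follow from expanding the squared norms of [|y| x + |x| y] and [|y| x - |x| y]. *)
Lemma cauchy_schwarz x y : Rabs (dot x y) <= nrm x * nrm y.
Proof.
case: (Req_dec (nrm x) 0) => [H|Hx].
  by rewrite nrm_eq0_dot // H Rabs_R0; lra.
case: (Req_dec (nrm y) 0) => [H|Hy].
  by rewrite dotC nrm_eq0_dot // H Rabs_R0; lra.
have px : 0 < nrm x by have := nrm_ge0 x; lra.
have py : 0 < nrm y by have := nrm_ge0 y; lra.
have h1 := nsq_ge0 (fun i => nrm y * x i + nrm x * y i).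
have h2 := nsq_ge0 (fun i => nrm y * x i - nrm x * y i).
move: h1 h2; rewrite nsqD nsqB !nsqZ !dotZl !dotZr -!nrm_sqr.
set a := nrm x in px *; set b := nrm y in py *; set d := dot x y.
move=> h1 h2.
have hab : 0 < a * b by apply: Rmult_lt_0_compat.
apply: Rabs_le; split; apply: (Rmult_le_reg_l (a * b)) => //; lra.
Qed.

Lemma dot_le x y : dot x y <= nrm x * nrm y.
Proof. by have := cauchy_schwarz x y; split_Rabs; lra. Qed.

Lemma nrm_le c x : 0 <= c -> nsq x <= c * c -> nrm x <= c.
Proof. by move=> hc h; apply: Rnot_lt_le => h'; have := nrm_sqr x; nra. Qed.

Lemma nsq_le c x : nrm x <= c -> nsq x <= c * c.
Proof. by move=> h; rewrite -nrm_sqr; have := nrm_ge0 x; nra. Qed.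

Lemma nrm_triang x y : nrm (fun i => x i + y i) <= nrm x + nrm y.
Proof.
apply: nrm_le; first by have := nrm_ge0 x; have := nrm_ge0 y; lra.
by rewrite nsqD -!nrm_sqr; have := dot_le x y; lra.
Qed.

Lemma nrm_ext x y : (forall i, x i = y i) -> nrm x = nrm y.
Proof. by move=> H; congr nrm; apply: functional_extensionality. Qed.

Lemma nrm_dist_triang x y z :
  nrm (fun i => x i - z i) <= nrm (fun i => x i - y i) + nrm (fun i => y i - z i).
Proof.
apply: Rle_trans (nrm_triang _ _); apply: Req_le; apply: nrm_ext => i; ring.
Qed.

Lemma nrm_le_sum x : nrm x <= \sum_i Rabs (x i).
Proof.
have h0 : 0 <= \sum_i Rabs (x i) by apply: sum_ge0 => i; apply: Rabs_pos.
apply: nrm_le => //.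
rewrite -sum_scalr; apply: sum_le => i.
have h := sum_term_le (F := fun i => Rabs (x i)) i (fun i => Rabs_pos (x i)).
apply: Rle_trans (_ : Rabs (x i) * Rabs (x i) <= _); first by split_Rabs; nra.
by apply: Rmult_le_compat_l => //; apply: Rabs_pos.
Qed.

Lemma nrm_bound c x : (forall i, Rabs (x i) <= c) -> nrm x <= INR #|I| * c.
Proof. by move=> H; apply: Rle_trans (nrm_le_sum x) _; rewrite -sum_const; apply: sum_le. Qed.

Lemma nrm0 x : (forall i, x i = 0) -> nrm x = 0.
Proof. by move=> H; rewrite /nrm /nsq /dot sum_zero ?sqrt_0 // => i; rewrite H; ring. Qed.

End Norm.

Lemma nrm_basis (I : finType) (j : I) : nrm (fun i => if i == j then 1 else 0) = 1.
Proof.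
rewrite /nrm /nsq /dot.
rewrite (sum_ext (H := fun i => if i == j then 1 else 0)) ?sum_delta ?sqrt_1 // => i.
by case: eqP => _; ring.
Qed.

Lemma dot_sum_abs (I : finType) (x y : I -> R) c d :
  (forall i, Rabs (x i) <= c) -> (forall i, Rabs (y i) <= d) ->
  Rabs (dot x y) <= INR #|I| * (c * d).
Proof.
move=> hx hy; apply: Rle_trans (sum_abs _) _; rewrite -sum_const; apply: sum_le => i.
by rewrite Rabs_mult; apply: Rmult_le_compat => //; apply: Rabs_pos.
Qed.

Lemma vnorm_nrm p (x : vec p) : vnorm x = nrm x.
Proof. by []. Qed.

Lemma Rabs_minus_le a b x y : Rabs a <= x -> Rabs b <= y -> Rabs (a - b) <= x + y.
Proof. by move=> ha hb; split_Rabs; lra. Qed.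

Lemma dot_near (I : finType) (x y : I -> R) eps : 0 < eps -> exists d, 0 < d /\
  forall x' y', (forall i, Rabs (x' i - x i) <= d) -> (forall i, Rabs (y' i - y i) <= d) ->
    Rabs (dot x' y' - dot x y) <= eps.
Proof.
move=> he; pose S := \sum_i (Rabs (x i) + 1 + Rabs (y i)).
have S0 : 0 <= S.
  by apply: sum_ge0 => i; have := Rabs_pos (x i); have := Rabs_pos (y i); lra.
have e0 : 0 < eps / (S + 1) by apply: Rdiv_lt_0_compat; lra.
exists (Rmin 1 (eps / (S + 1))); split; first by apply: Rmin_glb_lt; lra.
set d := Rmin _ _.
have d1 : d <= 1 by apply: Rmin_l.
have d2 : d * (S + 1) <= eps.
  have := Rmult_le_compat_r (S + 1) _ _ ltac:(lra) (Rmin_r 1 (eps / (S + 1))).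
  by rewrite -/d /Rdiv Rmult_assoc Rinv_l ?Rmult_1_r; lra.
have d0 : 0 <= d by apply: Rmin_glb; lra.
move=> x' y' hx hy; rewrite -sum_minus.
apply: Rle_trans (sum_abs _) _; apply: Rle_trans (_ : d * S <= _); last lra.
rewrite -sum_scal; apply: sum_le => i.
have -> : x' i * y' i - x i * y i = x' i * (y' i - y i) + (x' i - x i) * y i by ring.
apply: Rle_trans (Rabs_triang _ _) _; rewrite !Rabs_mult.
have h1 : Rabs (x' i) <= Rabs (x i) + 1 by have := hx i; clear -d1; split_Rabs; lra.
have h2 := Rmult_le_compat _ _ _ _ (Rabs_pos _) (Rabs_pos _) h1 (hy i).
have h3 := Rmult_le_compat_r _ _ _ (Rabs_pos (y i)) (hx i).
lra.
Qed.

Lemma mulmv_comp (I J L : finType) (P : L -> I -> R) (Q : I -> J -> R) v l :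
  mulmv (fun l j => \sum_i (P l i * Q i j)) v l = mulmv P (mulmv Q v) l.
Proof.
rewrite /mulmv (sum_ext (H := fun j => \sum_i (P l i * Q i j * v j))) => [|j]; last by rewrite -sum_scalr.
rewrite sum_exchange; apply: sum_ext => i; rewrite -sum_scal; apply: sum_ext => j; ring.
Qed.

Lemma mulmvD (I J : finType) (P Q : I -> J -> R) v i :
  mulmv (fun i j => P i j + Q i j) v i = mulmv P v i + mulmv Q v i.
Proof. by rewrite -sum_plus; apply: sum_ext => j; ring. Qed.

Lemma mulmvB (I J : finType) (P Q : I -> J -> R) v i :
  mulmv (fun i j => P i j - Q i j) v i = mulmv P v i - mulmv Q v i.
Proof. by rewrite -sum_minus; apply: sum_ext => j; ring. Qed.

(** * Calculus on the line *)

Lemma dpl_eq (f : R -> R) x l l' : derivable_pt_lim f x l -> l = l' -> derivable_pt_lim f x l'.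
Proof. by move=> H <-. Qed.

Lemma dpl_near (f g : R -> R) x l d : 0 < d ->
  (forall t, Rabs (t - x) < d -> f t = g t) ->
  derivable_pt_lim f x l -> derivable_pt_lim g x l.
Proof.
move=> hd E H eps he; have [del hdel] := H eps he.
have hm : 0 < Rmin del d by apply: Rmin_glb_lt => //; apply: cond_pos.
exists (mkposreal _ hm) => h h0 /= hh.
rewrite -!E; [|by rewrite Rminus_diag Rabs_R0|].
  by apply: hdel => //; apply: Rlt_le_trans hh (Rmin_l _ _).
by rewrite Rplus_minus_l; apply: Rlt_le_trans hh (Rmin_r _ _).
Qed.

Lemma dpl_sum (I : finType) (F : I -> R -> R) x (l : I -> R) :
  (forall i, derivable_pt_lim (F i) x (l i)) ->
  derivable_pt_lim (fun t => \sum_i F i t) x (\sum_i l i).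
Proof.
move=> H; rewrite unlock /=; elim: (index_enum I) => [|i s IH] /=.
  exact: derivable_pt_lim_const.
exact: derivable_pt_lim_plus (H i) IH.
Qed.

Lemma dpl_scal (f : R -> R) x l c :
  derivable_pt_lim f x l -> derivable_pt_lim (fun t => c * f t) x (c * l).
Proof. exact: derivable_pt_lim_scal. Qed.

Lemma dpl_plus (f g : R -> R) x l m :
  derivable_pt_lim f x l -> derivable_pt_lim g x m ->
  derivable_pt_lim (fun t => f t + g t) x (l + m).
Proof. exact: derivable_pt_lim_plus. Qed.

Lemma dpl_minus (f g : R -> R) x l m :
  derivable_pt_lim f x l -> derivable_pt_lim g x m ->
  derivable_pt_lim (fun t => f t - g t) x (l - m).
Proof. exact: derivable_pt_lim_minus. Qed.

Lemma dpl_mult (f g : R -> R) x l m :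
  derivable_pt_lim f x l -> derivable_pt_lim g x m ->
  derivable_pt_lim (fun t => f t * g t) x (l * g x + f x * m).
Proof. exact: derivable_pt_lim_mult. Qed.

Lemma dpl_affine c d x : derivable_pt_lim (fun t => c + d * t) x d.
Proof.
apply: dpl_eq (dpl_plus (derivable_pt_lim_const c x) (dpl_scal d (derivable_pt_lim_id x))) _.
ring.
Qed.

Lemma dpl_nsq (I : finType) (F : R -> I -> R) x (l : I -> R) :
  (forall i, derivable_pt_lim (fun t => F t i) x (l i)) ->
  derivable_pt_lim (fun t => nsq (F t)) x (2 * dot (F x) l).
Proof.
move=> H; rewrite -sum_scal; apply: (dpl_sum (F := fun i t => F t i * F t i)) => i.
apply: dpl_eq (dpl_mult (H i) (H i)) _; ring.
Qed.

Lemma cont_of_dpl (f : R -> R) x l : derivable_pt_lim f x l -> continuity_pt f x.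
Proof. by move=> H; apply: derivable_continuous_pt; exists l. Qed.

Lemma cont_eps (f : R -> R) x : continuity_pt f x <->
  forall eps, 0 < eps -> exists d, 0 < d /\ forall y, Rabs (y - x) < d -> Rabs (f y - f x) < eps.
Proof.
split=> H eps he.
  have [d [hd Hd]] := H eps he; exists d; split=> // y hy.
  case: (Req_dec x y) => [<-|ne]; first by rewrite Rminus_diag Rabs_R0.
  exact: (Hd y (conj (conj Logic.I ne) hy)).
have [d [hd Hd]] := H eps he; exists d; split=> // y [_ hy]; exact: Hd.
Qed.

Lemma cont_sum (I : finType) (F : I -> R -> R) x :
  (forall i, continuity_pt (F i) x) -> continuity_pt (fun t => \sum_i F i t) x.
Proof.
move=> H; rewrite unlock /=; elim: (index_enum I) => [|i s IH] /=.
  by apply: continuity_pt_const.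
exact: continuity_pt_plus (H i) IH.
Qed.

Lemma cont_nsq (I : finType) (F : R -> I -> R) x :
  (forall i, continuity_pt (fun t => F t i) x) -> continuity_pt (fun t => nsq (F t)) x.
Proof.
move=> H; apply: (cont_sum (F := fun i t => F t i * F t i)) => i.
exact: continuity_pt_mult (H i) (H i).
Qed.

Lemma mvt (f df : R -> R) a b : a < b ->
  (forall c, a <= c <= b -> continuity_pt f c) ->
  (forall c, a < c < b -> derivable_pt_lim f c (df c)) ->
  exists c, a < c < b /\ f b - f a = df c * (b - a).
Proof.
move=> ab hc hd.
have pr1 : forall c, a < c < b -> derivable_pt f c by move=> c hc'; exists (df c); apply: hd.
have pr2 : forall c, a < c < b -> derivable_pt id c by move=> c hc'; apply: derivable_pt_id.
have [c [P E]] := MVT f id a b pr1 pr2 ab hc (fun c _ => derivable_continuous_pt _ _ (derivable_pt_id c)).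
exists c; split=> //.
have e1 : derive_pt f c (pr1 c P) = df c by apply: derive_pt_eq_0; apply: hd.
have e2 : derive_pt id c (pr2 c P) = 1 by apply: derive_pt_eq_0; apply: derivable_pt_lim_id.
by move: E; rewrite e1 e2 /id; lra.
Qed.

Lemma mvt_ge (f df : R -> R) a b k : a <= b ->
  (forall c, a <= c <= b -> continuity_pt f c) ->
  (forall c, a < c < b -> derivable_pt_lim f c (df c)) ->
  (forall c, a < c < b -> k <= df c) -> f a + k * (b - a) <= f b.
Proof.
move=> [ab|->] hc hd hk; last by lra.
have [c [hc' E]] := mvt ab hc hd.
have := hk c hc'; nra.
Qed.

(* Only the sign of the derivative where [u > 0] matters: [u] cannot leave the region through zero. *)
Lemma positive_persists (u du : R -> R) T : 0 <= T ->
  (forall t, 0 <= t <= T -> continuity_pt u t) ->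
  (forall t, 0 < t < T -> derivable_pt_lim u t (du t)) ->
  (forall t, 0 < t < T -> 0 < u t -> 0 <= du t) ->
  0 < u 0 -> u 0 <= u T.
Proof.
move=> hT hc hd hdu h0; apply: Rnot_lt_le => hlt.
pose E t := 0 <= t <= T /\ u 0 <= u t.
have E0 : E 0 by split; lra.
have [s [sub slub]] : {m | is_lub E m}.
  by apply: completeness; [exists T => t [? _]; lra | exists 0].
have s0 : 0 <= s by apply: sub.
have sT : s <= T by apply: slub => t [? _]; lra.
have us : u 0 <= u s.
  apply: Rnot_lt_le => hs.
  have [d [d0 Hd]] := (cont_eps u s).1 (hc s (conj s0 sT)) (u 0 - u s) ltac:(lra).
  suff : s <= s - d by lra.
  apply: slub => t [ht1 ht2]; apply: Rnot_lt_le => ht.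
  have ts : t <= s by apply: sub.
  have := Hd t ltac:(split_Rabs; lra); split_Rabs; lra.
have sT' : s < T by case: sT => // e; move: us hlt; rewrite e; lra.
have [d [d0 Hd]] := (cont_eps u s).1 (hc s (conj s0 sT)) (u 0) h0.
pose b := s + Rmin (d / 2) (T - s).
have hm : 0 < Rmin (d / 2) (T - s) by apply: Rmin_glb_lt; lra.
have hm1 := Rmin_l (d / 2) (T - s); have hm2 := Rmin_r (d / 2) (T - s).
have Ub : u s + 0 * (b - s) <= u b.
  apply: (mvt_ge (df := du)); rewrite /b; first lra.
  - by move=> c hc'; apply: hc; lra.
  - by move=> c hc'; apply: hd; lra.
  - move=> c hc'; apply: hdu; first lra.
    have := Hd c ltac:(split_Rabs; lra); split_Rabs; lra.
have : b <= s by apply: sub; split; [split; rewrite /b|]; lra.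
rewrite /b; lra.
Qed.

(** Compactness of [[0, T]], by a supremum: the local data at the supremum of the times up to which
    one [d] serves push this time further, unless it is [T]. *)
Lemma uniform_on_segment (P : R -> R -> Prop) T : 0 <= T ->
  (forall s d d', P s d -> d' <= d -> P s d') ->
  (forall s, 0 <= s <= T -> exists d rho, 0 < d /\ 0 < rho /\
     forall s', 0 <= s' <= T -> Rabs (s' - s) < rho -> P s' d) ->
  exists d, 0 < d /\ forall s, 0 <= s <= T -> P s d.
Proof.
move=> hT mono loc.
pose E t := 0 <= t <= T /\ exists d, 0 < d /\ forall s, 0 <= s <= t -> P s d.
have E0 : E 0.
  split; first lra.
  have [d [rho [d0 [r0 H]]]] := loc 0 ltac:(lra).
  exists d; split=> // s hs; have -> : s = 0 by lra.
  by apply: H; [lra | rewrite Rminus_diag Rabs_R0].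
have [s [sub slub]] : {m | is_lub E m}.
  by apply: completeness; [exists T => t [? _]; lra | exists 0].
have s0 : 0 <= s by apply: sub.
have sT : s <= T by apply: slub => t [? _]; lra.
have [d [rho [d0 [r0 H]]]] := loc s (conj s0 sT).
have [t [Et ht]] : exists t, E t /\ s - rho < t.
  apply: NNPP => hn; suff : s <= s - rho by lra.
  apply: slub => t Et; apply: Rnot_lt_le => ht; apply: hn; by exists t.
have ts : t <= s by apply: sub.
case: Et => _ [d2 [d20 H2]].
pose b := Rmin T (s + rho / 2).
have hb1 := Rmin_l T (s + rho / 2); have hb2 := Rmin_r T (s + rho / 2).
have Pb : forall s', 0 <= s' <= b -> P s' (Rmin d d2).
  move=> s' hs'; case: (Rle_lt_dec s' t) => h.
    apply: mono (Rmin_r _ _); apply: H2; lra.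
  apply: mono (Rmin_l _ _); apply: H; rewrite /b in hs'; first lra.
  split_Rabs; lra.
have dd : 0 < Rmin d d2 by apply: Rmin_glb_lt.
have bs : b <= s.
  apply: sub; split; last by exists (Rmin d d2).
  split; last exact: hb1.
  by apply: Rmin_glb; lra.
have bT : b = T.
  move: bs; rewrite /b /Rmin; case: Rle_dec => //; lra.
by exists (Rmin d d2); split=> // s' hs'; apply: Pb; rewrite bT.
Qed.

(** Gronwall: [u t * exp (- L t)] does not increase. The sign in [v] turns this into an increase, to
    which [mvt_ge] applies. *)
Lemma exp_growth (u du : R -> R) L T : 0 <= T ->
  (forall t, 0 <= t <= T -> continuity_pt u t) ->
  (forall t, 0 < t < T -> derivable_pt_lim u t (du t)) ->
  (forall t, 0 < t < T -> du t <= L * u t) -> u T <= u 0 * exp (L * T).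
Proof.
move=> hT hc hd hdu.
pose v t := - (u t * exp (- L * t)).
have dexp t : derivable_pt_lim (fun t => exp (- L * t)) t (- L * exp (- L * t)).
  have := derivable_pt_lim_comp (fun t => - L * t) exp t _ _
    (dpl_scal (- L) (derivable_pt_lim_id t)) (derivable_pt_lim_exp _).
  move=> h; apply: dpl_eq h _; ring.
have h : v 0 + 0 * (T - 0) <= v T.
  apply: (mvt_ge (df := fun t => - (du t * exp (- L * t) + u t * (- L * exp (- L * t))))) => //.
  - move=> c hc'; apply: continuity_pt_opp; apply: continuity_pt_mult; first exact: hc.
    exact: cont_of_dpl (dexp c).
  - move=> c hc'; apply: derivable_pt_lim_opp; apply: dpl_mult; [exact: hd|exact: dexp].
  - move=> c hc'; have := hdu c hc'; have := exp_pos (- L * c).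
    set e := exp _ => e0 hh; nra.
move: h; rewrite /v Rmult_0_r exp_0 => h.
have e1 : exp (- L * T) * exp (L * T) = 1 by rewrite -exp_plus -exp_0; congr exp; ring.
have := exp_pos (L * T); have := exp_pos (- L * T).
move: e1 h; set e := exp _; set e' := exp _ => e1 h e0 e0'.
have : u T * e <= u 0 by lra.
move=> h2; have := Rmult_le_compat_r e' _ _ (Rlt_le _ _ e0') h2.
by rewrite Rmult_assoc e1; lra.
Qed.

(** * Strict differentiability *)

(** Radii that remain valid when shrunk can be merged over a finite index set. Upper bounds are
    merged by the same lemma, as reciprocals of radii. *)
Lemma fin_common (I : finType) (Q : I -> R -> Prop) :
  (forall k d d', Q k d -> 0 < d' <= d -> Q k d') ->
  (forall k, exists d, 0 < d /\ Q k d) ->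
  exists d, 0 < d /\ forall k, Q k d.
Proof.
move=> mono H.
suff [d [d0 Hd]] : exists d, 0 < d /\ forall k, k \in enum I -> Q k d.
  by exists d; split=> // k; apply: Hd; rewrite mem_enum.
elim: (enum I) => [|k s [d [d0 Hd]]]; first by exists 1; split; [lra|].
have [d2 [d20 H2]] := H k.
have hm : 0 < Rmin d d2 by apply: Rmin_glb_lt.
exists (Rmin d d2); split=> // l; rewrite inE => /orP[/eqP ->|hl].
- by apply: mono H2 _; split=> //; apply: Rmin_r.
- by apply: mono (Hd l hl) _; split=> //; apply: Rmin_l.
Qed.

Section Vec.
Variable p : nat.
Implicit Types (x y z : vec p) (u : vec p -> R) (U : vec p -> Prop).

Lemma vnorm_vsubxx x : vnorm (vsub x x) = 0.
Proof. by apply: nrm0 => i; rewrite /vsub Rminus_diag. Qed.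

Lemma vdist_triang x y z :
  vnorm (vsub x z) <= vnorm (vsub x y) + vnorm (vsub y z).
Proof. exact: nrm_dist_triang. Qed.

Lemma shift0 x i : shift_coord x i 0 = x.
Proof. by apply: functional_extensionality => k; rewrite /shift_coord; case: eqP => _ //; ring. Qed.

Lemma shift_shift x i s t : shift_coord (shift_coord x i s) i t = shift_coord x i (s + t).
Proof. by apply: functional_extensionality => k; rewrite /shift_coord; case: eqP => _ //; ring. Qed.

Lemma shift_sub x i t :
  vsub (shift_coord x i t) x = (fun k => t * (if k == i then 1 else 0)).
Proof. by apply: functional_extensionality => k; rewrite /vsub /shift_coord; case: eqP => _; ring. Qed.

Lemma vnorm_shift x i t : vnorm (vsub (shift_coord x i t) x) = Rabs t.
Proof. by rewrite shift_sub vnorm_nrm nrmZ nrm_basis Rmult_1_r. Qed.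

Lemma dpl_shift x i t k :
  derivable_pt_lim (fun s => shift_coord x i s k) t (if k == i then 1 else 0).
Proof.
rewrite /shift_coord; case: eqP => _; last exact: derivable_pt_lim_const.
apply: dpl_eq (dpl_plus (derivable_pt_lim_const (x k) t) (derivable_pt_lim_id t)) _; ring.
Qed.

Lemma pd_eq u i x l : has_partial u i x l -> pd i u x = l.
Proof.
move=> H; have H' : has_partial u i x (pd i u x) by apply: epsilon_spec; exists l.
exact: uniqueness_limite H' H.
Qed.

Lemma pd_spec u i x : (exists l, has_partial u i x l) -> has_partial u i x (pd i u x).
Proof. by move=> [l Hl]; rewrite (pd_eq Hl). Qed.

Lemma has_partial_line u i x s l :
  has_partial u i (shift_coord x i s) l ->
  derivable_pt_lim (fun t => u (shift_coord x i t)) s l.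
Proof.
rewrite /has_partial => H eps he; have [d Hd] := H eps he; exists d => h h0 hh.
by move: (Hd h h0 hh); rewrite !shift_shift Rplus_0_r Rplus_0_l.
Qed.

Lemma has_partial_ext U u v i x l : is_open U -> U x ->
  (forall y, U y -> u y = v y) -> has_partial u i x l -> has_partial v i x l.
Proof.
move=> Uo Ux E; have [d [d0 Hd]] := Uo x Ux.
apply: (dpl_near d0) => t ht; apply: E; apply: Hd.
by rewrite vnorm_shift -(Rminus_0_r t).
Qed.

Lemma cont_curve (c : R -> vec p) t :
  (forall k, continuity_pt (fun s => c s k) t) ->
  forall eps, 0 < eps -> exists d, 0 < d /\
    forall s, Rabs (s - t) < d -> vnorm (vsub (c s) (c t)) < eps.
Proof.
move=> H eps he.
have hc : continuity_pt (fun s => nsq (vsub (c s) (c t))) t.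
  by apply: cont_nsq => k; apply: continuity_pt_minus (H k) (continuity_pt_const _ _ _).
have e2 : 0 < eps * eps by nra.
have [d [d0 Hd]] := (cont_eps _ _).1 hc _ e2.
exists d; split=> // s hs; have := Hd s hs.
rewrite -!nrm_sqr -!vnorm_nrm vnorm_vsubxx.
have := nrm_ge0 (vsub (c s) (c t)); rewrite -vnorm_nrm; split_Rabs; nra.
Qed.

Lemma cont_on_curve U u (c : R -> vec p) t : cont_on U u -> U (c t) ->
  (forall k, continuity_pt (fun s => c s k) t) -> continuity_pt (fun s => u (c s)) t.
Proof.
move=> uc Ut cc; apply/cont_eps => eps he.
have [d [d0 Hd]] := uc _ Ut _ he.
have [d2 [d20 H2]] := cont_curve cc d0.
by exists d2; split=> // s hs; apply: Hd; apply: H2.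
Qed.

(** Strict differentiability: both points move, because the estimates compare two trajectories near
    [z0], neither of which need pass through it. Continuous partial derivatives provide it. *)
Definition strictd u z0 (q : 'I_p -> R) : Prop :=
  forall mu, 0 < mu -> exists d, 0 < d /\
    forall z1 z2, vnorm (vsub z1 z0) < d -> vnorm (vsub z2 z0) < d ->
    Rabs (u z2 - u z1 - dot q (vsub z2 z1)) <= mu * vnorm (vsub z2 z1).

Lemma chain_curve u z0 q (c : R -> vec p) t c' : strictd u z0 q -> c t = z0 ->
  (forall k, derivable_pt_lim (fun s => c s k) t (c' k)) ->
  derivable_pt_lim (fun s => u (c s)) t (dot q c').
Proof.
move=> hu E hc eps he; subst z0.
(* Bounds [|c (t + h) - c t| / |h|] once every coordinate quotient is within 1 of its limit; the
   curve is differentiable at [t] only. *)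
pose Kc := INR #|'I_p| * (\sum_k Rabs (c' k) + 1).
have K0 : 0 <= Kc.
  apply: Rmult_le_pos; first exact: pos_INR.
  have := sum_ge0 (F := fun k => Rabs (c' k)) (fun k => Rabs_pos (c' k)); lra.
have hmu : 0 < eps / 2 / (Kc + 1) by apply: Rdiv_lt_0_compat; lra.
have [d [d0 Hd]] := hu _ hmu.
have hcc k : continuity_pt (fun s => c s k) t := cont_of_dpl (hc k).
have [d1 [d10 H1]] := cont_curve hcc d0.
have [d2 [d20 H2]] : exists d, 0 < d /\ forall k h, h <> 0 -> Rabs h < d ->
    Rabs ((c (t + h) k - c t k) / h - c' k) < 1.
  apply: (fin_common (Q := fun k d => forall h, h <> 0 -> Rabs h < d ->
    Rabs ((c (t + h) k - c t k) / h - c' k) < 1)).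
    by move=> k e e' H [_ he'] h h0 hh; apply: H => //; lra.
  move=> k; have [[e e0] He] := hc k 1 Rlt_0_1; by exists e.
have hdot : derivable_pt_lim (fun s => dot q (c s)) t (dot q c').
  by apply: dpl_sum => k; apply: dpl_scal.
have [[d3 d30] H3] := hdot (eps / 2) ltac:(lra).
have hm : 0 < Rmin d1 (Rmin d2 d3) by do ! apply: Rmin_glb_lt.
exists (mkposreal _ hm) => h h0 /= hh.
have l1 := Rmin_l d1 (Rmin d2 d3); have l2 := Rmin_r d1 (Rmin d2 d3).
have l3 := Rmin_l d2 d3; have l4 := Rmin_r d2 d3.
have hN : vnorm (vsub (c (t + h)) (c t)) <= Kc * Rabs h.
  rewrite Rmult_assoc; apply: nrm_bound => k.
  have := H2 k h h0 ltac:(lra) => hk.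
  have -> : vsub (c (t + h)) (c t) k = (c (t + h) k - c t k) / h * h by rewrite /vsub; field.
  rewrite Rabs_mult; apply: Rmult_le_compat_r; first exact: Rabs_pos.
  have := sum_term_le (F := fun k => Rabs (c' k)) k (fun k => Rabs_pos (c' k)) => /= hs.
  split_Rabs; lra.
have h1 := Hd (c t) (c (t + h)) ltac:(by rewrite vnorm_vsubxx)
   ltac:(by apply: H1; rewrite Rplus_minus_l; lra).
have h3 := H3 h h0 ltac:(rewrite /=; lra).
have -> : (u (c (t + h)) - u (c t)) / h - dot q c' =
   (u (c (t + h)) - u (c t) - dot q (vsub (c (t + h)) (c t))) / h +
   ((dot q (c (t + h)) - dot q (c t)) / h - dot q c').
  rewrite /vsub dotBr; field; exact: h0.
have hp := Rabs_pos_lt h h0.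
apply: Rle_lt_trans (Rabs_triang _ _) _.
suff : Rabs ((u (c (t + h)) - u (c t) - dot q (vsub (c (t + h)) (c t))) / h) <= eps / 2 by lra.
rewrite /Rdiv Rabs_mult Rabs_inv.
apply: (Rmult_le_reg_r (Rabs h)) => //.
rewrite Rmult_assoc Rinv_l ?Rmult_1_r; last by lra.
apply: Rle_trans h1 _.
apply: Rle_trans (_ : eps / 2 / (Kc + 1) * (Kc * Rabs h) <= _).
  apply: Rmult_le_compat_l => //; lra.
have -> : eps / 2 / (Kc + 1) * (Kc * Rabs h) = (eps / 2 * Rabs h) * (Kc / (Kc + 1)) by field; lra.
rewrite -[X in _ <= X]Rmult_1_r; apply: Rmult_le_compat_l; first by nra.
apply: (Rmult_le_reg_r (Kc + 1)); first lra.
rewrite /Rdiv Rmult_assoc Rinv_l; lra.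
Qed.

Definition segment x y (s : R) : vec p := vadd (vscale (1 - s) x) (vscale s y).

Lemma segment0 x y : segment x y 0 = x.
Proof. by apply: functional_extensionality => k; rewrite /segment /vadd /vscale; ring. Qed.

Lemma segment1 x y : segment x y 1 = y.
Proof. by apply: functional_extensionality => k; rewrite /segment /vadd /vscale; ring. Qed.

Lemma dpl_segment x y s k : derivable_pt_lim (fun t => segment x y t k) s (vsub y x k).
Proof.
have -> : (fun t => segment x y t k) = (fun t => x k + vsub y x k * t).
  by apply: functional_extensionality => t; rewrite /segment /vadd /vscale /vsub; ring.
exact: dpl_affine.
Qed.

Lemma segment_dist x y s : 0 <= s <= 1 -> vnorm (vsub (segment x y s) x) <= vnorm (vsub y x).
Proof.
move=> hs; have -> : vsub (segment x y s) x = (fun k => s * vsub y x k).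
  by apply: functional_extensionality => t; rewrite /segment /vadd /vscale /vsub; ring.
rewrite vnorm_nrm nrmZ Rabs_right; last lra.
have := nrm_ge0 (vsub y x); rewrite -vnorm_nrm; nra.
Qed.

Lemma strictd_mvt U u (q : vec p -> 'I_p -> R) x y : is_convex U -> U x -> U y ->
  (forall z, U z -> strictd u z (q z)) ->
  exists s, 0 < s < 1 /\ u y - u x = dot (q (segment x y s)) (vsub y x).
Proof.
move=> Uc Ux Uy hu.
have hd s : 0 <= s <= 1 -> derivable_pt_lim (fun s => u (segment x y s)) s
    (dot (q (segment x y s)) (vsub y x)).
  move=> hs; apply: chain_curve (erefl _) _; first by apply: hu; apply: Uc.
  exact: dpl_segment.
have [s [hs E]] := mvt (f := fun s => u (segment x y s)) Rlt_0_1
  (fun s hs => cont_of_dpl (hd s hs)) (fun s hs => hd s ltac:(lra)).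
exists s; split=> //.
by move: E; rewrite segment1 segment0 => ->; ring.
Qed.

Lemma strictd_lip U u (q : vec p -> 'I_p -> R) Bd x y : is_convex U -> U x -> U y ->
  (forall z, U z -> strictd u z (q z)) ->
  (forall z i, U z -> Rabs (q z i) <= Bd) ->
  Rabs (u y - u x) <= INR #|'I_p| * Bd * vnorm (vsub y x).
Proof.
move=> Uc Ux Uy hu hq; have [s [hs ->]] := strictd_mvt Uc Ux Uy hu.
apply: Rle_trans (cauchy_schwarz _ _) _; apply: Rmult_le_compat_r; first exact: nrm_ge0.
by apply: nrm_bound => i; apply: hq; apply: Uc => //; lra.
Qed.

(* Replace the coordinates of [z1] by those of [z2] one at a time: each elementary move is governed by one partial derivative. *)
Lemma strictd_C1 U u z0 : is_open U -> U z0 ->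
  (forall i x, U x -> exists l, has_partial u i x l) ->
  (forall i, cont_on U (pd i u)) ->
  strictd u z0 (fun i => pd i u z0).
Proof.
move=> Uo U0 hex hcont mu hmu.
have [d1 [d10 H1]] := Uo z0 U0.
have hmu' : 0 < mu / (INR p + 1) by apply: Rdiv_lt_0_compat => //; have := pos_INR p; lra.
have [d2 [d20 H2]] : exists d, 0 < d /\ forall i y, vnorm (vsub y z0) < d ->
    Rabs (pd i u y - pd i u z0) < mu / (INR p + 1).
  apply: (fin_common (Q := fun i d => forall y, vnorm (vsub y z0) < d ->
    Rabs (pd i u y - pd i u z0) < mu / (INR p + 1))).
    by move=> k d d' H [_ h] y hy; apply: H; lra.
  by move=> i; apply: hcont.
have hm : 0 < Rmin d1 d2 by apply: Rmin_glb_lt.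
(* The distance of a hybrid point to [z0] is at most the sum of the distances of [z1] and [z2],
   hence the half. *)
exists (Rmin d1 d2 / 2); split; first lra.
move=> z1 z2 hz1 hz2.
set N := vnorm (vsub z2 z1).
pose zz k : vec p := fun i => if (i < k)%nat then z2 i else z1 i.
have near w : (forall i, Rabs (w i - z0 i) <= Rabs (z1 i - z0 i) \/
      Rabs (w i - z0 i) <= Rabs (z2 i - z0 i)) -> vnorm (vsub w z0) < Rmin d1 d2.
  move=> hw.
  have a0 := nrm_ge0 (vsub z1 z0); have b0 := nrm_ge0 (vsub z2 z0).
  rewrite vnorm_nrm in hz1; rewrite vnorm_nrm in hz2.
  apply: Rle_lt_trans (_ : nrm (vsub z1 z0) + nrm (vsub z2 z0) < _); last lra.
  apply: nrm_le; first lra.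
  apply: Rle_trans (_ : nsq (vsub z1 z0) + nsq (vsub z2 z0) <= _).
    rewrite -sum_plus; apply: sum_le => i; rewrite /vsub.
    have := Rle_0_sqr (z1 i - z0 i); have := Rle_0_sqr (z2 i - z0 i).
    by case: (hw i) => h; have := Rsqr_le_abs_1 _ _ h; rewrite /Rsqr; lra.
  by rewrite -!nrm_sqr; nra.
have step (k : 'I_p) : Rabs (u (zz k.+1) - u (zz k) - pd k u z0 * (z2 k - z1 k))
    <= mu / (INR p + 1) * N.
  have e1 : zz k.+1 = shift_coord (zz k) k (z2 k - z1 k).
    apply: functional_extensionality => i; rewrite /zz /shift_coord ltnS.
    case: (ltngtP i k) => h; try by rewrite -val_eqE /= ?(ltn_eqF h) ?(gtn_eqF h).
    by have -> : i = k by [apply: val_inj]; rewrite eqxx; ring.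
  have inb s : 0 <= s <= 1 ->
      vnorm (vsub (shift_coord (zz k) k (s * (z2 k - z1 k))) z0) < Rmin d1 d2.
    move=> hs; apply: near => i; rewrite /shift_coord /zz.
    case: eqP => [->|_].
      rewrite ltnn; case: (Rle_lt_dec (Rabs (z1 k - z0 k)) (Rabs (z2 k - z0 k))) => h;
       [right|left]; split_Rabs; nra.
    by case: ifP => _; [right|left]; lra.
  have hd s : 0 <= s <= 1 -> derivable_pt_lim
     (fun s => u (shift_coord (zz k) k (s * (z2 k - z1 k)))) s
     (pd k u (shift_coord (zz k) k (s * (z2 k - z1 k))) * (z2 k - z1 k)).
    move=> hs.
    have hl : derivable_pt_lim (fun s => s * (z2 k - z1 k)) s (z2 k - z1 k).
      apply: dpl_eq (dpl_mult (derivable_pt_lim_id s) (derivable_pt_lim_const (z2 k - z1 k) s)) _.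
      rewrite /fct_cte; ring.
    apply: (derivable_pt_lim_comp (fun s => s * (z2 k - z1 k))
       (fun t => u (shift_coord (zz k) k t)) s _ _ hl).
    apply: has_partial_line; apply: pd_spec; apply: hex; apply: H1.
    by apply: Rlt_le_trans (inb s hs) (Rmin_l _ _).
  have [s [hs E]] := mvt Rlt_0_1 (fun s hs => cont_of_dpl (hd s hs)) (fun s hs => hd s ltac:(lra)).
  move: E; rewrite Rmult_1_l Rmult_0_l shift0 -e1 => ->.
  have -> a b c : a * b * (1 - 0) - c * b = (a - c) * b by ring.
  rewrite Rabs_mult; apply: Rmult_le_compat; try exact: Rabs_pos.
    apply: Rlt_le; apply: H2; apply: Rlt_le_trans (inb s _) (Rmin_r _ _); lra.
  exact: (nrm_coord (vsub z2 z1)).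
have acc k : (k <= p)%nat -> Rabs (u (zz k) - u z1 - dot (fun i => pd i u z0) (vsub (zz k) z1))
   <= INR k * (mu / (INR p + 1) * N).
  elim: k => [_|k IH hk].
    have -> : zz 0%nat = z1 by apply: functional_extensionality => i; rewrite /zz ltn0.
    rewrite /dot sum_zero; last by move=> i; rewrite /vsub; ring.
    by rewrite Rminus_diag Rminus_0_r Rabs_R0 /=; lra.
  have h1 := IH (ltnW hk); have h2 := step (Ordinal hk).
  have e : dot (fun i => pd i u z0) (vsub (zz k.+1) z1) =
      dot (fun i => pd i u z0) (vsub (zz k) z1) +
      pd (Ordinal hk) u z0 * (z2 (Ordinal hk) - z1 (Ordinal hk)).
    rewrite -(sum_delta (Ordinal hk) (fun i => pd i u z0 * (z2 i - z1 i))) -sum_plus.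
    apply: sum_ext => i; rewrite /vsub /zz ltnS -val_eqE /=.
    by case: (ltngtP i k) => h; ring.
  rewrite S_INR e.
  move: h1 h2; rewrite /=; set a := u (zz k.+1); set b := u (zz k).
  set c := dot _ _; set D := _ * (z2 _ - _) => h1 h2.
  have -> : a - u z1 - (c + D) = (b - u z1 - c) + (a - b - D) by ring.
  by apply: Rle_trans (Rabs_triang _ _) _; lra.
have e2 : zz p = z2 by apply: functional_extensionality => i; rewrite /zz ltn_ord.
have := acc p (leqnn p); rewrite e2 => h; apply: Rle_trans h _.
have N0 : 0 <= N by exact: nrm_ge0.
have := pos_INR p => p0.
have -> : INR p * (mu / (INR p + 1) * N) = (mu * N) * (INR p / (INR p + 1)) by field; lra.
rewrite -[X in _ <= X]Rmult_1_r; apply: Rmult_le_compat_l; first by nra.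
apply: (Rmult_le_reg_r (INR p + 1)); first lra.
rewrite /Rdiv Rmult_assoc Rinv_l; lra.
Qed.

End Vec.

(** * Functions with bounded derivatives *)

Lemma fin_bound (I : finType) (T : Type) (Q : T -> Prop) (F : I -> T -> R) :
  (forall i, exists b, forall x, Q x -> F i x <= b) ->
  exists b, 0 < b /\ forall i x, Q x -> F i x <= b.
Proof.
move=> H.
have [d [d0 Hd]] : exists d, 0 < d /\ forall i x, Q x -> F i x <= / d.
  apply: (fin_common (Q := fun i d => forall x, Q x -> F i x <= / d)).
    move=> i d d' h [d'0 dd'] x Qx; apply: Rle_trans (h x Qx) _; exact: Rinv_le_contravar.
  move=> i; have [b Hb] := H i.
  have b0 : 0 < Rabs b + 1 by have := Rabs_pos b; lra.
  exists (/ (Rabs b + 1)); split; first exact: Rinv_0_lt_compat.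
  by move=> x Qx; rewrite Rinv_inv; have := Hb x Qx; split_Rabs; lra.
by exists (/ d); split=> //; exact: Rinv_0_lt_compat.
Qed.

Section Classes.
Variables (p : nat) (U : vec p -> Prop).
Hypothesis Uo : is_open U.
Implicit Types (f g : vec p -> R).

Lemma CrB_cont k f : CrB k U f -> cont_on U f.
Proof. by case: k => [|k] // []. Qed.

Lemma CrB_S k f : CrB k.+1 U f -> CrB k U f.
Proof.
elim: k f => [|k IH] f; first by case.
move=> [fc H]; split=> // i; have [h1 [h2 h3]] := H i.
by split=> //; split=> //; apply: IH.
Qed.

Lemma CrB_le k l f : (k <= l)%nat -> CrB l U f -> CrB k U f.
Proof.
by move=> kl; rewrite -(subnK kl); elim: (l - k)%nat => // j IH h; apply: IH; apply: CrB_S.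
Qed.

Lemma cont_on_ext f g : (forall x, U x -> f x = g x) -> cont_on U f -> cont_on U g.
Proof.
move=> E fc x Ux eps he; have [d [d0 Hd]] := fc x Ux eps he.
have [d2 [d20 H2]] := Uo Ux.
exists (Rmin d d2); split; first by apply: Rmin_glb_lt.
move=> y hy; rewrite -!E //.
  by apply: Hd; apply: Rlt_le_trans hy (Rmin_l _ _).
by apply: H2; apply: Rlt_le_trans hy (Rmin_r _ _).
Qed.

Lemma bounded_on_ext f g : (forall x, U x -> f x = g x) -> bounded_on U f -> bounded_on U g.
Proof. by move=> E [b Hb]; exists b => x Ux; rewrite -E //; apply: Hb. Qed.

Lemma CrB_ext k f g : (forall x, U x -> f x = g x) -> CrB k U f -> CrB k U g.
Proof.
elim: k f g => [|k IH] f g E; first exact: cont_on_ext.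
move=> [fc H]; split; first exact: cont_on_ext E fc.
move=> i; have [h1 [h2 h3]] := H i.
have hp x : U x -> has_partial g i x (pd i f x).
  by move=> Ux; apply: (has_partial_ext Uo Ux E); apply: pd_spec; apply: h1.
have E' x : U x -> pd i f x = pd i g x by move=> Ux; rewrite (pd_eq (hp x Ux)).
split; first by move=> x Ux; exists (pd i f x); apply: hp.
by split; [exact: bounded_on_ext E' h2 | exact: IH E' h3].
Qed.

(** Products preserve [CB] but not [CrB]: the product rule multiplies derivatives by the functions
    themselves, which must then be bounded. [CrB] alone remains the right class for [h0], whose
    values may be unbounded. *)
Definition CB k f := bounded_on U f /\ CrB k U f.

Lemma CB_le k l f : (k <= l)%nat -> CB l f -> CB k f.
Proof. by move=> kl [h1 h2]; split=> //; apply: CrB_le h2. Qed.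

Lemma CB_ext k f g : (forall x, U x -> f x = g x) -> CB k f -> CB k g.
Proof. by move=> E [h1 h2]; split; [exact: bounded_on_ext h1 | exact: CrB_ext h2]. Qed.

(** Since [pd] is picked by [epsilon], candidate derivatives [d] are supplied explicitly and
    identified with [pd] on [U] by uniqueness of limits. *)
Lemma CrB_intro k f (d : 'I_p -> vec p -> R) : cont_on U f ->
  (forall i x, U x -> has_partial f i x (d i x)) ->
  (forall i, CB k (d i)) -> CrB k.+1 U f.
Proof.
move=> fc hp hd; split=> // i.
have E x : U x -> d i x = pd i f x by move=> Ux; rewrite (pd_eq (hp i x Ux)).
split; first by move=> x Ux; exists (d i x); apply: hp.
by have [h1 h2] := hd i; split; [exact: bounded_on_ext h1 | exact: CrB_ext h2].
Qed.

Lemma CrB_pd k f i : CrB k.+1 U f -> CB k (pd i f).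
Proof. by move=> [_ H]; have [_ [h1 h2]] := H i. Qed.

Lemma CrB_partial k f i x : CrB k.+1 U f -> U x -> has_partial f i x (pd i f x).
Proof. by move=> [_ H] Ux; have [h1 _] := H i; apply: pd_spec; apply: h1. Qed.

Lemma CrB_strictd k f x : CrB k.+1 U f -> U x -> strictd f x (fun i => pd i f x).
Proof.
move=> fC Ux; apply: strictd_C1 Uo Ux _ _.
  by move=> i y Uy; exists (pd i f y); apply: CrB_partial fC Uy.
by move=> i; have [_] := CrB_pd i fC; apply: CrB_cont.
Qed.

Lemma cont_on_plus f g : cont_on U f -> cont_on U g -> cont_on U (fun x => f x + g x).
Proof.
move=> fc gc x Ux eps he.
have [d [d0 Hd]] := fc x Ux (eps / 2) ltac:(lra).
have [d2 [d20 H2]] := gc x Ux (eps / 2) ltac:(lra).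
exists (Rmin d d2); split; first by apply: Rmin_glb_lt.
move=> y hy.
have h1 := Hd y (Rlt_le_trans _ _ _ hy (Rmin_l _ _)).
have h2 := H2 y (Rlt_le_trans _ _ _ hy (Rmin_r _ _)).
split_Rabs; lra.
Qed.

Lemma cont_on_mult f g : cont_on U f -> cont_on U g -> cont_on U (fun x => f x * g x).
Proof.
move=> fc gc x Ux eps he.
pose a := Rabs (f x) + 1; pose b := Rabs (g x) + 1.
have a0 : 0 < a by rewrite /a; have := Rabs_pos (f x); lra.
have b0 : 0 < b by rewrite /b; have := Rabs_pos (g x); lra.
have [d [d0 Hd]] := fc x Ux (Rmin 1 (eps / 2 / b)) ltac:(apply: Rmin_glb_lt; [lra|apply: Rdiv_lt_0_compat; lra]).
have [d2 [d20 H2]] := gc x Ux (eps / 2 / a) ltac:(apply: Rdiv_lt_0_compat; lra).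
exists (Rmin d d2); split; first by apply: Rmin_glb_lt.
move=> y hy.
have h1 := Hd y (Rlt_le_trans _ _ _ hy (Rmin_l _ _)).
have h2 := H2 y (Rlt_le_trans _ _ _ hy (Rmin_r _ _)).
have h3 := Rlt_le_trans _ _ _ h1 (Rmin_l _ _).
have h4 := Rlt_le_trans _ _ _ h1 (Rmin_r _ _).
have fy : Rabs (f y) <= a by rewrite /a; split_Rabs; lra.
have -> : f y * g y - f x * g x = f y * (g y - g x) + (f y - f x) * g x by ring.
apply: Rle_lt_trans (Rabs_triang _ _) _; rewrite !Rabs_mult.
have h5 : Rabs (f y) * Rabs (g y - g x) <= a * Rabs (g y - g x).
  by apply: Rmult_le_compat_r => //; apply: Rabs_pos.
have h6 : a * Rabs (g y - g x) < eps / 2.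
  by rewrite Rmult_comm; apply: (Rmult_lt_reg_r (/ a)); [exact: Rinv_0_lt_compat|];
   rewrite Rmult_assoc Rinv_r ?Rmult_1_r //; lra.
have h7 : Rabs (f y - f x) * b < eps / 2.
  by apply: (Rmult_lt_reg_r (/ b)); [exact: Rinv_0_lt_compat|];
   rewrite Rmult_assoc Rinv_r ?Rmult_1_r //; lra.
have h8 : Rabs (f y - f x) * Rabs (g x) <= Rabs (f y - f x) * b.
  by apply: Rmult_le_compat_l; [exact: Rabs_pos | rewrite /b; lra].
lra.
Qed.

Lemma cont_on_const c : cont_on U (fun _ => c).
Proof. by move=> x _ eps he; exists 1; split; [lra|move=> y _; rewrite Rminus_diag Rabs_R0]. Qed.

Lemma bounded_on_plus f g : bounded_on U f -> bounded_on U g -> bounded_on U (fun x => f x + g x).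
Proof.
move=> [a Ha] [b Hb]; exists (a + b) => x Ux; have := Ha x Ux; have := Hb x Ux; split_Rabs; lra.
Qed.

Lemma bounded_on_mult f g : bounded_on U f -> bounded_on U g -> bounded_on U (fun x => f x * g x).
Proof.
move=> [a Ha] [b Hb]; exists (a * b) => x Ux; rewrite Rabs_mult.
by apply: Rmult_le_compat; [exact: Rabs_pos|exact: Rabs_pos|exact: Ha|exact: Hb].
Qed.

Lemma CB_const k c : CB k (fun _ => c).
Proof.
elim: k c => [|k IH] c; split; try by exists (Rabs c) => x _; lra.
  exact: cont_on_const.
apply: (CrB_intro (d := fun _ _ => 0)); first exact: cont_on_const.
  by move=> i x _; apply: derivable_pt_lim_const.
by move=> i.
Qed.

Lemma CB_plus k f g : CB k f -> CB k g -> CB k (fun x => f x + g x).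
Proof.
elim: k f g => [|k IH] f g [fb fC] [gb gC]; split; try exact: bounded_on_plus.
  exact: cont_on_plus.
apply: (CrB_intro (d := fun i x => pd i f x + pd i g x)).
- exact: cont_on_plus (CrB_cont fC) (CrB_cont gC).
- by move=> i x Ux; apply: dpl_plus; [exact: CrB_partial fC Ux|exact: CrB_partial gC Ux].
- by move=> i; apply: IH; apply: CrB_pd.
Qed.

Lemma CB_mult k f g : CB k f -> CB k g -> CB k (fun x => f x * g x).
Proof.
elim: k f g => [|k IH] f g hf hg; have [fb fC] := hf; have [gb gC] := hg; split;
  try exact: bounded_on_mult.
  exact: cont_on_mult.
apply: (CrB_intro (d := fun i x => pd i f x * g x + f x * pd i g x)).
- exact: cont_on_mult (CrB_cont fC) (CrB_cont gC).
- move=> i x Ux.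
  have := dpl_mult (CrB_partial i fC Ux) (CrB_partial i gC Ux).
  by rewrite shift0.
- move=> i; apply: CB_plus; apply: IH; try exact: CrB_pd.
    exact: CB_le (leqnSn k) hg.
  exact: CB_le (leqnSn k) hf.
Qed.

Lemma CB_opp k f : CB k f -> CB k (fun x => - f x).
Proof.
move=> h; apply: CB_ext (CB_mult (CB_const k (-1)) h) => x _; ring.
Qed.

Lemma CB_minus k f g : CB k f -> CB k g -> CB k (fun x => f x - g x).
Proof. by move=> hf hg; apply: CB_plus hf (CB_opp hg). Qed.

Lemma CB_sum k (I : finType) (F : I -> vec p -> R) :
  (forall i, CB k (F i)) -> CB k (fun x => \sum_i F i x).
Proof.
move=> H; rewrite unlock /=; elim: (index_enum I) => [|i s IH] /=; first exact: CB_const.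
exact: CB_plus (H i) IH.
Qed.

Lemma CB_lip k f : is_convex U -> CrB k.+1 U f -> exists L, 0 <= L /\
  forall x y, U x -> U y -> Rabs (f y - f x) <= L * vnorm (vsub y x).
Proof.
move=> Uc fC.
have [b [b0 Hb]] := fin_bound (Q := U) (F := fun i x => Rabs (pd i f x))
  (fun i => (CrB_pd i fC).1).
exists (INR #|'I_p| * b); split.
  by apply: Rmult_le_pos; [exact: pos_INR|lra].
move=> x y Ux Uy; apply: (strictd_lip Uc Ux Uy (q := fun z i => pd i f z)).
  by move=> z Uz; apply: CrB_strictd fC Uz.
by move=> z i Uz; apply: Hb.
Qed.

End Classes.

(** * Functions evolving along a flow with a spectral gap *)

Section Flow.
Variables (m : nat) (K : vec m -> Prop) (G : vec m -> vec m) (Tr : (R -> vec m) -> Prop).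
Variable Lam : R.
Hypothesis Lam0 : 0 <= Lam.
Hypothesis Ko : is_open K.
Hypothesis Tr_in : forall phi t, Tr phi -> K (phi t).
Hypothesis Tr_cont : forall phi t k, Tr phi -> continuity_pt (fun s => phi s k) t.
Hypothesis Tr_dpl : forall phi t k, Tr phi -> 0 < t ->
  derivable_pt_lim (fun s => phi s k) t (G (phi t) k).
Hypothesis Tr_shift : forall phi s, Tr phi -> 0 <= s -> Tr (fun t => phi (s + t)).
Hypothesis Tr_ex : forall z, K z -> exists phi, Tr phi /\ phi 0 = z.
Hypothesis G_lip : forall x y, K x -> K y ->
  vnorm (vsub (G y) (G x)) <= Lam * vnorm (vsub y x).

(** Gronwall for the squared distance: squaring keeps the function differentiable where the
    trajectories meet, and doubles the rate [Lam]. *)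
Lemma traj_stay phi psi t : Tr phi -> Tr psi -> 0 <= t ->
  nsq (vsub (psi t) (phi t)) <= nsq (vsub (psi 0) (phi 0)) * exp (2 * Lam * t).
Proof.
move=> hphi hpsi ht.
apply: (exp_growth (u := fun t => nsq (vsub (psi t) (phi t)))
  (du := fun t => 2 * dot (vsub (psi t) (phi t)) (vsub (G (psi t)) (G (phi t))))) => //.
- move=> c _; apply: cont_nsq => k; exact: continuity_pt_minus (Tr_cont c k hpsi) (Tr_cont c k hphi).
- move=> c hc; apply: dpl_nsq => k; apply: dpl_minus; apply: Tr_dpl => //; lra.
- move=> c hc; have h1 := dot_le (vsub (psi c) (phi c)) (vsub (G (psi c)) (G (phi c))).
  have h2 := G_lip (Tr_in c hphi) (Tr_in c hpsi); rewrite !vnorm_nrm in h2.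
  rewrite -nrm_sqr; have := nrm_ge0 (vsub (psi c) (phi c)); nra.
Qed.

Lemma traj_near phi T d : Tr phi -> 0 <= T -> 0 < d -> exists rho, 0 < rho /\
  forall psi t, Tr psi -> vnorm (vsub (psi 0) (phi 0)) < rho -> 0 <= t <= T ->
  vnorm (vsub (psi t) (phi t)) < d.
Proof.
move=> hphi T0 d0; pose E := exp (Lam * T).
have E0 : 0 < E by apply: exp_pos.
exists (d / E); split; first exact: Rdiv_lt_0_compat.
move=> psi t hpsi h0 [t0 tT].
have h1 := traj_stay hphi hpsi t0.
have h2 : exp (2 * Lam * t) <= E * E.
  have tT' : 2 * Lam * t <= Lam * T + Lam * T.
    by have := Rmult_le_compat_l _ _ _ Lam0 tT; lra.
  rewrite -exp_plus; case: tT' => [h|->]; last exact: Rle_refl.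
  exact: Rlt_le (exp_increasing _ _ h).
apply: Rnot_le_lt => hd.
have h3 : vnorm (vsub (psi 0) (phi 0)) * E < d.
  have := Rmult_lt_compat_r _ _ _ E0 h0.
  by rewrite /Rdiv Rmult_assoc Rinv_l ?Rmult_1_r //; lra.
move: h1; rewrite -!nrm_sqr -!vnorm_nrm.
set b := vnorm _ in h0 h3 hd *; set a := vnorm _ in h0 h3 hd *.
have b0 : 0 <= b by apply: nrm_ge0.
have h4 := Rmult_le_compat_l (b * b) _ _ (Rmult_le_pos _ _ b0 b0) h2.
have bE := Rmult_le_pos _ _ b0 (Rlt_le _ _ E0).
have h5 := Rmult_le_0_lt_compat _ _ _ _ bE bE h3 h3.
have h6 : d * d <= a * a by apply: Rmult_le_compat; lra.
lra.
Qed.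

(** * Arrays of functions that expand faster than the base flow *)

Section Regularity.
Variables (I : finType) (Y Phi : I -> vec m -> R) (beta gam : vec m -> R) (c : R).
Hypothesis Ycont : forall i, cont_on K (Y i).
Hypothesis Ydpl : forall phi t i, Tr phi -> 0 < t ->
  derivable_pt_lim (fun s => Y i (phi s)) t (Phi i (phi t)).
Hypothesis c0 : 0 < c.
Hypothesis gam0 : forall z, K z -> 0 <= gam z.
Hypothesis gap : forall z, K z -> gam z + c <= beta z.

Lemma Y_traj_cont phi t i : Tr phi -> continuity_pt (fun s => Y i (phi s)) t.
Proof.
move=> h; apply: (cont_on_curve (Ycont i)); first exact: Tr_in.
by move=> k; apply: Tr_cont.
Qed.

Definition delta (F : I -> vec m -> R) x y : I -> R := fun i => F i y - F i x.

(* While the cone condition [|dY| > L |dz|] holds the two base points stay close, since [Y] is bounded; the condition then reinforces itself and [dY] grows without bound. *)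
Lemma Y_lipschitz B C :
  (forall z, K z -> nrm (fun i => Y i z) <= B) -> 0 <= C ->
  (forall x y, K x -> K y ->
     beta x * nsq (delta Y x y) - C * nrm (delta Y x y) * vnorm (vsub y x)
       <= dot (delta Y x y) (delta Phi x y)) ->
  (forall e, 0 < e -> exists d, 0 < d /\ forall x y, K x -> K y -> vnorm (vsub y x) < d ->
     dot (vsub y x) (vsub (G y) (G x)) <= (gam x + e) * nsq (vsub y x)) ->
  exists L, 0 < L /\ forall x y, K x -> K y -> nrm (delta Y x y) <= L * vnorm (vsub y x).
Proof.
move=> Ybd C0 Hexp Hgam.
have [d [d0 Hd]] := Hgam (c / 4) ltac:(lra).
(* The first entry lets [c L / 4] dominate the coupling constant [C]. The second forces [|w| < d]
   inside the cone, since [|dY| <= 2 B]. *)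
pose L := Rmax (4 * C / c) (2 * Rabs B / d) + 1.
have LC : C <= c * L / 4.
  have : 4 * C / c <= L by rewrite /L; have := Rmax_l (4 * C / c) (2 * Rabs B / d); lra.
  move=> h; have : c * (4 * C / c) <= c * L by apply: Rmult_le_compat_l; lra.
  have -> : c * (4 * C / c) = 4 * C by field; lra.
  lra.
have Ld : 2 * B < L * d.
  have : 2 * Rabs B / d < L by rewrite /L; have := Rmax_r (4 * C / c) (2 * Rabs B / d); lra.
  move=> h; have : 2 * Rabs B / d * d < L * d by apply: Rmult_lt_compat_r.
  have -> : 2 * Rabs B / d * d = 2 * Rabs B by field; lra.
  by split_Rabs; lra.
have L0 : 0 < L.
  rewrite /L; have := Rmax_l (4 * C / c) (2 * Rabs B / d).
  have : 0 <= 4 * C / c by apply: Rmult_le_pos; [lra|apply: Rlt_le; apply: Rinv_0_lt_compat].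
  lra.
exists L; split=> // x y Kx Ky; apply: Rnot_lt_le => hlt.
have [phi [hphi phi0]] := Tr_ex Kx; have [psi [hpsi psi0]] := Tr_ex Ky.
pose w t := vsub (psi t) (phi t).
pose D t := delta Y (phi t) (psi t).
pose u t := nsq (D t) - L * L * nsq (w t).
pose du t := 2 * dot (D t) (delta Phi (phi t) (psi t)) -
   L * L * (2 * dot (w t) (vsub (G (psi t)) (G (phi t)))).
have uc t : continuity_pt u t.
  apply: continuity_pt_minus.
    by apply: cont_nsq => i; apply: continuity_pt_minus; apply: Y_traj_cont.
  apply: continuity_pt_mult; first exact: continuity_pt_const.
  by apply: cont_nsq => i; apply: continuity_pt_minus; apply: Tr_cont.
have ud t : 0 < t -> derivable_pt_lim u t (du t).
  move=> t0; apply: dpl_minus.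
    by apply: dpl_nsq => i; apply: dpl_minus; apply: Ydpl.
  by apply: dpl_scal; apply: dpl_nsq => i; apply: dpl_minus; apply: Tr_dpl.
have N2B t : nrm (D t) <= 2 * B.
  have := nrm_triang (fun i => Y i (psi t)) (fun i => -1 * Y i (phi t)).
  rewrite nrmZ Rabs_Ropp Rabs_R1 (nrm_ext (y := D t)) => [h|i]; last by rewrite /D /delta; ring.
  have := Ybd _ (Tr_in t hphi); have := Ybd _ (Tr_in t hpsi); lra.
(* Twice the gap leaves a surplus [2 c]: one quarter of it pays for the coupling, one quarter for
   the error [c / 4] in the tangent rate, and growth at rate at least [c] remains. *)
have hdu t : 0 < u t -> c * u t <= du t.
  move=> ut.
  have Kphi := Tr_in t hphi; have Kpsi := Tr_in t hpsi.
  have N0 := nrm_ge0 (D t); have W0 := nrm_ge0 (w t).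
  have NW : L * nrm (w t) < nrm (D t).
    apply: Rnot_le_lt => h.
    move: ut; rewrite /u -!nrm_sqr.
    have : nrm (D t) * nrm (D t) <= (L * nrm (w t)) * (L * nrm (w t)) by apply: Rmult_le_compat.
    lra.
  have Wd : nrm (w t) < d.
    apply: Rnot_le_lt => h; have := N2B t.
    have : L * d <= L * nrm (w t) by apply: Rmult_le_compat_l; lra.
    lra.
  have h1 := Hexp _ _ Kphi Kpsi; have h2 := Hd _ _ Kphi Kpsi Wd.
  have hg := gam0 Kphi; have hb := gap Kphi.
  move: h1 h2; rewrite vnorm_nrm -/(D t) -/(w t) -!nrm_sqr => h1 h2.
  rewrite /u /du -!nrm_sqr.
  set N := nrm (D t) in N0 NW h1 h2 *; set W := nrm (w t) in W0 NW Wd h1 h2 *.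
  set b := beta _ in hb h1; set g := gam _ in hg hb h2.
  set P := dot (D t) _ in h1 *; set Q := dot (w t) _ in h2 *.
  have e1 : L * L * Q <= L * L * ((g + c / 4) * (W * W)).
    by apply: Rmult_le_compat_l => //; nra.
  have e2 : C * N * W <= c / 4 * (N * N).
    have := Rmult_le_compat_r (N * W) _ _ (Rmult_le_pos _ _ N0 W0) LC.
    have := Rmult_le_compat_l N _ _ N0 (Rlt_le _ _ NW).
    move=> h3; have := Rmult_le_compat_l c _ _ (Rlt_le _ _ c0) h3; lra.
  have e3 : (g + c / 4) * (L * L * (W * W)) <= (g + c / 4) * (N * N).
    apply: Rmult_le_compat_l; first lra.
    have : (L * W) * (L * W) <= N * N by apply: Rmult_le_compat; nra.
    lra.
  have e4 : (g + c) * (N * N) <= b * (N * N) by apply: Rmult_le_compat_r; nra.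
  have e5 : 0 <= c * (L * L * (W * W)) by apply: Rmult_le_pos; [lra|apply: Rmult_le_pos; nra].
  lra.
have u0 : 0 < u 0.
  rewrite /u /D /w phi0 psi0 -!nrm_sqr.
  rewrite vnorm_nrm in hlt; have := nrm_ge0 (vsub y x).
  have : (L * nrm (vsub y x)) * (L * nrm (vsub y x)) < nrm (delta Y x y) * nrm (delta Y x y).
    by apply: Rmult_le_0_lt_compat => //; apply: Rmult_le_pos; [lra|exact: nrm_ge0|lra|exact: nrm_ge0].
  lra.
have upos t : 0 <= t -> u 0 <= u t.
  move=> t0; apply: (positive_persists (du := du)) => //.
    by move=> s hs; apply: ud; lra.
  move=> s hs us; have := hdu s us; nra.
(* By this time a growth of at least [c * u 0] per unit of time exceeds [(2 B)^2], the largest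
   possible value of [nsq (D t)]. *)
pose T := (4 * (B * B) + 1) / (c * u 0).
have cu : 0 < c * u 0 by nra.
have T0 : 0 < T by apply: Rdiv_lt_0_compat; nra.
have grow s : 0 < s < T -> c * u 0 <= du s.
  move=> hs; have h1 := upos s ltac:(lra); have := hdu s ltac:(lra); nra.
have := mvt_ge (Rlt_le _ _ T0) (fun s _ => uc s) (fun s hs => ud s hs.1) grow.
have eT : c * u 0 * T = 4 * (B * B) + 1 by rewrite /T; field; split; lra.
rewrite Rminus_0_r eT.
have h1 := nsq_le (N2B T); have h2 := nsq_ge0 (w T).
have : u T <= nsq (D T) by rewrite /u; nra.
lra.
Qed.

Lemma cont_common (T : finType) (F : T -> vec m -> R) z eps :
  (forall i, cont_on K (F i)) -> K z -> 0 < eps ->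
  exists d, 0 < d /\ forall i y, vnorm (vsub y z) < d -> Rabs (F i y - F i z) < eps.
Proof.
move=> H Kz he; apply: (fin_common (Q := fun i d => forall y, vnorm (vsub y z) < d ->
    Rabs (F i y - F i z) < eps)).
  by move=> i d d' h [_ dd'] y hy; apply: h; lra.
by move=> i; apply: H.
Qed.

(* [Y] is Lipschitz but possibly not differentiable, so increments of [u] are expanded in the increments of both [Y] and the base point. *)
Definition sdiff (u : vec m -> R) (z0 : vec m) (P : I -> R) (q : 'I_m -> R) : Prop :=
  forall mu, 0 < mu -> exists d, 0 < d /\
    forall z1 z2, vnorm (vsub z1 z0) < d -> vnorm (vsub z2 z0) < d ->
    Rabs (u z2 - u z1 - dot P (delta Y z1 z2) - dot q (vsub z2 z1)) <= mu * vnorm (vsub z2 z1).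

Lemma sdiff_strictd u z0 q : strictd u z0 q -> sdiff u z0 (fun _ => 0) q.
Proof.
move=> H mu hmu; have [d [d0 Hd]] := H mu hmu; exists d; split=> // z1 z2 h1 h2.
have -> : dot (fun _ : I => 0) (delta Y z1 z2) = 0 by apply: sum_zero => i; ring.
by rewrite Rminus_0_r; apply: Hd.
Qed.

Variable L : R.
Hypothesis L0 : 0 < L.
Hypothesis Ylip : forall x y, K x -> K y -> nrm (delta Y x y) <= L * vnorm (vsub y x).

(** Coefficients may be frozen at any [z0] near [z]; this is what allows one radius along a whole
    trajectory. Moving them costs their oscillation times the increments of [Y] and of the base
    point, and the former are controlled by [L]. *)
Lemma sdiff_uniform u (P : I -> vec m -> R) (q : 'I_m -> vec m -> R) z mu : K z ->
  (forall i, cont_on K (P i)) -> (forall j, cont_on K (q j)) ->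
  sdiff u z (fun i => P i z) (fun j => q j z) -> 0 < mu ->
  exists d, 0 < d /\ forall z0 z1 z2, vnorm (vsub z0 z) < d ->
    vnorm (vsub z1 z) < d -> vnorm (vsub z2 z) < d ->
    Rabs (u z2 - u z1 - dot (fun i => P i z0) (delta Y z1 z2)
       - dot (fun j => q j z0) (vsub z2 z1)) <= mu * vnorm (vsub z2 z1).
Proof.
move=> Kz Pc qc H hmu.
pose S := INR #|I| * L + INR #|'I_m| + 1.
have S0 : 0 < S.
  rewrite /S; have := pos_INR #|'I_m|; have : 0 <= INR #|I| * L.
    by apply: Rmult_le_pos; [exact: pos_INR|lra].
  lra.
have he : 0 < mu / 2 / S by apply: Rdiv_lt_0_compat; lra.
have [d1 [d10 H1]] := H (mu / 2) ltac:(lra).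
have [d2 [d20 H2]] := cont_common Pc Kz he.
have [d3 [d30 H3]] := cont_common qc Kz he.
have [d4 [d40 H4]] := Ko Kz.
pose d := Rmin (Rmin d1 d2) (Rmin d3 d4).
have l1 : d <= d1 by apply: Rle_trans (Rmin_l _ _) (Rmin_l _ _).
have l2 : d <= d2 by apply: Rle_trans (Rmin_l _ _) (Rmin_r _ _).
have l3 : d <= d3 by apply: Rle_trans (Rmin_r _ _) (Rmin_l _ _).
have l4 : d <= d4 by apply: Rle_trans (Rmin_r _ _) (Rmin_r _ _).
exists d; split; first by rewrite /d; do ! apply: Rmin_glb_lt.
move=> z0 z1 z2 h0 h1 h2.
set D := delta Y z1 z2; set w := vsub z2 z1.
have hD : nrm D <= L * vnorm w by apply: Ylip; apply: H4; lra.
have e1 := H1 z1 z2 ltac:(lra) ltac:(lra).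
have e2 : Rabs (dot (fun i => P i z0 - P i z) D) <= INR #|I| * (mu / 2 / S * (L * vnorm w)).
  apply: dot_sum_abs => i; first by apply: Rlt_le; apply: H2; lra.
  by apply: Rle_trans hD; apply: nrm_coord.
have e3 : Rabs (dot (fun i => q i z0 - q i z) w) <= INR #|'I_m| * (mu / 2 / S * vnorm w).
  apply: dot_sum_abs => i; first by apply: Rlt_le; apply: H3; lra.
  exact: nrm_coord.
have -> : u z2 - u z1 - dot (fun i => P i z0) D - dot (fun j => q j z0) w =
   (u z2 - u z1 - dot (fun i => P i z) D - dot (fun j => q j z) w)
   - dot (fun i => P i z0 - P i z) D - dot (fun i => q i z0 - q i z) w.
  rewrite !dotBl; ring.
have w0 : 0 <= vnorm w by apply: nrm_ge0.
have e4 : INR #|I| * (mu / 2 / S * (L * vnorm w)) + INR #|'I_m| * (mu / 2 / S * vnorm w) <=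
    mu / 2 * vnorm w.
  have -> : INR #|I| * (mu / 2 / S * (L * vnorm w)) + INR #|'I_m| * (mu / 2 / S * vnorm w) =
     (mu / 2 * vnorm w) * ((S - 1) / S) by rewrite /S; field; rewrite -/S; lra.
  rewrite -[X in _ <= X]Rmult_1_r; apply: Rmult_le_compat_l; first by apply: Rmult_le_pos; lra.
  apply: (Rmult_le_reg_r S) => //; rewrite /Rdiv Rmult_assoc Rinv_l; lra.
move: e1; rewrite -/D -/w => e1.
have t1 a b e : Rabs (a - b - e) <= Rabs a + Rabs b + Rabs e.
  by clear; split_Rabs; lra.
apply: Rle_trans (t1 _ _ _) _.
apply: Rle_trans (Rplus_le_compat _ _ _ _ (Rplus_le_compat _ _ _ _ e1 e2) e3) _; lra.
Qed.

Variables (M : I -> I -> vec m -> R) (Rr : I -> 'I_m -> vec m -> R) (DG : 'I_m -> 'I_m -> vec m -> R).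
Hypothesis Phi_sdiff : forall z i, K z -> sdiff (Phi i) z (fun k => M i k z) (fun j => Rr i j z).
Hypothesis G_strictd : forall z l, K z -> strictd (fun x => G x l) z (fun j => DG l j z).
Hypothesis Mcont : forall i k, cont_on K (M i k).
Hypothesis Rcont : forall i j, cont_on K (Rr i j).
Hypothesis DGcont : forall l j, cont_on K (DG l j).

Definition linear_within mu (z0 : vec m) (d : R) : Prop :=
  forall z1 z2, vnorm (vsub z1 z0) < d -> vnorm (vsub z2 z0) < d ->
  (forall i, Rabs (Phi i z2 - Phi i z1 - dot (fun k => M i k z0) (delta Y z1 z2)
       - dot (fun j => Rr i j z0) (vsub z2 z1)) <= mu * vnorm (vsub z2 z1)) /\
  (forall l, Rabs (G z2 l - G z1 l - dot (fun j => DG l j z0) (vsub z2 z1))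
       <= mu * vnorm (vsub z2 z1)).

Lemma linear_within_near mu z : K z -> 0 < mu -> exists d, 0 < d /\
  forall z0, vnorm (vsub z0 z) < d -> linear_within mu z0 d.
Proof.
move=> Kz hmu.
have [d1 [d10 H1]] : exists d, 0 < d /\ forall i z0 z1 z2, vnorm (vsub z0 z) < d ->
    vnorm (vsub z1 z) < d -> vnorm (vsub z2 z) < d ->
    Rabs (Phi i z2 - Phi i z1 - dot (fun k => M i k z0) (delta Y z1 z2)
       - dot (fun j => Rr i j z0) (vsub z2 z1)) <= mu * vnorm (vsub z2 z1).
  apply: (fin_common (Q := fun i d => forall z0 z1 z2, vnorm (vsub z0 z) < d ->
    vnorm (vsub z1 z) < d -> vnorm (vsub z2 z) < d ->
    Rabs (Phi i z2 - Phi i z1 - dot (fun k => M i k z0) (delta Y z1 z2)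
       - dot (fun j => Rr i j z0) (vsub z2 z1)) <= mu * vnorm (vsub z2 z1))).
    by move=> i d d' H [_ dd'] z0 z1 z2 h0 h1 h2; apply: H; lra.
  by move=> i; apply: (sdiff_uniform Kz (Mcont i) (Rcont i)) => //; apply: Phi_sdiff.
have [d2 [d20 H2]] : exists d, 0 < d /\ forall l z0 z1 z2, vnorm (vsub z0 z) < d ->
    vnorm (vsub z1 z) < d -> vnorm (vsub z2 z) < d ->
    Rabs (G z2 l - G z1 l - dot (fun j => DG l j z0) (vsub z2 z1)) <= mu * vnorm (vsub z2 z1).
  apply: (fin_common (Q := fun l d => forall z0 z1 z2, vnorm (vsub z0 z) < d ->
    vnorm (vsub z1 z) < d -> vnorm (vsub z2 z) < d ->
    Rabs (G z2 l - G z1 l - dot (fun j => DG l j z0) (vsub z2 z1)) <= mu * vnorm (vsub z2 z1))).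
    by move=> i d d' H [_ dd'] z0 z1 z2 h0 h1 h2; apply: H; lra.
  (* [G] depends on the base point only, so it is treated as a function whose coefficient in the
     increments of [Y] is zero. *)
  move=> l; have [d [dp Hd]] := sdiff_uniform (u := fun x => G x l) (P := fun _ _ => 0) Kz
    (fun i => @cont_on_const _ K 0) (DGcont l) (sdiff_strictd (G_strictd l Kz)) hmu.
  exists d; split=> // z0 z1 z2 h0 h1 h2; have := Hd z0 z1 z2 h0 h1 h2.
  have -> : dot (fun _ : I => 0) (delta Y z1 z2) = 0 by apply: sum_zero => i; ring.
  by rewrite Rminus_0_r.
have hm : 0 < Rmin d1 d2 by apply: Rmin_glb_lt.
have l1 := Rmin_l d1 d2; have l2 := Rmin_r d1 d2.
exists (Rmin d1 d2 / 2); split; first lra.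
move=> z0 h0 z1 z2 h1 h2.
have t1 := vdist_triang z1 z0 z; have t2 := vdist_triang z2 z0 z.
by split=> [i|l]; [apply: H1|apply: H2]; lra.
Qed.

(** Compactness turns local radii into a tube of constant width around [phi], in which all pairs of
    trajectories obey the same linear equation up to a relative error [mu]. *)
Lemma linear_within_traj mu phi T : Tr phi -> 0 < mu -> 0 <= T ->
  exists d, 0 < d /\ forall t, 0 <= t <= T -> linear_within mu (phi t) d.
Proof.
move=> hphi hmu hT.
apply: (uniform_on_segment (P := fun s d => linear_within mu (phi s) d)) => //.
  by move=> s d d' H dd' z1 z2 h1 h2; apply: H; lra.
move=> s _; have [d [d0 Hd]] := linear_within_near (Tr_in s hphi) hmu.
have [rho [r0 Hr]] := cont_curve (fun k => Tr_cont s k hphi) d0.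
by exists d, rho; do 2 split=> //; move=> s' _ hs'; apply: Hd; apply: Hr.
Qed.

(* Writing [w], [D] for the rescaled increments of the base point and of [Y] along a trajectory started at [phi s + e e_j], the function [D i - sum_l pd l (Y i) (phi t) w_l] runs from about [pd j (Y i) (phi s) - pd j (Y i) (phi t)] at time [s] to about [0] at time [t], with controlled slope. *)
Lemma pd_traj phi t0 i j : (forall k, CrB 1 K (Y k)) -> Tr phi -> 0 < t0 ->
  derivable_pt_lim (fun s => pd j (Y i) (phi s)) t0
    (\sum_k (M i k (phi t0) * pd j (Y k) (phi t0)) + Rr i j (phi t0)
      - \sum_l (pd l (Y i) (phi t0) * DG l j (phi t0))).
Proof.
move=> YC hphi t00; set Val := _ - _.
pose z0 := phi t0; have Kz0 : K z0 by apply: Tr_in.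
pose X k l z := pd l (Y k) z.
pose ej (l : 'I_m) := if l == j then 1 else 0.
have dot_ej (q : 'I_m -> R) : dot q ej = q j.
  rewrite -(sum_delta j q); apply: sum_ext => l; rewrite /ej; case: eqP => _; ring.
(* A two-point slope estimate near [t0] is proved instead of a limit at [t0]: trajectories run
   forward only, so the left quotient must start at the earlier time [t0 + h]. *)
have strict : forall th, 0 < th -> exists del, 0 < del /\ forall s t, 0 <= s -> s < t ->
    Rabs (s - t0) < del -> Rabs (t - t0) < del ->
    Rabs (X i j (phi t) - X i j (phi s) - (t - s) * Val) <= th * (t - s).
  move=> th th0.
  have [n1 [n10 N1]] := dot_near (fun l => X i l z0) (fun l => DG l j z0) (eps := th / 4) ltac:(lra).
  have [n2 [n20 N2]] := dot_near (fun k => M i k z0) (fun k => X k j z0) (eps := th / 8) ltac:(lra).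
  have [n3 [n30 N3]] := dot_near (fun l => Rr i l z0) ej (eps := th / 8) ltac:(lra).
  have [n4 [n40 N4]] : exists d, 0 < d /\ forall l w, (forall l, Rabs (w l - ej l) <= d) ->
      Rabs (dot (fun j => DG l j z0) w - DG l j z0) <= n1 / 2.
    apply: (fin_common (Q := fun l d => forall w, (forall l, Rabs (w l - ej l) <= d) ->
      Rabs (dot (fun j => DG l j z0) w - DG l j z0) <= n1 / 2)).
      by move=> l d d' H [_ dd'] w hw; apply: H => l'; have := hw l'; lra.
    move=> l; have [d [d0 Hd]] := dot_near (fun j => DG l j z0) ej (eps := n1 / 2) ltac:(lra).
    exists d; split=> // w hw; rewrite -(dot_ej (fun j => DG l j z0)); apply: Hd => // k.
    by rewrite Rminus_diag Rabs_R0; lra.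
  have [n5 [n50 N5]] : exists d, 0 < d /\ forall k w, (forall l, Rabs (w l - ej l) <= d) ->
      Rabs (dot (fun l => X k l z0) w - X k j z0) <= n2 / 2.
    apply: (fin_common (Q := fun k d => forall w, (forall l, Rabs (w l - ej l) <= d) ->
      Rabs (dot (fun l => X k l z0) w - X k j z0) <= n2 / 2)).
      by move=> l d d' H [_ dd'] w hw; apply: H => l'; have := hw l'; lra.
    move=> k; have [d [d0 Hd]] := dot_near (fun l => X k l z0) ej (eps := n2 / 2) ltac:(lra).
    exists d; split=> // w hw; rewrite -(dot_ej (fun l => X k l z0)); apply: Hd => // l.
    by rewrite Rminus_diag Rabs_R0; lra.
  pose mu := Rmin (th / 8) (Rmin (n1 / 4) (n2 / 4)).
  have mu0 : 0 < mu by apply: Rmin_glb_lt; [lra|apply: Rmin_glb_lt; lra].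
  have mu1 : mu <= th / 8 by apply: Rmin_l.
  have mu2 : mu <= n1 / 4 by apply: Rle_trans (Rmin_r _ _) (Rmin_l _ _).
  have mu3 : mu <= n2 / 4 by apply: Rle_trans (Rmin_r _ _) (Rmin_r _ _).
  pose ka := Rmin (Rmin n3 1) (Rmin n4 n5).
  have ka0 : 0 < ka by apply: Rmin_glb_lt; apply: Rmin_glb_lt; lra.
  have ka3 : ka <= n3 by apply: Rle_trans (Rmin_l _ _) (Rmin_l _ _).
  have ka1 : ka <= 1 by apply: Rle_trans (Rmin_l _ _) (Rmin_r _ _).
  have ka4 : ka <= n4 by apply: Rle_trans (Rmin_r _ _) (Rmin_l _ _).
  have ka5 : ka <= n5 by apply: Rle_trans (Rmin_r _ _) (Rmin_r _ _).
  have [d1 [d10 Hd1]] := linear_within_near Kz0 mu0.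
  have lin := Hd1 z0 ltac:(by rewrite vnorm_vsubxx).
  have [d2 [d20 Hd2]] : exists d, 0 < d /\ forall k z1 z2, vnorm (vsub z1 z0) < d ->
      vnorm (vsub z2 z0) < d -> Rabs (Y k z2 - Y k z1 - dot (fun l => X k l z0) (vsub z2 z1))
        <= mu * vnorm (vsub z2 z1).
    apply: (fin_common (Q := fun k d => forall z1 z2, vnorm (vsub z1 z0) < d ->
      vnorm (vsub z2 z0) < d -> Rabs (Y k z2 - Y k z1 - dot (fun l => X k l z0) (vsub z2 z1))
        <= mu * vnorm (vsub z2 z1))).
      by move=> k d d' H [_ dd'] z1 z2 h1 h2; apply: H; lra.
    move=> k; exact: (CrB_strictd Ko (YC k) Kz0).
  have [d3 [d30 Hd3]] := cont_common (F := fun l z => X i l z)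
     (fun l => CrB_cont (CrB_pd l (YC i)).2) Kz0 n10.
  pose d := Rmin d3 (Rmin d1 d2 / 2).
  have dm : 0 < Rmin d1 d2 by apply: Rmin_glb_lt.
  have d0 : 0 < d by apply: Rmin_glb_lt; lra.
  have dd1 := Rmin_l d1 d2; have dd2 := Rmin_r d1 d2.
  have dd3 : d <= d3 by apply: Rmin_l.
  have dd4 : d <= Rmin d1 d2 / 2 by apply: Rmin_r.
  have [del1 [del10 Hdel]] := cont_curve (fun k => Tr_cont t0 k hphi) d0.
  (* The window is short enough that [w], whose slope is at most [2 * Lam], stays within [ka] of the
     unit vector [ej], and that [|w| <= 2]. *)
  pose del := Rmin del1 (ka / (8 * Lam + 8)).
  have del0 : 0 < del by apply: Rmin_glb_lt => //; apply: Rdiv_lt_0_compat; lra.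
  have dell1 : del <= del1 by apply: Rmin_l.
  have delka : del * (8 * Lam + 8) <= ka.
    have := Rmult_le_compat_r (8 * Lam + 8) _ _ ltac:(lra) (Rmin_r del1 (ka / (8 * Lam + 8))).
    by rewrite -/del /Rdiv Rmult_assoc Rinv_l ?Rmult_1_r; lra.
  exists del; split=> // s t s0 st hs ht.
  pose tau := t - s.
  have tau0 : 0 < tau by rewrite /tau; lra.
  have tau2 : tau < 2 * del by rewrite /tau; move: hs ht; clear; split_Rabs; lra.
  have [chi [hchi chiE]] : exists chi, Tr chi /\ forall u, chi u = phi (s + u).
    by exists (fun u => phi (s + u)); split=> //; apply: Tr_shift.
  have chi0 : chi 0 = phi s by rewrite chiE Rplus_0_r.
  have chit : chi tau = phi t by rewrite chiE /tau; congr phi; ring.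
  have nchi u : 0 <= u <= tau -> vnorm (vsub (chi u) z0) < d.
    move=> hu; rewrite chiE; apply: Hdel; move: hs ht hu; rewrite /tau; clear -dell1; split_Rabs; lra.
  have Ks : K (phi s) by apply: Tr_in.
  have Kt : K (phi t) by apply: Tr_in.
  (* [nu] collects the errors of replacing increments of [Y] by partial derivatives at the two end
     times. They vanish with the step [e], which is chosen after [s] and [t]. *)
  suff main : forall nu, 0 < nu -> Rabs (X i j (phi t) - X i j (phi s) - tau * Val) <= th * tau + nu.
    apply: Rnot_lt_le => hlt.
    have := main ((Rabs (X i j (phi t) - X i j (phi s) - (t - s) * Val) - th * (t - s)) / 2) ltac:(lra).
    rewrite -/tau in hlt *; lra.
  move=> nu nu0.
  have [d5 [d50 Hd5]] := CrB_strictd Ko (YC i) Kt (mu := nu / 4) ltac:(lra).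
  have hpart := CrB_partial j (YC i) Ks.
  have [[d6 d60] Hd6] := hpart (nu / 2) ltac:(lra).
  have [d7 [d70 Hd7]] := Ko Ks.
  have d50' : 0 < Rmin d5 d by apply: Rmin_glb_lt.
  have [rho [rho0 Hrho]] := traj_near hchi (Rlt_le _ _ tau0) d50'.
  pose em := Rmin rho (Rmin d6 d7).
  have em0 : 0 < em by apply: Rmin_glb_lt => //; apply: Rmin_glb_lt.
  have em1 : em <= rho by apply: Rmin_l.
  have em2 : em <= d6 by apply: Rle_trans (Rmin_r _ _) (Rmin_l _ _).
  have em3 : em <= d7 by apply: Rle_trans (Rmin_r _ _) (Rmin_r _ _).
  pose e := em / 2.
  have e0 : 0 < e by rewrite /e; lra.
  have eA : Rabs e = e by rewrite Rabs_right; lra.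
  have [psi [hpsi psi0]] : exists psi, Tr psi /\ psi 0 = shift_coord (phi s) j e.
    by apply: Tr_ex; apply: Hd7; rewrite vnorm_shift eA /e; lra.
  have npsi u : 0 <= u <= tau -> vnorm (vsub (psi u) (chi u)) < Rmin d5 d.
    by move=> hu; apply: Hrho => //; rewrite psi0 chi0 vnorm_shift eA /e; lra.
  have npsi' u : 0 <= u <= tau -> vnorm (vsub (psi u) z0) < Rmin d1 d2.
    move=> hu; have := vdist_triang (psi u) (chi u) z0; have := npsi u hu; have := nchi u hu.
    have := Rmin_r d5 d; lra.
  pose w u l := / e * vsub (psi u) (chi u) l.
  pose D u k := / e * delta Y (chi u) (psi u) k.
  pose dw u l := / e * vsub (G (psi u)) (G (chi u)) l.
  pose dD u k := / e * delta Phi (chi u) (psi u) k.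
  have ei0 : 0 < / e by apply: Rinv_0_lt_compat.
  have eiA : Rabs (/ e) = / e by rewrite Rabs_right; lra.
  have wN u : nrm (w u) = / e * vnorm (vsub (psi u) (chi u)) by rewrite /w nrmZ eiA.
  have w2 u : 0 <= u <= tau -> nrm (w u) <= 2.
    move=> hu; apply: nrm_le; first lra.
    have h := traj_stay hchi hpsi hu.1.
    rewrite psi0 chi0 shift_sub nsqZ -[nsq (fun k => if _ then _ else _)]nrm_sqr nrm_basis in h.
    have h2 : exp (2 * Lam * u) <= 2 * 2.
      apply: Rle_trans (_ : exp 1 <= _); last by have := exp_le_3; lra.
      apply: Rlt_le; apply: exp_increasing.
      have := Rmult_le_compat_l Lam u (2 * del) Lam0 ltac:(lra); lra.
    rewrite /w nsqZ.
    have h3 := Rmult_le_compat_l _ _ _ (Rmult_le_pos _ _ (Rlt_le _ _ ei0) (Rlt_le _ _ ei0)) h.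
    apply: Rle_trans h3 _.
    by have -> : / e * / e * (e * e * (1 * 1) * exp (2 * Lam * u)) = exp (2 * Lam * u) by field; lra.
  have wc u l : continuity_pt (fun u => w u l) u.
    apply: continuity_pt_mult; first exact: continuity_pt_const.
    by apply: continuity_pt_minus; apply: Tr_cont.
  have Dc u k : continuity_pt (fun u => D u k) u.
    apply: continuity_pt_mult; first exact: continuity_pt_const.
    by apply: continuity_pt_minus; apply: Y_traj_cont.
  have wd u l : 0 < u -> derivable_pt_lim (fun u => w u l) u (dw u l).
    by move=> u0; apply: dpl_scal; apply: dpl_minus; apply: Tr_dpl.
  have Dd u k : 0 < u -> derivable_pt_lim (fun u => D u k) u (dD u k).
    by move=> u0; apply: dpl_scal; apply: dpl_minus; apply: Ydpl.
  have w0 l : w 0 l = ej l by rewrite /w psi0 chi0 shift_sub /ej; field; lra.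
  have dwb u l : 0 <= u <= tau -> Rabs (dw u l) <= 2 * Lam.
    move=> hu; rewrite /dw Rabs_mult eiA.
    apply: Rle_trans (_ : / e * (Lam * vnorm (vsub (psi u) (chi u))) <= _).
      apply: Rmult_le_compat_l; first lra.
      by apply: Rle_trans (G_lip (Tr_in u hchi) (Tr_in u hpsi)); apply: nrm_coord.
    have := Rmult_le_compat_l _ _ _ Lam0 (w2 u hu); rewrite wN; lra.
  have wej u l : 0 <= u <= tau -> Rabs (w u l - ej l) <= ka.
    move=> [[u0|<-] hu]; last by rewrite w0 Rminus_diag Rabs_R0; lra.
    have [v [hv E]] := mvt u0 (fun v _ => wc v l) (fun v hv => wd v l hv.1).
    rewrite -w0 E Rminus_0_r Rabs_mult (Rabs_right u); last lra.
    have := Rmult_le_compat _ _ u (2 * del) (Rabs_pos _) (Rlt_le _ _ u0) (dwb v l ltac:(lra)) ltac:(lra).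
    have := Rmult_le_pos _ _ Lam0 (Rlt_le _ _ del0); lra.
  have scale (T' : finType) (P : T' -> R) x : dot P (fun k => / e * x k) = / e * dot P x.
    by rewrite dotZr.
  have dwE u l : 0 <= u <= tau -> Rabs (dw u l - DG l j z0) <= n1.
    move=> hu.
    have [_ h] := lin (chi u) (psi u) ltac:(have := nchi u hu; lra) ltac:(have := npsi' u hu; lra).
    have h1 := N4 l (w u) (fun l => Rle_trans _ _ _ (wej u l hu) ka4).
    have h2 : Rabs (dw u l - dot (fun j => DG l j z0) (w u)) <= n1 / 2.
      rewrite scale -Rmult_minus_distr_l Rabs_mult eiA.
      apply: Rle_trans (Rmult_le_compat_l _ _ _ (Rlt_le _ _ ei0) (h l)) _.
      have := Rmult_le_compat_l _ _ _ (Rlt_le _ _ mu0) (w2 u hu); rewrite wN; lra.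
    move: h1 h2; set a := dot _ _; clear; split_Rabs; lra.
  have DE u k : 0 <= u <= tau -> Rabs (D u k - X k j z0) <= n2.
    move=> hu.
    have h := Hd2 k (chi u) (psi u) ltac:(have := nchi u hu; lra) ltac:(have := npsi' u hu; lra).
    have h1 := N5 k (w u) (fun l => Rle_trans _ _ _ (wej u l hu) ka5).
    have h2 : Rabs (D u k - dot (fun l => X k l z0) (w u)) <= n2 / 2.
      rewrite scale -Rmult_minus_distr_l Rabs_mult eiA.
      apply: Rle_trans (Rmult_le_compat_l _ _ _ (Rlt_le _ _ ei0) h) _.
      have := Rmult_le_compat_l _ _ _ (Rlt_le _ _ mu0) (w2 u hu); rewrite wN; lra.
    move: h1 h2; set a := dot _ _; clear; split_Rabs; lra.
  have dDE u : 0 <= u <= tau ->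
      Rabs (dD u i - (dot (fun k => M i k z0) (fun k => X k j z0) + Rr i j z0)) <= th / 2.
    move=> hu.
    have [h _] := lin (chi u) (psi u) ltac:(have := nchi u hu; lra) ltac:(have := npsi' u hu; lra).
    have h1 : Rabs (dot (fun k => M i k z0) (D u) - dot (fun k => M i k z0) (fun k => X k j z0)) <= th / 8.
      by apply: N2 => k; [rewrite Rminus_diag Rabs_R0; lra | exact: DE].
    have h2 : Rabs (dot (fun l => Rr i l z0) (w u) - dot (fun l => Rr i l z0) ej) <= th / 8.
      apply: N3 => l; first by rewrite Rminus_diag Rabs_R0; lra.
      exact: Rle_trans (wej u l hu) ka3.
    rewrite dot_ej in h2.
    have h3 : Rabs (dD u i - dot (fun k => M i k z0) (D u) - dot (fun l => Rr i l z0) (w u)) <= th / 4.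
      rewrite !scale -!Rmult_minus_distr_l Rabs_mult eiA.
      apply: Rle_trans (Rmult_le_compat_l _ _ _ (Rlt_le _ _ ei0) (h i)) _.
      have := Rmult_le_compat_l _ _ _ (Rlt_le _ _ mu0) (w2 u hu); rewrite wN; lra.
    move: h1 h2 h3; set a := dot _ (D u); set b := dot _ (w u); set a' := dot _ _.
    clear; split_Rabs; lra.
  (* The coefficients [X] are frozen at the final point [phi t]: no derivative of [X] along the
     trajectory, which is what is being sought, enters the slope of [F]. *)
  pose F u := D u i - dot (fun l => X i l (phi t)) (w u).
  pose dF u := dD u i - dot (fun l => X i l (phi t)) (dw u).
  have [v [hv E]] : exists v, 0 < v < tau /\ F tau - F 0 = dF v * (tau - 0).
    apply: mvt => // v hv.
      apply: continuity_pt_minus; first exact: Dc.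
      apply: cont_sum => l; apply: continuity_pt_mult; first exact: continuity_pt_const.
      exact: wc.
    apply: dpl_minus; first by apply: Dd; lra.
    by apply: dpl_sum => l; apply: dpl_scal; apply: wd; lra.
  have hdF : Rabs (dF v - Val) <= th.
    have hv' : 0 <= v <= tau by lra.
    have h1 := dDE v hv'.
    have h2 : Rabs (dot (fun l => X i l (phi t)) (dw v) - dot (fun l => X i l z0) (fun l => DG l j z0)) <= th / 4.
      apply: N1 => l; last exact: dwE.
      by apply: Rlt_le; apply: Hd3; rewrite -chit; have := nchi tau ltac:(lra); lra.
    move: h1 h2; rewrite /dF /Val -/z0 /X /dot; set a := dD _ _; set b := \sum_k _; set b' := \sum_l _.
    set b'' := \sum_l _; clear -th0; split_Rabs; lra.
  have hFt : Rabs (F tau) <= nu / 2.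
    have ht' : 0 <= tau <= tau by lra.
    have hn := npsi tau ht'; rewrite chit in hn.
    have h := Hd5 (phi t) (psi tau) ltac:(by rewrite vnorm_vsubxx) ltac:(have := Rmin_l d5 d; lra).
    rewrite -chit in h.
    rewrite /F scale -Rmult_minus_distr_l Rabs_mult eiA -chit.
    apply: Rle_trans (Rmult_le_compat_l _ _ _ (Rlt_le _ _ ei0) h) _.
    have := w2 tau ht'; rewrite wN => h2.
    have := Rmult_le_compat_l (nu / 4) _ _ ltac:(lra) h2; lra.
  have hF0 : Rabs (F 0 - (X i j (phi s) - X i j (phi t))) <= nu / 2.
    have := Hd6 e ltac:(lra) ltac:(rewrite /= eA /e; lra).
    rewrite Rplus_0_l shift0.
    have -> : F 0 = (Y i (shift_coord (phi s) j e) - Y i (phi s)) / e - X i j (phi t).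
      have wE : w 0 = ej by apply: functional_extensionality.
      by rewrite /F wE dot_ej /D psi0 chi0 /delta /Rdiv Rmult_comm.
    rewrite /X; set a := _ / e; clear; split_Rabs; lra.
  have -> : X i j (phi t) - X i j (phi s) - tau * Val =
     - F tau + (F 0 - (X i j (phi s) - X i j (phi t))) + (dF v - Val) * tau.
    move: E; rewrite Rminus_0_r => E; lra.
  have h3 := Rmult_le_compat_r _ _ _ (Rlt_le _ _ tau0) hdF.
  have h4 : Rabs ((dF v - Val) * tau) <= th * tau by rewrite Rabs_mult (Rabs_right tau); lra.
  move: hFt hF0 h4; set a := F tau; set b := F 0 - _; set b' := (dF v - Val) * tau.
  clear; split_Rabs; lra.
move=> eps he.
have [del [del0 H]] := strict (eps / 2) ltac:(lra).
have hm : 0 < Rmin del t0 by apply: Rmin_glb_lt.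
have l1 := Rmin_l del t0; have l2 := Rmin_r del t0.
exists (mkposreal _ hm) => h hne /= hh.
have hp := Rabs_pos_lt h hne.
suff H' : Rabs (X i j (phi (t0 + h)) - X i j (phi t0) - h * Val) <= eps / 2 * Rabs h.
  have -> : (pd j (Y i) (phi (t0 + h)) - pd j (Y i) (phi t0)) / h - Val =
     (X i j (phi (t0 + h)) - X i j (phi t0) - h * Val) / h by rewrite /X; field.
  rewrite /Rdiv Rabs_mult Rabs_inv.
  apply: (Rmult_lt_reg_r (Rabs h)) => //; rewrite Rmult_assoc Rinv_l ?Rmult_1_r; [|lra].
  have := Rmult_lt_compat_r _ _ _ hp (_ : eps / 2 < eps); lra.
case: (Rle_lt_dec 0 h) => h0.
  have := H t0 (t0 + h) ltac:(lra) ltac:(lra) ltac:(rewrite Rminus_diag Rabs_R0; lra)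
    ltac:(rewrite Rplus_minus_l; lra).
  rewrite (Rabs_right h); last lra.
  by have -> : t0 + h - t0 = h by ring.
have := H (t0 + h) t0 ltac:(move: hh; clear -l2; split_Rabs; lra) ltac:(lra)
    ltac:(rewrite Rplus_minus_l; lra) ltac:(rewrite Rminus_diag Rabs_R0; lra).
rewrite (Rabs_left h h0).
have -> : t0 - (t0 + h) = - h by ring.
set a := X i j (phi t0); set b := X i j (phi (t0 + h)).
have -> : a - b - - h * Val = - (b - a - h * Val) by ring.
by rewrite Rabs_Ropp.
Qed.

(** * Convergence of difference quotients *)

Variable CR : R.
Hypothesis CR0 : 0 <= CR.
Hypothesis Rbd : forall i j z, K z -> Rabs (Rr i j z) <= CR.
Hypothesis Mexp : forall z (y : I -> R), K z ->
  beta z * nsq y <= dot y (mulmv (fun i k => M i k z) y).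
Hypothesis DGrate : forall z (v : 'I_m -> R), K z ->
  dot v (mulmv (fun l j => DG l j z) v) <= gam z * nsq v.

Lemma mulR_bound z v : K z ->
  nrm (mulmv (fun i j => Rr i j z) v) <= INR #|I| * (INR #|'I_m| * (CR * nrm v)).
Proof.
move=> Kz; apply: nrm_bound => i.
apply: Rle_trans (sum_abs _) _; rewrite -sum_const; apply: sum_le => j.
rewrite Rabs_mult; apply: Rmult_le_compat; try exact: Rabs_pos; first exact: Rbd.
exact: nrm_coord.
Qed.

(** The array difference [D] expands at rate at least [gam + c], while [w], [w1], [w2] grow at rate
    about [gam]. The surplus absorbs three things: the coupling through [Rr], as [C] is large; the
    linearisation errors of order [mu * s], as [mu] is small against [th^2]; and the slope [c / 4]
    of the weight [kap]. The term in [s] is unavoidable because those errors are proportional to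
    [w1] and [w2], not to their difference. *)
Lemma cone_derivative z (D1 D2 dD1 dD2 : I -> R) (w1 w2 dw1 dw2 : 'I_m -> R) C mu th kap
    (s := nsq w1 + nsq w2)
    (D := fun i => D1 i - D2 i) (w := fun l => w1 l - w2 l)
    (dD := fun i => dD1 i - dD2 i) (dw := fun l => dw1 l - dw2 l) :
  K z -> 0 <= mu -> 1 <= kap ->
  8 * (INR #|I| * (INR #|'I_m| * CR)) <= c * C -> 0 < C -> L <= C ->
  (4 * INR #|I| * C + 4 * C * C * INR #|'I_m|) * mu <= c / 2 * (th * th) ->
  2 * INR #|'I_m| * mu <= c / 2 ->
  nrm D1 <= L * nrm w1 -> nrm D2 <= L * nrm w2 ->
  (forall i, Rabs (dD1 i - mulmv (fun i k => M i k z) D1 i - mulmv (fun i j => Rr i j z) w1 i)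
     <= mu * nrm w1) ->
  (forall i, Rabs (dD2 i - mulmv (fun i k => M i k z) D2 i - mulmv (fun i j => Rr i j z) w2 i)
     <= mu * nrm w2) ->
  (forall l, Rabs (dw1 l - mulmv (fun l j => DG l j z) w1 l) <= mu * nrm w1) ->
  (forall l, Rabs (dw2 l - mulmv (fun l j => DG l j z) w2 l) <= mu * nrm w2) ->
  0 < nsq D - C * C * nsq w - th * th * (kap * s) ->
  0 <= 2 * dot D dD - C * C * (2 * dot w dw)
    - th * th * (c / 4 * s + kap * (2 * dot w1 dw1 + 2 * dot w2 dw2)).
Proof.
move=> Kz mu0 kap1 hC C0 LC hmu hmu2 hD1 hD2 e1 e2 f1 f2 hq.
set N := INR #|I| in hC hmu *; set m' := INR #|'I_m| in hC hmu hmu2 *.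
have N0 : 0 <= N by apply: pos_INR.
have m0 : 0 <= m' by apply: pos_INR.
pose n1 := nrm w1; pose n2 := nrm w2.
have n10 : 0 <= n1 by apply: nrm_ge0.
have n20 : 0 <= n2 by apply: nrm_ge0.
have sE : s = n1 * n1 + n2 * n2 by rewrite /s -!nrm_sqr.
have s0 : 0 <= s by rewrite sE; nra.
have s2 : (n1 + n2) * (n1 + n2) <= 2 * s by rewrite sE; have := Rle_0_sqr (n1 - n2); rewrite /Rsqr; lra.
have hD : nrm D <= C * (n1 + n2).
  have h := nrm_triang D1 (fun i => -1 * D2 i).
  rewrite nrmZ Rabs_Ropp Rabs_R1 Rmult_1_l in h.
  rewrite (nrm_ext (y := D)) in h; last by move=> i; rewrite /D; ring.
  have := Rmult_le_compat_r n1 _ _ n10 LC; have := Rmult_le_compat_r n2 _ _ n20 LC.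
  rewrite /n1 /n2 in hD1 hD2 *; lra.
have hw : nrm w <= n1 + n2.
  have h := nrm_triang w1 (fun i => -1 * w2 i).
  rewrite nrmZ Rabs_Ropp Rabs_R1 Rmult_1_l in h.
  by rewrite (nrm_ext (y := w)) in h; last by move=> i; rewrite /w; ring.
have D0 := nrm_ge0 D; have w0 := nrm_ge0 w.
pose E i := dD i - mulmv (fun i k => M i k z) D i - mulmv (fun i j => Rr i j z) w i.
have hE i : Rabs (E i) <= mu * (n1 + n2).
  have := e1 i; have := e2 i.
  have -> : E i = (dD1 i - mulmv (fun i k => M i k z) D1 i - mulmv (fun i j => Rr i j z) w1 i)
     - (dD2 i - mulmv (fun i k => M i k z) D2 i - mulmv (fun i j => Rr i j z) w2 i).
    have hs (T : finType) (A : T -> R) x y : \sum_k (A k * (x k - y k)) = \sum_k (A k * x k) - \sum_k (A k * y k).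
      by rewrite -sum_minus; apply: sum_ext => k; ring.
    by rewrite /E /dD /mulmv /D /w !hs; ring.
  by rewrite Rmult_plus_distr_l => h2 h1; apply: Rabs_minus_le.
have hF l (F := fun l => dw l - mulmv (fun l j => DG l j z) w l) : Rabs (F l) <= mu * (n1 + n2).
  have := f1 l; have := f2 l.
  have -> : F l = (dw1 l - mulmv (fun l j => DG l j z) w1 l) - (dw2 l - mulmv (fun l j => DG l j z) w2 l).
    have hs (T : finType) (A : T -> R) x y : \sum_k (A k * (x k - y k)) = \sum_k (A k * x k) - \sum_k (A k * y k).
      by rewrite -sum_minus; apply: sum_ext => k; ring.
    by rewrite /F /dw /mulmv /w !hs; ring.
  by rewrite Rmult_plus_distr_l => h2 h1; apply: Rabs_minus_le.
have g1 : beta z * nsq D - N * (m' * CR) * (nrm D * nrm w) - 2 * N * C * mu * s <= dot D dD.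
  have -> : dot D dD = dot D (mulmv (fun i k => M i k z) D) + dot D (mulmv (fun i j => Rr i j z) w) + dot D E.
    by rewrite -!dotDr; apply: sum_ext => i; rewrite /E; ring.
  have h1 := Mexp D Kz.
  have h2 := cauchy_schwarz D (mulmv (fun i j => Rr i j z) w).
  have h3 := Rmult_le_compat_l _ _ _ D0 (mulR_bound w Kz).
  have h4 := cauchy_schwarz D E.
  have h5 := Rmult_le_compat _ _ _ _ D0 (nrm_ge0 E) hD (nrm_bound hE).
  have h6 : C * (n1 + n2) * (INR #|I| * (mu * (n1 + n2))) <= 2 * N * C * mu * s.
    have hh : 0 <= N * C * mu by apply: Rmult_le_pos => //; apply: Rmult_le_pos => //; lra.
    have := Rmult_le_compat_l _ _ _ hh s2; rewrite -/N; lra.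
  have a1 : - (nrm D * nrm E) <= dot D E by clear -h4; split_Rabs; lra.
  have a2 : - (nrm D * nrm (mulmv (fun i j => Rr i j z) w)) <= dot D (mulmv (fun i j => Rr i j z) w)
    by clear -h2; split_Rabs; lra.
  rewrite -/N -/m' in h3; lra.
have gen (v dv : 'I_m -> R) e : 0 <= e ->
   (forall l, Rabs (dv l - mulmv (fun l j => DG l j z) v l) <= e) ->
   dot v dv <= gam z * nsq v + nrm v * (m' * e).
  move=> e0 he; pose F l := dv l - mulmv (fun l j => DG l j z) v l.
  have -> : dot v dv = dot v (mulmv (fun l j => DG l j z) v) + dot v F.
    by rewrite -dotDr; apply: sum_ext => i; rewrite /F; ring.
  have h1 := DGrate v Kz; have h2 := dot_le v F.
  have := Rmult_le_compat_l _ _ _ (nrm_ge0 v) (nrm_bound (x := F) he); rewrite -/m'; lra.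
have g2 : dot w dw <= gam z * nsq w + 2 * m' * mu * s.
  have e0 : 0 <= mu * (n1 + n2) by apply: Rmult_le_pos; lra.
  have h1 := gen w dw _ e0 hF.
  have h2 := Rmult_le_compat_r (m' * (mu * (n1 + n2))) _ _ (Rmult_le_pos _ _ m0 e0) hw.
  have hh : 0 <= m' * mu by apply: Rmult_le_pos.
  have := Rmult_le_compat_l _ _ _ hh s2; lra.
have g3 : dot w1 dw1 <= gam z * (n1 * n1) + m' * mu * (n1 * n1).
  have := gen w1 dw1 _ (Rmult_le_pos _ _ mu0 n10) f1; rewrite -nrm_sqr -/n1; lra.
have g4 : dot w2 dw2 <= gam z * (n2 * n2) + m' * mu * (n2 * n2).
  have := gen w2 dw2 _ (Rmult_le_pos _ _ mu0 n20) f2; rewrite -nrm_sqr -/n2; lra.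
have g5 : dot w1 dw1 + dot w2 dw2 <= (gam z + m' * mu) * s by rewrite sE; lra.
have hg := gam0 Kz; have hb := gap Kz.
(* By [2 C |D| |w| <= |D|^2 + C^2 |w|^2], the lower bound on [C] reduces the coupling to a fraction
   [c / 8] of the two squares. *)
have g6 : 2 * (N * (m' * CR)) * (nrm D * nrm w) <= c / 8 * (nsq D + C * C * nsq w).
  have p0 : 0 <= nrm D * nrm w by apply: Rmult_le_pos.
  have h1 := Rmult_le_compat_r _ _ _ p0 hC.
  have := Rle_0_sqr (nrm D - C * nrm w); rewrite /Rsqr => h2.
  have h3 : c * (2 * (C * (nrm D * nrm w))) <= c * (nsq D + C * C * nsq w).
    apply: Rmult_le_compat_l; first lra. rewrite -!nrm_sqr; lra.
  lra.
set ND := nsq D in hq g1 g6 *; set W := nsq w in hq g2 g6 *.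
have W0 : 0 <= W by apply: nsq_ge0.
set a := dot D dD in g1 *; set b := dot w dw in g2 *.
set d := dot w1 dw1 + _ in g5.
have -> : 2 * dot w1 dw1 + 2 * dot w2 dw2 = 2 * d by rewrite /d; ring.
set be := beta z in hb g1; set g := gam z in hg hb g2 g5.
have ND0 : 0 <= ND by apply: nsq_ge0.
have k1 : (g + c) * ND <= be * ND by apply: Rmult_le_compat_r.
have C2 : 0 <= C * C by nra.
have k2 : C * C * b <= C * C * (g * W + 2 * m' * mu * s) by apply: Rmult_le_compat_l.
have th2 : 0 <= th * th by exact: Rle_0_sqr.
have tk : 0 <= th * th * kap by apply: Rmult_le_pos => //; lra.
have k3 : th * th * kap * d <= th * th * kap * ((g + m' * mu) * s) by apply: Rmult_le_compat_l.
have k4 : (2 * g + 2 * c - c / 8) * (C * C * W + th * th * (kap * s)) <= (2 * g + 2 * c - c / 8) * ND.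
  apply: Rmult_le_compat_l; lra.
have k5 : (4 * N * C + 4 * C * C * m') * mu * s <= c / 2 * (th * th) * s.
  by apply: Rmult_le_compat_r.
have CW : 0 <= C * C * W by apply: Rmult_le_pos.
have cCW : 0 <= c * (C * C * W) by apply: Rmult_le_pos => //; lra.
have ts : 0 <= th * th * s by apply: Rmult_le_pos.
have k6 : 2 * m' * mu * (th * th * (kap * s)) <= c / 2 * (th * th * (kap * s)).
  apply: Rmult_le_compat_r => //; rewrite (_ : _ * (_ * _) = th * th * kap * s); last ring.
  exact: Rmult_le_pos.
have k7 : c * (th * th * s) <= c * (th * th * (kap * s)).
  apply: Rmult_le_compat_l; first lra.
  have := Rmult_le_compat_r _ _ _ ts kap1; lra.
have k8 : 0 <= c * (th * th * s) by apply: Rmult_le_pos => //; lra.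
lra.
Qed.

Definition quotient (u : vec m -> R) j z e := (u (shift_coord z j e) - u z) / e.

Lemma quotient_bound i j z e : K z -> K (shift_coord z j e) -> e <> 0 ->
  Rabs (quotient (Y i) j z e) <= L.
Proof.
move=> Kz Ks he; have h := Ylip Kz Ks.
rewrite vnorm_shift in h.
rewrite /quotient /Rdiv Rabs_mult Rabs_inv.
have e0 := Rabs_pos_lt e he.
apply: (Rmult_le_reg_r (Rabs e)) => //; rewrite Rmult_assoc Rinv_l ?Rmult_1_r; last lra.
by apply: Rle_trans h; apply: (nrm_coord (delta Y z (shift_coord z j e))).
Qed.

(* Rescaled differences of two pairs of trajectories both obey the linearised equation. Where they disagree the disagreement grows faster, by the spectral gap, than the base differences; but it is bounded by [L] times these. *)
Lemma quotient_cauchy i j z0 th : K z0 -> 0 < th -> exists rho, 0 < rho /\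
  forall z1 z2 e1 e2, vnorm (vsub z1 z0) < rho -> vnorm (vsub z2 z0) < rho ->
    e1 <> 0 -> e2 <> 0 -> Rabs e1 < rho -> Rabs e2 < rho ->
    Rabs (quotient (Y i) j z1 e1 - quotient (Y i) j z2 e2) <= 2 * th.
Proof.
move=> Kz0 th0.
pose N := INR #|I|; pose m' := INR #|'I_m|.
have N0 : 0 <= N by apply: pos_INR.
have m0 : 0 <= m' by apply: pos_INR.
have NmC : 0 <= N * (m' * CR) by do 2 apply: Rmult_le_pos => //.
(* The second summand is what absorbs the coupling [Rr] in [cone_derivative]; the first keeps [C] a
   Lipschitz constant. *)
pose C := L + 8 * (N * (m' * CR)) / c.
have C8 : 0 <= 8 * (N * (m' * CR)) / c.
  by apply: Rmult_le_pos; [lra|apply: Rlt_le; apply: Rinv_0_lt_compat].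
have C0 : 0 < C by rewrite /C; lra.
have LC : L <= C by rewrite /C; lra.
have hC : 8 * (N * (m' * CR)) <= c * C.
  have -> : c * C = c * L + 8 * (N * (m' * CR)) by rewrite /C; field; lra.
  nra.
pose A1 := 4 * N * C + 4 * C * C * m' + 1.
pose A2 := 2 * m' + 1.
have A10 : 0 < A1.
  rewrite /A1; have : 0 <= N * C by apply: Rmult_le_pos; lra.
  have : 0 <= C * C * m' by apply: Rmult_le_pos => //; nra.
  lra.
have A20 : 0 < A2 by rewrite /A2; lra.
have t2 : 0 < c / 2 * (th * th) by apply: Rmult_lt_0_compat; nra.
pose mu := Rmin (c / 2 * (th * th) / A1) (c / 2 / A2).
have mu0 : 0 < mu by apply: Rmin_glb_lt; apply: Rdiv_lt_0_compat; lra.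
have hmu1 : (4 * N * C + 4 * C * C * m') * mu <= c / 2 * (th * th).
  have := Rmult_le_compat_l A1 _ _ (Rlt_le _ _ A10) (Rmin_l (c / 2 * (th * th) / A1) (c / 2 / A2)).
  rewrite -/mu (_ : A1 * (_ / A1) = c / 2 * (th * th)); last by field; lra.
  rewrite /A1; lra.
have hmu2 : 2 * m' * mu <= c / 2.
  have := Rmult_le_compat_l A2 _ _ (Rlt_le _ _ A20) (Rmin_r (c / 2 * (th * th) / A1) (c / 2 / A2)).
  rewrite -/mu (_ : A2 * (_ / A2) = c / 2); last by field; lra.
  rewrite /A2; lra.
(* At this time the weight of [s] in [q] is [th^2 + 2 C^2], above the a priori bound
   [nsq D <= 2 C^2 s]. Hence [q T <= 0], which a positive [q 0] would contradict. *)
pose T := 8 * (C * C) / (c * (th * th)).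
have T0 : 0 < T by apply: Rdiv_lt_0_compat; nra.
have TE : th * th * (1 + c * T / 4) = th * th + 2 * (C * C) by rewrite /T; field; split; lra.
have [phi [hphi phi0]] := Tr_ex Kz0.
have [d [d0 Hd]] := linear_within_traj hphi mu0 (Rlt_le _ _ T0).
have [rho1 [r10 Hr]] := traj_near hphi (Rlt_le _ _ T0) d0.
have [rho2 [r20 Hr2]] := Ko Kz0.
pose rho := Rmin rho1 rho2 / 2.
have l1 := Rmin_l rho1 rho2; have l2 := Rmin_r rho1 rho2.
have rho0 : 0 < rho by rewrite /rho; have := Rmin_glb_lt _ _ _ r10 r20; lra.
exists rho; split=> //.
have start z e : vnorm (vsub z z0) < rho -> Rabs e < rho -> exists a b, Tr a /\ Tr b /\
    a 0 = z /\ b 0 = shift_coord z j e /\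
    (forall t, 0 <= t <= T -> vnorm (vsub (a t) (phi t)) < d) /\
    (forall t, 0 <= t <= T -> vnorm (vsub (b t) (phi t)) < d).
  move=> hz he.
  have hs : vnorm (vsub (shift_coord z j e) z0) < 2 * rho.
    by have := vdist_triang (shift_coord z j e) z z0; rewrite vnorm_shift; lra.
  have [a [ha a0]] : exists a, Tr a /\ a 0 = z by apply: Tr_ex; apply: Hr2; rewrite /rho in hz; lra.
  have [b [hb b0]] : exists b, Tr b /\ b 0 = shift_coord z j e
    by apply: Tr_ex; apply: Hr2; rewrite /rho in hs; lra.
  exists a, b; do 4 split=> //; split=> t ht; apply: Hr => //; rewrite ?a0 ?b0 phi0;
    rewrite /rho in hz hs; lra.
move=> z1 z2 e1 e2 hz1 hz2 ne1 ne2 he1 he2.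
have [a1 [b1 [ha1 [hb1 [a10 [b10 [na1 nb1]]]]]]] := start z1 e1 hz1 he1.
have [a2 [b2 [ha2 [hb2 [a20 [b20 [na2 nb2]]]]]]] := start z2 e2 hz2 he2.
pose w1 t := fun l => / e1 * vsub (b1 t) (a1 t) l.
pose w2 t := fun l => / e2 * vsub (b2 t) (a2 t) l.
pose D1 t := fun i => / e1 * delta Y (a1 t) (b1 t) i.
pose D2 t := fun i => / e2 * delta Y (a2 t) (b2 t) i.
pose dw1 t := fun l => / e1 * vsub (G (b1 t)) (G (a1 t)) l.
pose dw2 t := fun l => / e2 * vsub (G (b2 t)) (G (a2 t)) l.
pose dD1 t := fun i => / e1 * delta Phi (a1 t) (b1 t) i.
pose dD2 t := fun i => / e2 * delta Phi (a2 t) (b2 t) i.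
pose s t := nsq (w1 t) + nsq (w2 t).
pose D t := fun i => D1 t i - D2 t i.
pose w t := fun l => w1 t l - w2 t l.
pose q t := nsq (D t) - C * C * nsq (w t) - th * th * ((1 + c / 4 * t) * s t).
pose dq t := 2 * dot (D t) (fun i => dD1 t i - dD2 t i)
    - C * C * (2 * dot (w t) (fun l => dw1 t l - dw2 t l))
    - th * th * (c / 4 * s t + (1 + c / 4 * t) * (2 * dot (w1 t) (dw1 t) + 2 * dot (w2 t) (dw2 t))).
have wd a b e t l : Tr a -> Tr b -> 0 < t ->
    derivable_pt_lim (fun t => / e * vsub (b t) (a t) l) t (/ e * vsub (G (b t)) (G (a t)) l).
  by move=> ha hb t0; apply: dpl_scal; apply: dpl_minus; apply: Tr_dpl.
have Dd a b e t k : Tr a -> Tr b -> 0 < t ->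
    derivable_pt_lim (fun t => / e * delta Y (a t) (b t) k) t (/ e * delta Phi (a t) (b t) k).
  by move=> ha hb t0; apply: dpl_scal; apply: dpl_minus; apply: Ydpl.
have wc a b e t l : Tr a -> Tr b -> continuity_pt (fun t => / e * vsub (b t) (a t) l) t.
  move=> ha hb; apply: continuity_pt_mult; first exact: continuity_pt_const.
  by apply: continuity_pt_minus; apply: Tr_cont.
have Dc a b e t k : Tr a -> Tr b -> continuity_pt (fun t => / e * delta Y (a t) (b t) k) t.
  move=> ha hb; apply: continuity_pt_mult; first exact: continuity_pt_const.
  by apply: continuity_pt_minus; apply: Y_traj_cont.
have qc t : continuity_pt q t.
  apply: continuity_pt_minus; first apply: continuity_pt_minus.
  - by apply: cont_nsq => k; apply: continuity_pt_minus; apply: Dc.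
  - apply: continuity_pt_mult; first exact: continuity_pt_const.
    by apply: cont_nsq => k; apply: continuity_pt_minus; apply: wc.
  - apply: continuity_pt_mult; first exact: continuity_pt_const.
    apply: continuity_pt_mult; first exact: cont_of_dpl (dpl_affine 1 (c / 4) t).
    by apply: continuity_pt_plus; apply: cont_nsq => k; apply: wc.
have qd t : 0 < t -> derivable_pt_lim q t (dq t).
  move=> t0; apply: dpl_minus; first apply: dpl_minus.
  - by apply: dpl_nsq => k; apply: dpl_minus; apply: Dd.
  - by apply: dpl_scal; apply: dpl_nsq => k; apply: dpl_minus; apply: wd.
  - apply: dpl_scal; apply: dpl_mult; first exact: dpl_affine.
    by apply: dpl_plus; apply: dpl_nsq => k; apply: wd.
have lipD a b e t : Tr a -> Tr b ->
    nrm (fun i => / e * delta Y (a t) (b t) i) <= L * nrm (fun l => / e * vsub (b t) (a t) l).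
  move=> ha hb; rewrite !nrmZ.
  have := Rmult_le_compat_l _ _ _ (Rabs_pos (/ e)) (Ylip (Tr_in t ha) (Tr_in t hb)).
  by rewrite vnorm_nrm; lra.
have scale (T' : finType) (P : T' -> R) e x : \sum_k (P k * (/ e * x k)) = / e * \sum_k (P k * x k).
  by rewrite -sum_scal; apply: sum_ext => k; ring.
have hq : q 0 <= 0.
  apply: Rnot_lt_le => q0.
  have : q 0 <= q T.
    apply: (positive_persists (du := dq) (Rlt_le _ _ T0)) => //.
      by move=> t ht; apply: qd; lra.
    move=> t ht qt.
    have lin := Hd t ltac:(lra).
    have Kt := Tr_in t hphi.
    have linD a b e k : Tr a -> Tr b -> vnorm (vsub (a t) (phi t)) < d ->
        vnorm (vsub (b t) (phi t)) < d ->
        Rabs (/ e * delta Phi (a t) (b t) k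
          - mulmv (fun i k => M i k (phi t)) (fun i => / e * delta Y (a t) (b t) i) k
          - mulmv (fun i j => Rr i j (phi t)) (fun l => / e * vsub (b t) (a t) l) k)
        <= mu * nrm (fun l => / e * vsub (b t) (a t) l).
      move=> ha hb na nb; have [h _] := lin (a t) (b t) na nb.
      rewrite /mulmv !scale nrmZ -!Rmult_minus_distr_l Rabs_mult.
      have := Rmult_le_compat_l _ _ _ (Rabs_pos (/ e)) (h k).
      by rewrite vnorm_nrm /dot /delta; lra.
    have linw a b e l : Tr a -> Tr b -> vnorm (vsub (a t) (phi t)) < d ->
        vnorm (vsub (b t) (phi t)) < d ->
        Rabs (/ e * vsub (G (b t)) (G (a t)) l
          - mulmv (fun l j => DG l j (phi t)) (fun l => / e * vsub (b t) (a t) l) l)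
        <= mu * nrm (fun l => / e * vsub (b t) (a t) l).
      move=> ha hb na nb; have [_ h] := lin (a t) (b t) na nb.
      rewrite /mulmv !scale nrmZ -!Rmult_minus_distr_l Rabs_mult.
      have := Rmult_le_compat_l _ _ _ (Rabs_pos (/ e)) (h l).
      by rewrite vnorm_nrm /dot /vsub; lra.
    have ht' : 0 <= t <= T by lra.
    apply: (cone_derivative (z := phi t) (C := C) (mu := mu)) => //.
    - lra.
    - by have := Rmult_le_pos c t ltac:(lra) ltac:(lra); lra.
    - exact: lipD.
    - exact: lipD.
    - by move=> k; apply: linD; auto.
    - by move=> k; apply: linD; auto.
    - by move=> k; apply: linw; auto.
    - by move=> k; apply: linw; auto.
  have nD : nsq (D T) <= 2 * (C * C) * s T.
    have h := nrm_triang (D1 T) (fun i => -1 * D2 T i).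
    rewrite nrmZ Rabs_Ropp Rabs_R1 Rmult_1_l in h.
    rewrite (nrm_ext (y := D T)) in h; last by move=> k; rewrite /D; ring.
    have g1 := lipD a1 b1 e1 T ha1 hb1; have g2 := lipD a2 b2 e2 T ha2 hb2.
    rewrite /s -!nrm_sqr.
    set n1 := nrm (w1 T) in g1 *; set n2 := nrm (w2 T) in g2 *.
    have n10 : 0 <= n1 by apply: nrm_ge0.
    have n20 : 0 <= n2 by apply: nrm_ge0.
    have g3 := Rmult_le_compat_r n1 _ _ n10 LC; have g4 := Rmult_le_compat_r n2 _ _ n20 LC.
    have g5 : nrm (D T) <= C * (n1 + n2) by rewrite /D1 /D2 in h; lra.
    have g6 := Rmult_le_compat _ _ _ _ (nrm_ge0 _) (nrm_ge0 _) g5 g5.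
    have g7 := Rle_0_sqr (n1 - n2).
    have C2 : 0 <= C * C by nra.
    have := Rmult_le_pos _ _ C2 g7; rewrite /Rsqr; lra.
  have sT : 0 <= s T by rewrite /s; have := nsq_ge0 (w1 T); have := nsq_ge0 (w2 T); lra.
  have wT : 0 <= C * C * nsq (w T) by apply: Rmult_le_pos; [nra|apply: nsq_ge0].
  have e : th * th * ((1 + c / 4 * T) * s T) = (th * th + 2 * (C * C)) * s T by rewrite -TE; field.
  have : 0 <= th * th * s T by apply: Rmult_le_pos => //; nra.
  rewrite {2}/q e; lra.
(* Both rescaled base increments start at the same unit vector, so [w 0 = 0] and [s 0 = 2]:
   [q 0 <= 0] says [nsq (D 0) <= 2 th^2]. *)
have w1E : w1 0 = (fun k => if k == j then 1 else 0).
  apply: functional_extensionality => k; rewrite /w1 a10 b10 shift_sub; field; exact: ne1.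
have w2E : w2 0 = (fun k => if k == j then 1 else 0).
  apply: functional_extensionality => k; rewrite /w2 a20 b20 shift_sub; field; exact: ne2.
have hD0 : nsq (D 0) <= 2 * (th * th).
  have w00 : nsq (w 0) = 0.
    by rewrite -nrm_sqr nrm0 ?Rmult_0_l // => k; rewrite /w w1E w2E Rminus_diag.
  by move: hq; rewrite /q /s w00 w1E w2E -[nsq (fun k => if _ then _ else _)]nrm_sqr nrm_basis; lra.
have h1 := nsq_coord (D 0) i.
have DE : D 0 i = quotient (Y i) j z1 e1 - quotient (Y i) j z2 e2.
  by rewrite /D /D1 /D2 a10 b10 a20 b20 /quotient /delta /Rdiv; ring.
rewrite -DE; apply: Rnot_lt_le => h2.
have : (2 * th) * (2 * th) < Rabs (D 0 i) * Rabs (D 0 i) by apply: Rmult_le_0_lt_compat; lra.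
have -> : Rabs (D 0 i) * Rabs (D 0 i) = D 0 i * D 0 i by split_Rabs; ring.
have : 0 < th * th by nra.
lra.
Qed.

(** The Cauchy estimate is used at a single base point, with different steps: completeness gives the
    limit along the steps [e n], and the same estimate carries it to all small [h] of either
    sign. *)
Lemma quotient_limit i j z : K z -> exists l, has_partial (Y i) j z l.
Proof.
move=> Kz.
pose e n := / (INR n + 1).
have e0 n : 0 < e n by apply: Rinv_0_lt_compat; have := pos_INR n; lra.
have elim rho : 0 < rho -> exists n0, forall n, (n0 <= n)%coq_nat -> Rabs (e n) < rho.
  move=> r0; have [n0 [hn0 hn]] := archimed_cor1 rho r0.
  exists n0 => n hn'; rewrite Rabs_right; last by have := e0 n; lra.
  apply: Rlt_trans hn0; apply: Rinv_lt_contravar; have := lt_0_INR _ hn; have := le_INR _ _ hn'; last lra.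
  by move=> ? ?; apply: Rmult_lt_0_compat; lra.
have cau : Cauchy_crit (fun n => quotient (Y i) j z (e n)).
  move=> eps he; have [rho [r0 Hr]] := quotient_cauchy i j Kz (th := eps / 4) ltac:(lra).
  have [n0 hn0] := elim rho r0; exists n0 => n k hn hk.
  rewrite /Rdist; apply: Rle_lt_trans (Hr z z (e n) (e k) _ _ _ _ _ _) _; try lra;
    rewrite ?vnorm_vsubxx //; try exact: hn0; by have := e0 n; have := e0 k; lra.
have [l Hl] := R_complete _ cau.
exists l => eps he.
have [rho [r0 Hr]] := quotient_cauchy i j Kz (th := eps / 8) ltac:(lra).
exists (mkposreal _ r0) => h h0 /= hh.
have [n0 hn0] := elim rho r0.
have [n1 hn1] := Hl (eps / 2) ltac:(lra).
have H1 := hn1 (maxn n0 n1) ltac:(apply/leP; exact: leq_maxr).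
have H2 := hn0 (maxn n0 n1) ltac:(apply/leP; exact: leq_maxl).
move: H1 H2; set k := maxn _ _ => H1 H2.
have H3 := Hr z z h (e k) ltac:(by rewrite vnorm_vsubxx) ltac:(by rewrite vnorm_vsubxx) h0
   ltac:(by have := e0 k; lra) hh H2.
rewrite Rplus_0_l shift0 -/(quotient (Y i) j z h).
move: H1 H3; rewrite /Rdist; set a := quotient _ _ _ _; set b := quotient _ _ _ _.
clear -he; split_Rabs; lra.
Qed.

Lemma pd_quotient i j z0 th : K z0 -> 0 < th -> exists rho, 0 < rho /\
  forall z e, vnorm (vsub z z0) < rho -> e <> 0 -> Rabs e < rho ->
    Rabs (quotient (Y i) j z e - pd j (Y i) z) <= th.
Proof.
move=> Kz th0.
have [rho [r0 Hr]] := quotient_cauchy i j Kz (th := th / 4) ltac:(lra).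
have [rho2 [r20 Hr2]] := Ko Kz.
exists (Rmin rho rho2); split; first exact: Rmin_glb_lt.
have l1 := Rmin_l rho rho2; have l2 := Rmin_r rho rho2.
move=> z e hz ne he.
have hp := pd_spec (quotient_limit i j (Hr2 z ltac:(lra))).
have [[d d0] Hd] := hp (th / 2) ltac:(lra).
have hm : 0 < Rmin d rho by apply: Rmin_glb_lt.
have l3 := Rmin_l d rho; have l4 := Rmin_r d rho.
pose h := Rmin d rho / 2.
have hh : Rabs h = h by rewrite Rabs_right // /h; lra.
have hne : h <> 0 by rewrite /h; lra.
have H1 := Hd h hne ltac:(rewrite /= hh /h; lra).
have H2 := Hr z z e h ltac:(lra) ltac:(lra) ne hne ltac:(lra) ltac:(rewrite hh /h; lra).
move: H1 H2; rewrite Rplus_0_l shift0 -/(quotient (Y i) j z h).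
set a := quotient _ _ _ _; set b := quotient _ _ _ _.
clear -th0; split_Rabs; lra.
Qed.

(** Boundedness passes from the quotients, which are at most [L]. Continuity compares quotients at
    [y] and at [z0] with one common step, each uniformly close to its partial derivative; this is
    why [quotient_cauchy] allows two base points. *)
Lemma Y_CrB1 i : CrB 1 K (Y i).
Proof.
apply: (CrB_intro Ko (d := fun j => pd j (Y i))) => //.
  by move=> j z Kz; apply: pd_spec; apply: quotient_limit.
move=> j.
have near z0 th (Kz : K z0) (th0 : 0 < th) := pd_quotient i j Kz th0.
split.
  exists (L + 1) => z Kz; have [rho [r0 Hr]] := near z 1 Kz Rlt_0_1.
  have [d [d0 Hd]] := Ko Kz.
  have hm : 0 < Rmin rho d by apply: Rmin_glb_lt.
  have l1 := Rmin_l rho d; have l2 := Rmin_r rho d.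
  pose e := Rmin rho d / 2.
  have he : Rabs e = e by rewrite Rabs_right // /e; lra.
  have ne : e <> 0 by rewrite /e; lra.
  have H1 := Hr z e ltac:(by rewrite vnorm_vsubxx) ne ltac:(rewrite he /e; lra).
  have H2 := quotient_bound i (j := j) Kz (Hd (shift_coord z j e) ltac:(rewrite vnorm_shift he /e; lra)) ne.
  by move: H1 H2; set a := quotient _ _ _ _; clear; split_Rabs; lra.
move=> z0 Kz eps he.
have [rho [r0 Hr]] := quotient_cauchy i j Kz (th := eps / 8) ltac:(lra).
have [rho1 [r10 Hr1]] := near z0 (eps / 4) Kz ltac:(lra).
exists (Rmin rho rho1); split; first exact: Rmin_glb_lt.
have l1 := Rmin_l rho rho1; have l2 := Rmin_r rho rho1.
move=> y hy.
pose e := Rmin rho rho1 / 2.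
have hm : 0 < Rmin rho rho1 by apply: Rmin_glb_lt.
have hee : Rabs e = e by rewrite Rabs_right // /e; lra.
have ne : e <> 0 by rewrite /e; lra.
have H1 := Hr1 z0 e ltac:(by rewrite vnorm_vsubxx) ne ltac:(rewrite hee /e; lra).
have H2 := Hr1 y e ltac:(lra) ne ltac:(rewrite hee /e; lra).
have H3 := Hr z0 y e e ltac:(by rewrite vnorm_vsubxx) ltac:(lra) ne ne ltac:(rewrite hee /e; lra) ltac:(rewrite hee /e; lra).
move: H1 H2 H3; set a := quotient _ _ _ _; set b := quotient _ _ _ _.
clear -he; split_Rabs; lra.
Qed.

End Regularity.
End Flow.

(** * Calculus of increments *)

Section Increments.
Variables (m : nat) (K : vec m -> Prop).

(** Meant for remainders that depend on both points, such as [u y] times an increment of a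
    coefficient, and not only for differences [u y - u x]. *)
Definition lip_incr (e : vec m -> vec m -> R) : Prop := exists C, 0 <= C /\
  forall x y, K x -> K y -> Rabs (e x y) <= C * vnorm (vsub y x).

Lemma lip_incr_plus e e' : lip_incr e -> lip_incr e' -> lip_incr (fun x y => e x y + e' x y).
Proof.
move=> [C [C0 H]] [C' [C0' H']]; exists (C + C'); split; first lra.
move=> x y Kx Ky; have := H x y Kx Ky; have := H' x y Kx Ky.
by move=> h1 h2; apply: Rle_trans (Rabs_triang _ _) _; lra.
Qed.

Lemma lip_incr_minus e e' : lip_incr e -> lip_incr e' -> lip_incr (fun x y => e x y - e' x y).
Proof.
move=> he [C' [C0' H']]; apply: lip_incr_plus he _; exists C'; split=> // x y Kx Ky.
by rewrite Rabs_Ropp; apply: H'.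
Qed.

Lemma lip_incr_sum (T : finType) (e : T -> vec m -> vec m -> R) :
  (forall i, lip_incr (e i)) -> lip_incr (fun x y => \sum_i e i x y).
Proof.
move=> H; rewrite unlock /=; elim: (index_enum T) => [|i s IH] /=.
  by exists 0; split=> [|x y _ _]; [lra | rewrite Rabs_R0; lra].
exact: lip_incr_plus (H i) IH.
Qed.

Lemma lip_incr_mul u e : bounded_on K u -> lip_incr e -> lip_incr (fun x y => u y * e x y).
Proof.
move=> [b Hb] [C [C0 H]]; exists (Rabs b * C); split.
  by apply: Rmult_le_pos => //; apply: Rabs_pos.
move=> x y Kx Ky; rewrite Rabs_mult Rmult_assoc.
apply: Rmult_le_compat; try exact: Rabs_pos; last exact: H.
by have := Hb y Ky; have := Rle_abs b; lra.
Qed.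

Lemma lip_incr_common (T : finType) (e : T -> vec m -> vec m -> R) :
  (forall i, lip_incr (e i)) -> exists C, 0 <= C /\
  forall i x y, K x -> K y -> Rabs (e i x y) <= C * vnorm (vsub y x).
Proof.
move=> H; pose Q (i : T) d := 0 < d /\ forall x y, K x -> K y -> Rabs (e i x y) <= / d * vnorm (vsub y x).
have [d [d0 Hd]] : exists d, 0 < d /\ forall i, Q i d.
  apply: fin_common => [i d d' [d0 h] [d'0 dd']|i].
    split=> // x y Kx Ky; apply: Rle_trans (h x y Kx Ky) _.
    by apply: Rmult_le_compat_r; [exact: nrm_ge0 | exact: Rinv_le_contravar].
  have [C [C0 h]] := H i.
  have p0 : 0 < / (C + 1) by apply: Rinv_0_lt_compat; lra.
  exists (/ (C + 1)); split=> //; split=> // x y Kx Ky.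
  apply: Rle_trans (h x y Kx Ky) _; rewrite Rinv_inv.
  by apply: Rmult_le_compat_r; [exact: nrm_ge0 | lra].
exists (/ d); split; first by apply: Rlt_le; apply: Rinv_0_lt_compat.
by move=> i; case: (Hd i).
Qed.

Lemma lip_incr_CB k u : is_open K -> is_convex K -> CrB k.+1 K u ->
  lip_incr (fun x y => u y - u x).
Proof. by move=> Ko Kc uC; have [C [C0 H]] := CB_lip Ko Kc uC; exists C. Qed.

Variables (I : finType) (Y : I -> vec m -> R).

(** The increment of [Phi] is an exact secant matrix applied to the increment of [Y], plus a
    Lipschitz remainder, so no smallness of the increment of [Y] is involved. The conclusion has the
    form that [Y_lipschitz] asks for. *)
Lemma expansion_of_increments (Phi : I -> vec m -> R) (N : vec m -> vec m -> I -> I -> R)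
    (E : I -> vec m -> vec m -> R) (beta : vec m -> R) :
  (forall p x y, K x -> K y ->
     Phi p y - Phi p x = mulmv (N x y) (delta Y x y) p + E p x y) ->
  (forall p, lip_incr (E p)) ->
  (forall x y v, K x -> K y -> beta x * nsq v <= dot v (mulmv (N x y) v)) ->
  exists C, 0 <= C /\ forall x y, K x -> K y ->
     beta x * nsq (delta Y x y) - C * nrm (delta Y x y) * vnorm (vsub y x)
       <= dot (delta Y x y) (delta Phi x y).
Proof.
move=> hPhi hE hN; have [C [C0 HC]] := lip_incr_common hE.
exists (INR #|I| * C); split; first by apply: Rmult_le_pos => //; apply: pos_INR.
move=> x y Kx Ky; set D := delta Y x y.
have -> : delta Phi x y = (fun p => mulmv (N x y) D p + E p x y).
  by apply: functional_extensionality => p; apply: hPhi.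
rewrite dotDr; have h1 := hN x y D Kx Ky.
have h2 := cauchy_schwarz D (fun p => E p x y).
have h3 := Rmult_le_compat_l _ _ _ (nrm_ge0 D) (nrm_bound (fun p => HC p x y Kx Ky)).
have h4 : - (nrm D * nrm (fun p => E p x y)) <= dot D (fun p => E p x y).
  by move: h2; set a := dot _ _; clear; split_Rabs; lra.
lra.
Qed.

Hypothesis Ko : is_open K.
Variable L : R.
Hypothesis L0 : 0 < L.
Hypothesis Ylip : forall x y, K x -> K y -> nrm (delta Y x y) <= L * vnorm (vsub y x).

Lemma sdiff_ext u v z0 P q P' q' : K z0 -> (forall z, K z -> u z = v z) ->
  (forall i, P i = P' i) -> (forall j, q j = q' j) -> sdiff Y u z0 P q -> sdiff Y v z0 P' q'.
Proof.
move=> Kz0 E EP Eq; have -> : P = P' by apply: functional_extensionality.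
have -> : q = q' by apply: functional_extensionality.
move=> H mu hmu; have [d [d0 Hd]] := H mu hmu; have [d2 [d20 H2]] := Ko Kz0.
have l1 := Rmin_l d d2; have l2 := Rmin_r d d2.
exists (Rmin d d2); split; first exact: Rmin_glb_lt.
by move=> z1 z2 h1 h2; rewrite -!E; [apply: Hd| |]; try apply: H2; lra.
Qed.

Lemma sdiff_base z0 i : sdiff Y (Y i) z0 (fun k => if k == i then 1 else 0) (fun _ => 0).
Proof.
move=> mu hmu; exists 1; split; first lra.
move=> z1 z2 _ _.
have -> : dot (fun k => if k == i then 1 else 0) (delta Y z1 z2) = delta Y z1 z2 i.
  rewrite -(sum_delta i (delta Y z1 z2)); apply: sum_ext => k; case: eqP => _; ring.
have -> : dot (fun _ : 'I_m => 0) (vsub z2 z1) = 0 by apply: sum_zero => j; ring.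
rewrite Rminus_diag Rminus_0_r Rabs_R0; apply: Rmult_le_pos; [lra|exact: nrm_ge0].
Qed.

Lemma sdiff_lip u z0 P q : K z0 -> sdiff Y u z0 P q -> exists C d, 0 < C /\ 0 < d /\
  forall z1 z2, vnorm (vsub z1 z0) < d -> vnorm (vsub z2 z0) < d ->
    Rabs (u z2 - u z1) <= C * vnorm (vsub z2 z1).
Proof.
move=> Kz0 H; have [d [d0 Hd]] := H 1 Rlt_0_1; have [d2 [d20 H2]] := Ko Kz0.
have l1 := Rmin_l d d2; have l2 := Rmin_r d d2.
have hP := Rmult_le_pos _ _ (nrm_ge0 P) (Rlt_le _ _ L0); have hq := nrm_ge0 q.
exists (nrm P * L + nrm q + 1), (Rmin d d2); split; first lra.
split; first exact: Rmin_glb_lt.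
move=> z1 z2 h1 h2.
have e1 := Hd z1 z2 ltac:(lra) ltac:(lra).
have e2 := cauchy_schwarz P (delta Y z1 z2); have e3 := cauchy_schwarz q (vsub z2 z1).
have e4 := Rmult_le_compat_l _ _ _ (nrm_ge0 P) (Ylip (H2 z1 ltac:(lra)) (H2 z2 ltac:(lra))).
rewrite -[nrm (vsub _ _)]vnorm_nrm in e3.
move: e1 e2 e3; set a := dot _ _; set b := dot _ _; move=> e1 e2 e3.
have : Rabs (u z2 - u z1) <= Rabs (u z2 - u z1 - a - b) + Rabs a + Rabs b.
  by clear; split_Rabs; lra.
lra.
Qed.

Lemma sdiff_plus u v z0 P q P' q' : sdiff Y u z0 P q -> sdiff Y v z0 P' q' ->
  sdiff Y (fun z => u z + v z) z0 (fun i => P i + P' i) (fun j => q j + q' j).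
Proof.
move=> H H' mu hmu.
have [d [d0 Hd]] := H (mu / 2) ltac:(lra); have [d' [d'0 Hd']] := H' (mu / 2) ltac:(lra).
have l1 := Rmin_l d d'; have l2 := Rmin_r d d'.
exists (Rmin d d'); split; first exact: Rmin_glb_lt.
move=> z1 z2 h1 h2; rewrite !dotDl.
have := Hd z1 z2 ltac:(lra) ltac:(lra); have := Hd' z1 z2 ltac:(lra) ltac:(lra).
set a := dot P _; set a' := dot P' _; set b := dot q _; set b' := dot q' _.
move=> e2 e1.
have -> : u z2 + v z2 - (u z1 + v z1) - (a + a') - (b + b') =
  (u z2 - u z1 - a - b) + (v z2 - v z1 - a' - b') by ring.
by apply: Rle_trans (Rabs_triang _ _) _; lra.
Qed.

Lemma sdiff_opp u z0 P q : sdiff Y u z0 P q ->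
  sdiff Y (fun z => - u z) z0 (fun i => - P i) (fun j => - q j).
Proof.
move=> H mu hmu; have [d [d0 Hd]] := H mu hmu; exists d; split=> // z1 z2 h1 h2.
have neg (T : finType) (x y : T -> R) : dot (fun i => - x i) y = - dot x y.
  by rewrite -sum_opp; apply: sum_ext => i; ring.
rewrite !neg -Rabs_Ropp.
have := Hd z1 z2 h1 h2; set a := dot P _; set b := dot q _.
by have -> : - (- u z2 - - u z1 - - a - - b) = u z2 - u z1 - a - b by ring.
Qed.

Lemma sdiff_minus u v z0 P q P' q' : sdiff Y u z0 P q -> sdiff Y v z0 P' q' ->
  sdiff Y (fun z => u z - v z) z0 (fun i => P i - P' i) (fun j => q j - q' j).
Proof. by move=> H H'; apply: sdiff_plus H (sdiff_opp H'). Qed.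

Lemma sdiff_sum (T : finType) (u : T -> vec m -> R) z0 (P : T -> I -> R) (q : T -> 'I_m -> R) :
  (forall t, sdiff Y (u t) z0 (P t) (q t)) ->
  sdiff Y (fun z => \sum_t u t z) z0 (fun i => \sum_t P t i) (fun j => \sum_t q t j).
Proof.
move=> H; rewrite unlock /=; elim: (index_enum T) => [|t s IH] /=; last exact: sdiff_plus (H t) IH.
move=> mu hmu; exists 1; split; first lra.
move=> z1 z2 _ _; rewrite /dot !sum_zero; try by move=> i; ring.
rewrite !Rminus_0_r Rabs_R0; apply: Rmult_le_pos; [lra|exact: nrm_ge0].
Qed.

(** Besides the two linear errors there remain [(u z2 - u z0) (v z2 - v z1)] and its mirror image.
    Each is a local Lipschitz bound on the increment times a factor that is small near [z0]. *)
Lemma sdiff_mult u v z0 P q P' q' : K z0 -> sdiff Y u z0 P q -> sdiff Y v z0 P' q' ->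
  sdiff Y (fun z => u z * v z) z0 (fun i => u z0 * P' i + v z0 * P i)
    (fun j => u z0 * q' j + v z0 * q j).
Proof.
move=> Kz0 H H' mu hmu.
have [Cu [du [Cu0 [du0 Hu]]]] := sdiff_lip Kz0 H.
have [Cv [dv [Cv0 [dv0 Hv]]]] := sdiff_lip Kz0 H'.
pose S := Rabs (u z0) + Rabs (v z0) + 1.
have S0 : 0 < S by rewrite /S; have := Rabs_pos (u z0); have := Rabs_pos (v z0); lra.
have m0 : 0 < mu / 4 / S by apply: Rdiv_lt_0_compat; lra.
have mS : mu / 4 / S * S = mu / 4 by field; lra.
have [d1 [d10 H1]] := H _ m0; have [d2 [d20 H2]] := H' _ m0.
have c0 : 0 < Cu * Cv by apply: Rmult_lt_0_compat.
pose d3 := mu / 4 / (Cu * Cv).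
have d30 : 0 < d3 by apply: Rdiv_lt_0_compat; lra.
have d3E : d3 * (Cu * Cv) = mu / 4 by rewrite /d3; field; split; lra.
pose d := Rmin (Rmin (Rmin du dv) d3) (Rmin d1 d2).
have l1 : d <= du by apply: Rle_trans (Rmin_l _ _) (Rle_trans _ _ _ (Rmin_l _ _) (Rmin_l _ _)).
have l2 : d <= dv by apply: Rle_trans (Rmin_l _ _) (Rle_trans _ _ _ (Rmin_l _ _) (Rmin_r _ _)).
have l3 : d <= d3 by apply: Rle_trans (Rmin_l _ _) (Rmin_r _ _).
have l4 : d <= d1 by apply: Rle_trans (Rmin_r _ _) (Rmin_l _ _).
have l5 : d <= d2 by apply: Rle_trans (Rmin_r _ _) (Rmin_r _ _).
exists d; split; first by rewrite /d; do ! apply: Rmin_glb_lt.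
move=> z1 z2 h1 h2; rewrite !dotDl !dotZl.
have e1 := H1 z1 z2 ltac:(lra) ltac:(lra); have e2 := H2 z1 z2 ltac:(lra) ltac:(lra).
have z00 : vnorm (vsub z0 z0) < d by rewrite vnorm_vsubxx; have := nrm_ge0 (vsub z1 z0); rewrite -vnorm_nrm; lra.
have f1 := Hu z1 z2 ltac:(lra) ltac:(lra); have f2 := Hv z1 z2 ltac:(lra) ltac:(lra).
have g1 := Hu z0 z2 ltac:(lra) ltac:(lra); have g2 := Hv z0 z1 ltac:(lra) ltac:(lra).
move: e1 e2; set a := dot P _; set a' := dot P' _; set b := dot q _; set b' := dot q' _.
move=> e1 e2.
have -> : u z2 * v z2 - u z1 * v z1 - (u z0 * a' + v z0 * a) - (u z0 * b' + v z0 * b) =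
  (u z0 * (v z2 - v z1 - a' - b') + v z0 * (u z2 - u z1 - a - b)) +
  ((u z2 - u z0) * (v z2 - v z1) + (v z1 - v z0) * (u z2 - u z1)) by ring.
set w := vnorm (vsub z2 z1) in e1 e2 f1 f2 *.
have w0 : 0 <= w by apply: nrm_ge0.
have k1 : Rabs (u z2 - u z0) <= Cu * d3 by have := Rmult_le_compat_l Cu _ _ (Rlt_le _ _ Cu0) (Rle_trans _ _ _ (Rlt_le _ _ h2) l3); lra.
have k2 : Rabs (v z1 - v z0) <= Cv * d3 by have := Rmult_le_compat_l Cv _ _ (Rlt_le _ _ Cv0) (Rle_trans _ _ _ (Rlt_le _ _ h1) l3); lra.
have k3 := Rmult_le_compat _ _ _ _ (Rabs_pos _) (Rabs_pos _) k1 f2.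
have k4 := Rmult_le_compat _ _ _ _ (Rabs_pos _) (Rabs_pos _) k2 f1.
have k5 := Rmult_le_compat_l _ _ _ (Rabs_pos (u z0)) e2.
have k6 := Rmult_le_compat_l _ _ _ (Rabs_pos (v z0)) e1.
have k7 : Rabs (u z0) * (mu / 4 / S * w) + Rabs (v z0) * (mu / 4 / S * w) <= mu / 4 * w.
  have : 0 <= mu / 4 / S * w by apply: Rmult_le_pos; lra.
  have -> : mu / 4 * w = mu / 4 / S * w * S by field; lra.
  set t := mu / 4 / S * w; rewrite /S; lra.
have k8 : Cu * d3 * (Cv * w) = mu / 4 * w by rewrite -d3E; ring.
have k9 : Cv * d3 * (Cu * w) = mu / 4 * w by rewrite -d3E; ring.
have mw : 0 <= mu * w by apply: Rmult_le_pos; lra.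
apply: Rle_trans (Rabs_triang _ _) _.
apply: Rle_trans (Rplus_le_compat _ _ _ _ (Rabs_triang _ _) (Rabs_triang _ _)) _.
rewrite !Rabs_mult; lra.
Qed.

End Increments.

(** * Sylvester operators on arrays *)

Section Kronecker.
Variables (I J : finType) (Q : I -> I -> R) (DG : J -> J -> R).

(* The matrix of [y |-> Q y - y DG] on [I * J]-indexed arrays [y]. *)
Definition sylvester (p p' : I * J) : R :=
  (if p.2 == p'.2 then Q p.1 p'.1 else 0) - (if p.1 == p'.1 then DG p'.2 p.2 else 0).

Lemma sylvesterE y i j :
  mulmv sylvester y (i, j) = \sum_k (Q i k * y (k, j)) - \sum_l (y (i, l) * DG l j).
Proof.
rewrite /mulmv sum_pair /sylvester /=.
rewrite (sum_ext (H := fun k => Q i k * y (k, j) -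
   (if k == i then \sum_l (y (i, l) * DG l j) else 0))).
  by rewrite sum_minus sum_delta.
move=> k; rewrite (sum_ext (H := fun l => (if l == j then Q i k * y (k, l) else 0) -
   (if k == i then y (i, l) * DG l j else 0))).
  rewrite sum_minus sum_delta; congr (_ - _); case: eqP => // _; exact: sum_zero.
move=> l; rewrite (eq_sym j) (eq_sym i); case: eqP => // [->|_]; case: eqP => [->|_]; ring.
Qed.

(** The inner product splits: [Q] acts on each column of [y] separately and [DG] on each row, so the
    two rates subtract. This is the loss of one tangent rate per tangent index. *)
Lemma sylvester_expansive b g :
  (forall x, b * nsq x <= dot x (mulmv Q x)) -> (forall v, dot v (mulmv DG v) <= g * nsq v) ->
  forall y, (b - g) * nsq y <= dot y (mulmv sylvester y).
Proof.
move=> hQ hD y.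
have -> : dot y (mulmv sylvester y) =
   \sum_j dot (fun i => y (i, j)) (mulmv Q (fun i => y (i, j))) -
   \sum_i dot (fun j => y (i, j)) (mulmv DG (fun j => y (i, j))).
  rewrite /dot sum_pair [X in _ = X - _]sum_exchange -sum_minus; apply: sum_ext => i.
  rewrite (sum_ext (H := fun j => y (i, j) * mulmv Q (fun i => y (i, j)) i -
      y (i, j) * \sum_l (y (i, l) * DG l j))); last first.
    by move=> j; rewrite sylvesterE /mulmv; ring.
  rewrite sum_minus; congr (_ - _).
  rewrite (sum_ext (H := fun j => \sum_l (y (i, j) * (y (i, l) * DG l j)))); last first.
    by move=> j; rewrite sum_scal.
  rewrite sum_exchange; apply: sum_ext => l; rewrite /mulmv -sum_scal; apply: sum_ext => j; ring.
have e1 : nsq y = \sum_j nsq (fun i => y (i, j)) by rewrite /nsq /dot sum_pair sum_exchange.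
have e2 : nsq y = \sum_i nsq (fun j => y (i, j)) by rewrite /nsq /dot sum_pair.
have h1 : b * nsq y <= \sum_j dot (fun i => y (i, j)) (mulmv Q (fun i => y (i, j))).
  by rewrite e1 -sum_scal; apply: sum_le => j.
have h2 : \sum_i dot (fun j => y (i, j)) (mulmv DG (fun j => y (i, j))) <= g * nsq y.
  by rewrite e2 -sum_scal; apply: sum_le => i.
lra.
Qed.

End Kronecker.

(** * Composition with the graph map *)

(** The [epsilon] in [opnorm] is a least upper bound only once one exists; the sum of the row norms
    bounds the set. The inequality for general [v] follows by normalising. *)
Lemma opnorm_bound p q (M : 'I_q -> 'I_p -> R) :
  0 <= opnorm M /\ forall v : vec p, vnorm (matapp M v) <= opnorm M * vnorm v.
Proof.
pose S := fun t => exists v : vec p, vnorm v <= 1 /\ t = vnorm (matapp M v).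
have ex : exists s, is_lub S s.
  have [s hs] : {s | is_lub S s}; last by exists s.
  apply: completeness; last by exists (vnorm (matapp M (fun _ => 0))), (fun _ => 0);
    split=> //; rewrite vnorm_nrm nrm0 //; lra.
  exists (\sum_i nrm (M i)) => t [v [hv ->]].
  apply: Rle_trans (nrm_le_sum _) _; apply: sum_le => i.
  apply: Rle_trans (cauchy_schwarz _ _) _.
  by have := Rmult_le_compat_l _ _ _ (nrm_ge0 (M i)) hv; rewrite vnorm_nrm; lra.
have [ub _] : is_lub S (opnorm M) by exact: (epsilon_spec _ _ ex).
have h1 (v : vec p) : vnorm v <= 1 -> vnorm (matapp M v) <= opnorm M.
  by move=> hv; apply: ub; exists v.
split.
  apply: Rle_trans (h1 (fun _ => 0) _); first exact: nrm_ge0.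
  by rewrite vnorm_nrm nrm0 //; lra.
move=> v; case: (Req_dec (vnorm v) 0) => hv.
  have -> : matapp M v = (fun _ => 0).
    apply: functional_extensionality => k; apply: sum_zero => i.
    have := nrm_coord v i; rewrite -vnorm_nrm hv => h.
    have -> : v i = 0 by move: h; clear; split_Rabs; lra.
    ring.
  rewrite hv vnorm_nrm nrm0 //; lra.
have v0 : 0 < vnorm v by have := nrm_ge0 v; rewrite -vnorm_nrm; lra.
have i0 : 0 < / vnorm v by apply: Rinv_0_lt_compat.
pose u : vec p := fun i => / vnorm v * v i.
have := h1 u; rewrite /u vnorm_nrm nrmZ -vnorm_nrm Rabs_right; last lra.
rewrite Rinv_l // => /(_ (Rle_refl 1)).
have -> : matapp M u = (fun k => / vnorm v * matapp M v k).
  by apply: functional_extensionality => k; rewrite /matapp -sum_scal; apply: sum_ext => i; rewrite /u; ring.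
rewrite vnorm_nrm nrmZ -vnorm_nrm Rabs_right; last lra.
move=> h; have := Rmult_le_compat_r _ _ _ (Rlt_le _ _ v0) h.
by have -> : / vnorm v * vnorm (matapp M v) * vnorm v = vnorm (matapp M v) by field.
Qed.

Section Join.
Variables n m : nat.
Implicit Types (a : vec n) (z : vec m) (x : vec (n + m)).

Lemma join_lshift a z i : join a z (lshift m i) = a i.
Proof. by rewrite /join (unsplitK (inl i)). Qed.

Lemma join_rshift a z j : join a z (rshift n j) = z j.
Proof. by rewrite /join (unsplitK (inr j)). Qed.

Lemma apart_join a z : apart (join a z) = a.
Proof. by apply: functional_extensionality => i; rewrite /apart join_lshift. Qed.

Lemma zpart_join a z : zpart (join a z) = z.
Proof. by apply: functional_extensionality => i; rewrite /zpart join_rshift. Qed.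

Lemma join_parts x : join (apart x) (zpart x) = x.
Proof.
apply: functional_extensionality => k; rewrite /join /apart /zpart.
by case: split_ordP => [i ->|j ->].
Qed.

Lemma dot_join (q : 'I_(n + m) -> R) a z :
  dot q (join a z) = dot (fun i => q (lshift m i)) a + dot (fun j => q (rshift n j)) z.
Proof.
rewrite /dot big_split_ord; congr (_ + _); apply: sum_ext => i;
  by rewrite ?join_lshift ?join_rshift.
Qed.

Lemma vsub_join a b z w : vsub (join a z) (join b w) = join (vsub a b) (vsub z w).
Proof. by apply: functional_extensionality => k; rewrite /vsub /join; case: fintype.split. Qed.

Lemma vnorm_join a z : vnorm (join a z) <= vnorm a + vnorm z.
Proof.
have ha := nrm_ge0 a; have hz := nrm_ge0 z.
rewrite !vnorm_nrm; apply: nrm_le; first lra.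
have -> : nsq (join a z) = nsq a + nsq z.
  rewrite {1}/nsq dot_join; congr (_ + _); apply: sum_ext => i;
  by rewrite ?join_lshift ?join_rshift.
rewrite -!nrm_sqr; nra.
Qed.

End Join.

Section GraphMap.
Variables (n m : nat) (K : vec m -> Prop) (U : vec (n + m) -> Prop) (h : vec m -> vec n).
Hypothesis Ko : is_open K.
Hypothesis Uo : is_open U.

Definition gmap z : vec (n + m) := join (h z) z.

Hypothesis gU : forall z, K z -> U (gmap z).

Lemma cont_on_gmap u : cont_on U u -> (forall i, cont_on K (fun z => h z i)) ->
  cont_on K (fun z => u (gmap z)).
Proof.
move=> uc hc z Kz eps he; have [d [d0 Hd]] := uc _ (gU Kz) eps he.
have N0 : 0 < d / 2 / (INR #|'I_n| + 1).
  by apply: Rdiv_lt_0_compat; [lra | have := pos_INR #|'I_n|; lra].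
have [d2 [d20 H2]] := cont_common hc Kz N0.
exists (Rmin d2 (d / 2)); split; first by apply: Rmin_glb_lt; lra.
move=> y hy; apply: Hd; rewrite /gmap vsub_join.
have l1 := Rmin_l d2 (d / 2); have l2 := Rmin_r d2 (d / 2).
apply: Rle_lt_trans (vnorm_join _ _) _.
have h1 : vnorm (vsub (h y) (h z)) <= INR #|'I_n| * (d / 2 / (INR #|'I_n| + 1)).
  by apply: nrm_bound => i; apply: Rlt_le; apply: H2; lra.
have h2 : INR #|'I_n| * (d / 2 / (INR #|'I_n| + 1)) <= d / 2.
  have p0 := pos_INR #|'I_n|.
  apply: (Rmult_le_reg_r (INR #|'I_n| + 1)); first lra.
  have -> : INR #|'I_n| * (d / 2 / (INR #|'I_n| + 1)) * (INR #|'I_n| + 1) = INR #|'I_n| * (d / 2) by field; lra.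
  nra.
lra.
Qed.

Lemma has_partial_gmap u q j z : K z -> strictd u (gmap z) q ->
  (forall i, CrB 1 K (fun z => h z i)) ->
  has_partial (fun z => u (gmap z)) j z
    (\sum_i (q (lshift m i) * pd j (fun z => h z i) z) + q (rshift n j)).
Proof.
move=> Kz hu hC.
pose c' : vec (n + m) := join (fun i => pd j (fun z => h z i) z) (fun k => if k == j then 1 else 0).
have -> : \sum_i (q (lshift m i) * pd j (fun z => h z i) z) + q (rshift n j) = dot q c'.
  rewrite dot_join; congr (_ + _).
  rewrite -(sum_delta j (fun k => q (rshift n k))); apply: sum_ext => k; case: eqP => _; ring.
apply: (chain_curve (z0 := gmap z) (c := fun t => gmap (shift_coord z j t))) => //.
  by rewrite shift0.
move=> k; rewrite /gmap /c' /join; case: fintype.split => [i|l].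
  exact: CrB_partial (hC i) Kz.
exact: dpl_shift.
Qed.

(** By the chain rule, a partial derivative of the composite is built from derivatives of [u] on the
    graph and derivatives of [h], all bounded; the values of [h] may be unbounded. *)
Lemma CrB_gmap k u : CrB k U u -> (forall i, CrB k K (fun z => h z i)) ->
  CrB k K (fun z => u (gmap z)).
Proof.
elim: k u => [|k IH] u uC hC; first exact: cont_on_gmap.
apply: (CrB_intro Ko (d := fun j z => \sum_i (pd (lshift m i) u (gmap z) * pd j (fun z => h z i) z)
   + pd (rshift n j) u (gmap z))).
- by apply: cont_on_gmap (CrB_cont uC) _ => i; apply: CrB_cont (hC i).
- move=> j z Kz; apply: has_partial_gmap Kz (CrB_strictd Uo uC (gU Kz)) _ => i.
  by apply: CrB_le (hC i).
- have comp i : CB K k (fun z => pd i u (gmap z)).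
    have [[b Hb] hp] := CrB_pd i uC; split; first by exists b => z Kz; apply: Hb; apply: gU.
    by apply: IH hp _ => l; apply: CrB_S.
  move=> j; apply: CB_plus => //; apply: CB_sum => // i; apply: CB_mult => //.
  exact: CrB_pd (hC i).
Qed.

(** The increment of [h] is kept as an independent variable. With [u] a component of [f], this is
    the order-0 equation in the form required by [pd_traj]. *)
Lemma sdiff_gmap u q z L : strictd u (gmap z) q -> K z -> 0 < L ->
  (forall x y, K x -> K y -> vnorm (vsub (h y) (h x)) <= L * vnorm (vsub y x)) ->
  sdiff (fun i z => h z i) (fun z => u (gmap z)) z (fun i => q (lshift m i)) (fun j => q (rshift n j)).
Proof.
move=> hu Kz L0 hL mu hmu.
have [d [d0 Hd]] := hu (mu / (L + 1)) ltac:(apply: Rdiv_lt_0_compat; lra).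
have [d2 [d20 H2]] := Ko Kz.
have e0 : 0 < d / (L + 1) by apply: Rdiv_lt_0_compat; lra.
have dE : d / (L + 1) * (L + 1) = d by field; lra.
have l1 := Rmin_l d2 (d / (L + 1)); have l2 := Rmin_r d2 (d / (L + 1)).
have lip x y : K x -> K y -> vnorm (vsub (gmap y) (gmap x)) <= (L + 1) * vnorm (vsub y x).
  by move=> Kx Ky; rewrite /gmap vsub_join; have := vnorm_join (vsub (h y) (h x)) (vsub y x); have := hL x y Kx Ky; lra.
exists (Rmin d2 (d / (L + 1))); split; first exact: Rmin_glb_lt.
move=> z1 z2 h1 h2.
have K1 : K z1 by apply: H2; lra.
have K2 : K z2 by apply: H2; lra.
have near x : K x -> vnorm (vsub x z) < Rmin d2 (d / (L + 1)) -> vnorm (vsub (gmap x) (gmap z)) < d.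
  move=> Kx hx; apply: Rle_lt_trans (lip z x Kz Kx) _; rewrite -dE Rmult_comm.
  by apply: Rmult_lt_compat_r; lra.
have := Hd _ _ (near z1 K1 h1) (near z2 K2 h2).
have -> : dot q (vsub (gmap z2) (gmap z1)) = dot (fun i => q (lshift m i)) (vsub (h z2) (h z1)) +
    dot (fun j => q (rshift n j)) (vsub z2 z1) by rewrite /gmap vsub_join dot_join.
move=> hb.
have -> a b c e : a - b - c - e = a - b - (c + e) by ring.
apply: Rle_trans hb _.
have := Rmult_le_compat_l (mu / (L + 1)) _ _ ltac:(apply: Rlt_le; apply: Rdiv_lt_0_compat; lra) (lip z1 z2 K1 K2).
by rewrite (_ : mu / (L + 1) * ((L + 1) * _) = mu * vnorm (vsub z2 z1)); [|field; lra].
Qed.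

End GraphMap.

(** * The invariant graph *)

Lemma CrB_of_pd p (U : vec p -> Prop) k u : CrB 1 U u -> (forall j, CrB k U (pd j u)) -> CrB k.+1 U u.
Proof.
move=> [uc H1] H; split=> // i; have [h1 [h2 _]] := H1 i; do 2 split=> //; exact: H.
Qed.

Lemma dpl_shift_time (u : R -> R) s t l :
  derivable_pt_lim u (s + t) l -> derivable_pt_lim (fun t => u (s + t)) t l.
Proof.
move=> H eps he; have [d Hd] := H eps he; exists d => e e0 he'.
by rewrite -Rplus_assoc; apply: Hd.
Qed.

Section SlowManifold.
Variables (n m r : nat) (f : vec (n + m) -> vec n) (g : vec (n + m) -> vec m).
Variables (K0 : vec m -> Prop) (h0 : vec m -> vec n) (eta : R).
Variables (U0 : vec (n + m) -> Prop) (alpha ell : vec (n + m) -> R) (cr : R).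
Hypothesis Hr : (2 <= r)%nat.
Hypothesis Ko : is_open K0.
Hypothesis Kc : is_convex K0.
Hypothesis Hh0C1 : forall k, Ck 1 K0 (fun z => h0 z k).
Hypothesis Heta : 0 < eta.
Hypothesis Hh0bd : forall z, K0 z -> opnorm (Dh h0 z) < eta.
Hypothesis Uo : is_open U0.
Hypothesis HU0nbhd : forall x, graph K0 h0 x -> U0 x.
Hypothesis HfCr : forall k, CrB r U0 (fun x => f x k).
Hypothesis HgCr : forall k, CrB r U0 (fun x => g x k).
Hypothesis Hell_nn : forall x, U0 x -> 0 <= ell x.
Hypothesis Hcr : 0 < cr.
Hypothesis Hfa : forall x, U0 x -> forall a' : vec n,
  inner a' (matapp (Da_f f x) a') >= alpha x * (vnorm a') ^ 2.
Hypothesis Hgz : forall x, U0 x -> forall z' : vec m,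
  inner z' (matapp (Dz_g g x) z') <= ell x * (vnorm z') ^ 2.
Hypothesis Hgap : forall x, U0 x ->
  alpha x >= INR r * ell x + INR (r + 1) * eta * opnorm (Da_g g x) + cr.
Hypothesis Hinv : pos_invariant (field f g) (graph K0 h0).

(** On the graph, [A], [R0], [B], [C] are the blocks [D_a f], [D_z f], [D_a g], [D_z g], and
    [X = D h0]. The chain rule makes [DG = B X + C] the derivative of the reduced field [G]. In
    [beta], the single [eta * b] bounds [X B], and each of the [k] tangent indices costs one
    [rate]. *)
Let gam := gmap h0.
Let G z := g (gam z).
Let A i k z := pd (lshift m k) (fun x => f x i) (gam z).
Let R0 i j z := pd (rshift n j) (fun x => f x i) (gam z).
Let B l i z := pd (lshift m i) (fun x => g x l) (gam z).
Let C l j z := pd (rshift n j) (fun x => g x l) (gam z).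
Let X i j z := pd j (fun w => h0 w i) z.
Let DG l j z := \sum_i (B l i z * X i j z) + C l j z.
Let b z := opnorm (Da_g g (gam z)).
Let rate z := ell (gam z) + eta * b z.
Let beta k z := alpha (gam z) - eta * b z - INR k * rate z.

Definition hreg q := forall i, CrB q K0 (fun z => h0 z i).

Lemma hreg_le k l : (k <= l)%nat -> hreg l -> hreg k.
Proof. by move=> kl H i; apply: CrB_le (H i). Qed.

Lemma graph_gam z : K0 z -> graph K0 h0 (gam z).
Proof. by move=> Kz; rewrite /graph /gam /gmap apart_join zpart_join. Qed.

Lemma gam_U z : K0 z -> U0 (gam z).
Proof. by move=> Kz; apply: HU0nbhd; apply: graph_gam. Qed.

Lemma b_ge0 z : 0 <= b z.
Proof. exact: (opnorm_bound (Da_g g (gam z))).1. Qed.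

Lemma rate_ge0 z : K0 z -> 0 <= rate z.
Proof.
move=> Kz; rewrite /rate; have := Hell_nn (gam_U Kz); have := b_ge0 z.
move=> h1 h2; have := Rmult_le_pos _ _ (Rlt_le _ _ Heta) h1; lra.
Qed.

(** In terms of [k] the claim reads [alpha >= (k + 1) ell + (k + 2) eta b + cr]; the hypothesis is
    exactly the case [k = r - 1]. *)
Lemma gap k z : (k < r)%nat -> K0 z -> rate z + cr <= beta k z.
Proof.
move=> kr Kz; rewrite /beta /rate.
have h := Hgap (gam_U Kz); rewrite -/(b z) plus_INR /= in h.
have kr' : INR k + 1 <= INR r by rewrite -S_INR; apply: le_INR; apply/leP.
have e0 := Hell_nn (gam_U Kz); have eb := Rmult_le_pos _ _ (Rlt_le _ _ Heta) (b_ge0 z).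
have h1 := Rmult_le_compat_r _ _ _ e0 kr'; have h2 := Rmult_le_compat_r _ _ _ eb kr'.
lra.
Qed.

Lemma X_norm z v : K0 z -> nrm (mulmv (fun i j => X i j z) v) <= eta * nrm v.
Proof.
move=> Kz; have [_ h] := opnorm_bound (Dh h0 z).
apply: Rle_trans (h v) _; rewrite vnorm_nrm; apply: Rmult_le_compat_r; first exact: nrm_ge0.
exact: Rlt_le (Hh0bd Kz).
Qed.

Lemma B_norm z v : nrm (mulmv (fun l i => B l i z) v) <= b z * nrm v.
Proof. by have [_ h] := opnorm_bound (Da_g g (gam z)); apply: h. Qed.

Lemma X_bound i j z : K0 z -> Rabs (X i j z) <= eta.
Proof.
move=> Kz; have := X_norm (fun l => if l == j then 1 else 0) Kz.
rewrite nrm_basis Rmult_1_r; apply: Rle_trans.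
have -> : X i j z = mulmv (fun i j => X i j z) (fun l => if l == j then 1 else 0) i.
  rewrite /mulmv -(sum_delta j (fun l => X i l z)); apply: sum_ext => l; case: eqP => _; ring.
exact: nrm_coord.
Qed.

Lemma hreg1 : hreg 1.
Proof.
move=> i; have [hc H] := Hh0C1 i; split=> // j; have [h1 h2] := H j.
by split=> //; split=> //; exists eta => z; apply: X_bound.
Qed.

Lemma coef_CB q k u : CrB r U0 u -> (q.+1 <= r)%nat -> hreg q ->
  CB K0 q (fun z => pd k u (gam z)).
Proof.
move=> uC qr hq.
have [[c Hc] hp] := CrB_pd k (CrB_le qr uC); split; first by exists c => z Kz; apply: Hc; apply: gam_U.
exact: (CrB_gmap Ko Uo gam_U hp hq).
Qed.

Lemma X_CB q i j : hreg q.+1 -> CB K0 q (X i j).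
Proof. by move=> H; apply: CrB_pd (H i). Qed.

Lemma DG_CB q l j : (q.+1 <= r)%nat -> hreg q.+1 -> CB K0 q (DG l j).
Proof.
move=> qr hq; have hq' := hreg_le (leqnSn q) hq.
apply: CB_plus => //; last exact: coef_CB.
by apply: CB_sum => // i; apply: CB_mult => //; [exact: coef_CB | exact: X_CB].
Qed.

Lemma G_CrB l : CrB 1 K0 (fun z => G z l).
Proof. exact: (CrB_gmap Ko Uo gam_U (CrB_le (ltnW Hr) (HgCr l)) hreg1). Qed.

Lemma G_strictd z l : K0 z -> strictd (fun x => G x l) z (fun j => DG l j z).
Proof.
move=> Kz; have := CrB_strictd Ko (G_CrB l) Kz.
have -> : (fun j => pd j (fun x => G x l) z) = (fun j => DG l j z); last by [].
apply: functional_extensionality => j; apply: pd_eq.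
apply: (has_partial_gmap j Kz (CrB_strictd Uo (CrB_le (ltnW Hr) (HgCr l)) (gam_U Kz)) hreg1).
Qed.

(** Here [2 <= r] enters: the first derivatives of [f] and [g], restricted to the graph of a merely
    C^1 function, are still C^1 with bounded derivatives. *)
Lemma coef_lip u k : CrB r U0 u -> lip_incr K0 (fun x y => pd k u (gam y) - pd k u (gam x)).
Proof.
move=> uC; have [_ h] := coef_CB k uC Hr hreg1.
exact: lip_incr_CB Ko Kc h.
Qed.

Lemma vec_lip p (F : vec m -> vec p) : (forall i, CrB 1 K0 (fun z => F z i)) ->
  exists L, 0 < L /\ forall x y, K0 x -> K0 y -> vnorm (vsub (F y) (F x)) <= L * vnorm (vsub y x).
Proof.
move=> H; have [c [c0 Hc]] := lip_incr_common (fun i => lip_incr_CB Ko Kc (H i)).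
have N0 := pos_INR #|'I_p|.
exists (INR #|'I_p| * c + 1); split; first by have := Rmult_le_pos _ _ N0 c0; lra.
move=> x y Kx Ky.
have h : vnorm (vsub (F y) (F x)) <= INR #|'I_p| * (c * vnorm (vsub y x)).
  by apply: nrm_bound => i; apply: Hc.
by have := nrm_ge0 (vsub y x); rewrite -vnorm_nrm; lra.
Qed.

Lemma DG_rate z v : K0 z -> dot v (mulmv (fun l j => DG l j z) v) <= rate z * nsq v.
Proof.
move=> Kz.
have -> : mulmv (fun l j => DG l j z) v = (fun l =>
    mulmv (fun l i => B l i z) (mulmv (fun i j => X i j z) v) l + mulmv (fun l j => C l j z) v l).
  by apply: functional_extensionality => l; rewrite mulmvD mulmv_comp.
rewrite dotDr.
have h1 := Hgz (gam_U Kz) v.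
have h2 := dot_le v (mulmv (fun l i => B l i z) (mulmv (fun i j => X i j z) v)).
have h3 := B_norm z (mulmv (fun i j => X i j z) v).
have h4 := Rmult_le_compat_l _ _ _ (b_ge0 z) (X_norm v Kz).
have h5 := Rmult_le_compat_l _ _ _ (nrm_ge0 v) (Rle_trans _ _ _ h3 h4).
move: h1; rewrite vnorm_nrm /= Rmult_1_r -nrm_sqr /rate.
move=> h1; apply: Rle_trans (Rplus_le_compat _ _ _ _ (Rle_trans _ _ _ h2 h5) h1) _; lra.
Qed.

(** Two base points appear because the increment of the quadratic term [X B X] produces [X y]
    together with [B x]. The estimate survives the mixture since [X] enters only through
    [|X| <= eta]. *)
Lemma normal_rate x y a : K0 x -> K0 y ->
  (alpha (gam x) - eta * b x) * nsq a <=
  dot a (mulmv (fun i k => A i k x - \sum_l (X i l y * B l k x)) a).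
Proof.
move=> Kx Ky.
have -> : mulmv (fun i k => A i k x - \sum_l (X i l y * B l k x)) a = (fun i =>
    mulmv (fun i k => A i k x) a i - mulmv (fun i l => X i l y) (mulmv (fun l k => B l k x) a) i).
  by apply: functional_extensionality => i; rewrite mulmvB mulmv_comp.
rewrite dotBr.
have h1 := Hfa (gam_U Kx) a.
have h2 := dot_le a (mulmv (fun i l => X i l y) (mulmv (fun l k => B l k x) a)).
have h3 := X_norm (mulmv (fun l k => B l k x) a) Ky.
have h4 := Rmult_le_compat_l _ _ _ (Rlt_le _ _ Heta) (B_norm x a).
have h5 := Rmult_le_compat_l _ _ _ (nrm_ge0 a) (Rle_trans _ _ _ h3 h4).
move: h1; rewrite vnorm_nrm /= Rmult_1_r -nrm_sqr.
move=> h1; apply: Rle_trans (Rplus_le_compat _ _ _ _ (Rge_le _ _ h1)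
  (Ropp_le_contravar _ _ (Rle_trans _ _ _ h2 h5))); lra.
Qed.

(** The mean value along the segment brings in [DG] at an intermediate [z]. Only [B] and [C], which
    are Lipschitz, are moved back to [x]; [X] has no known modulus of continuity at this stage, so
    it stays at [z] and is bounded by [eta], as [rate] allows. The radius is uniform because the
    Lipschitz constants are global. *)
Lemma G_one_sided e : 0 < e -> exists d, 0 < d /\ forall x y, K0 x -> K0 y ->
  vnorm (vsub y x) < d ->
  dot (vsub y x) (vsub (G y) (G x)) <= (rate x + e) * nsq (vsub y x).
Proof.
move=> he.
have [cB [cB0 HB]] := lip_incr_common (fun p : 'I_m * 'I_n => coef_lip (lshift m p.2) (HgCr p.1)).
have [cC [cC0 HC]] := lip_incr_common (fun p : 'I_m * 'I_m => coef_lip (rshift n p.2) (HgCr p.1)).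
pose N := INR #|'I_m|; pose N' := INR #|'I_n|.
have N0 : 0 <= N by apply: pos_INR.
have N'0 : 0 <= N' by apply: pos_INR.
pose S := N * (N' * (cB * eta)) + N * (N * cC).
have S0 : 0 <= S.
  apply: Rplus_le_le_0_compat; repeat apply: Rmult_le_pos => //; lra.
exists (e / (S + 1)); split; first by apply: Rdiv_lt_0_compat; lra.
move=> x y Kx Ky hxy; set w := vsub y x.
have Kseg s : 0 <= s <= 1 -> K0 (segment x y s) by move=> hs; apply: Kc.
have dF s : 0 <= s <= 1 -> derivable_pt_lim (fun s => dot w (G (segment x y s))) s
    (dot w (mulmv (fun l j => DG l j (segment x y s)) w)).
  move=> hs; apply: dpl_sum => l; apply: dpl_scal.
  apply: (chain_curve (G_strictd l (Kseg s hs))) => // k; exact: dpl_segment.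
have [s [hs E]] := mvt Rlt_0_1 (fun s hs => cont_of_dpl (dF s hs)) (fun s hs => dF s ltac:(lra)).
have -> : dot w (vsub (G y) (G x)) = dot w (mulmv (fun l j => DG l j (segment x y s)) w).
  by move: E; rewrite segment0 segment1 -dotBr => ->; rewrite Rminus_0_r Rmult_1_r.
set z := segment x y s; have Kz : K0 z by apply: Kseg; lra.
have zx : vnorm (vsub z x) <= vnorm w by apply: segment_dist; lra.
have hw : 0 <= vnorm w by apply: nrm_ge0.
pose v := mulmv (fun i j => X i j z) w.
have hv : nrm v <= eta * vnorm w by apply: X_norm.
have -> : mulmv (fun l j => DG l j z) w = (fun l =>
   (mulmv (fun l i => B l i x) v l + mulmv (fun l j => C l j x) w l) +
   (mulmv (fun l i => B l i z - B l i x) v l + mulmv (fun l j => C l j z - C l j x) w l)).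
  by apply: functional_extensionality => l; rewrite mulmvD mulmv_comp !mulmvB -/v; ring.
rewrite !dotDr.
have small (T : finType) (M : 'I_m -> T -> R) u c a : 0 <= c -> 0 <= a -> nrm u <= a * vnorm w ->
    (forall l i, Rabs (M l i) <= c * vnorm (vsub z x)) ->
    dot w (mulmv M u) <= N * (INR #|T| * (c * a)) * vnorm w * nsq w.
  move=> c0 a0 hu hM; apply: Rle_trans (dot_le _ _) _.
  rewrite -nrm_sqr -[nrm w]vnorm_nrm.
  have h1 : nrm (mulmv M u) <= N * (INR #|T| * ((c * vnorm w) * (a * vnorm w))).
    apply: nrm_bound => l; apply: Rle_trans (dot_sum_abs (c := c * vnorm w) (d := a * vnorm w) _ _).
    - exact: Rle_refl.
    - move=> i; apply: Rle_trans (hM l i) _; exact: Rmult_le_compat_l.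
    - by move=> i; apply: Rle_trans (nrm_coord u i) hu.
  have := Rmult_le_compat_l _ _ _ hw h1; lra.
have k1 := small _ _ v cB eta cB0 (Rlt_le _ _ Heta) hv (fun l i => HB (l, i) x z Kx Kz).
have k2 := small _ _ w cC 1 cC0 Rle_0_1 ltac:(rewrite Rmult_1_l; exact: Rle_refl)
   (fun l j => HC (l, j) x z Kx Kz).
have k3 : dot w (mulmv (fun l i => B l i x) v) <= eta * b x * nsq w.
  apply: Rle_trans (dot_le _ _) _.
  have h1 := B_norm x v; have h2 := Rmult_le_compat_l _ _ _ (b_ge0 x) hv.
  have := Rmult_le_compat_l _ _ _ hw (Rle_trans _ _ _ h1 h2).
  by rewrite -nrm_sqr -[nrm w]vnorm_nrm; lra.
have k4 : dot w (mulmv (fun l j => C l j x) w) <= ell (gam x) * nsq w.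
  have := Hgz (gam_U Kx) w; rewrite vnorm_nrm /= Rmult_1_r -nrm_sqr; apply: Rle_trans.
  exact: Rle_refl.
apply: Rle_trans (Rplus_le_compat _ _ _ _ (Rplus_le_compat _ _ _ _ k3 k4) (Rplus_le_compat _ _ _ _ k1 k2)) _.
have n0 := nsq_ge0 w.
have k5 : S * vnorm w <= e.
  have := Rmult_le_compat_l _ _ _ S0 (Rlt_le _ _ hxy).
  have : S * (e / (S + 1)) <= e.
    have -> : S * (e / (S + 1)) = e - e / (S + 1) by field; lra.
    have : 0 < e / (S + 1) by apply: Rdiv_lt_0_compat; lra.
    lra.
  rewrite -/w; lra.
have := Rmult_le_compat_r _ _ _ n0 k5.
rewrite /S /rate -/N -/N'; lra.
Qed.

(** The last clause is the [a]-component of the flow: it makes [h0] differentiable along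
    trajectories, and all higher equations descend from it. Membership and continuity are required
    at all real times, which spares boundary cases at time 0. *)
Definition Tr (phi : R -> vec m) : Prop :=
  (forall t, K0 (phi t)) /\ (forall t k, continuity_pt (fun s => phi s k) t) /\
  (forall t k, 0 < t -> derivable_pt_lim (fun s => phi s k) t (G (phi t) k)) /\
  (forall t i, 0 < t -> derivable_pt_lim (fun s => h0 (phi s) i) t (f (gam (phi t)) i)).

Lemma Tr_in phi t : Tr phi -> K0 (phi t).
Proof. by case. Qed.

Lemma Tr_cont phi t k : Tr phi -> continuity_pt (fun s => phi s k) t.
Proof. by case=> _ []. Qed.

Lemma Tr_dpl phi t k : Tr phi -> 0 < t -> derivable_pt_lim (fun s => phi s k) t (G (phi t) k).
Proof. by case=> _ [_ [H _]] t0; apply: H. Qed.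

Lemma Tr_h0 phi t i : Tr phi -> 0 < t ->
  derivable_pt_lim (fun s => h0 (phi s) i) t (f (gam (phi t)) i).
Proof. by case=> _ [_ [_ H]] t0; apply: H. Qed.

Lemma Tr_shift phi s : Tr phi -> 0 <= s -> Tr (fun t => phi (s + t)).
Proof.
move=> [H1 [H2 [H3 H4]]] s0; split=> [t|]; first exact: H1.
split=> [t k|].
  apply: (continuity_pt_comp (fun t => s + t) (fun t => phi t k)); last exact: H2.
  by apply: continuity_pt_plus; [exact: continuity_pt_const | exact: derivable_continuous_pt (derivable_pt_id t)].
split=> t k t0.
  by apply: (dpl_shift_time (u := fun s => phi s k)); apply: H3; lra.
by apply: (dpl_shift_time (u := fun s => h0 (phi s) k)); apply: H4; lra.
Qed.

(* The trajectory is frozen for negative times, so that it is continuous on the whole line. *)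
Lemma Tr_ex z : K0 z -> exists phi, Tr phi /\ phi 0 = z.
Proof.
move=> Kz; have [phi [[p0 [pc pd]] pG]] := Hinv (graph_gam Kz).
pose psi t := zpart (phi (Rmax 0 t)).
have max0 t : 0 <= Rmax 0 t by apply: Rmax_l.
have maxE t : 0 <= t -> Rmax 0 t = t by apply: Rmax_right.
have gE t : 0 <= t -> phi t = gam (zpart (phi t)).
  move=> t0; have [_ h] := pG t t0; rewrite /gam /gmap -[LHS]join_parts; congr join.
  by apply: functional_extensionality.
have near t s : 0 < t -> Rabs (s - t) < t -> 0 <= s by move=> t0; split_Rabs; lra.
have der t k : 0 < t -> derivable_pt_lim (fun s => psi s k) t (G (psi t) k).
  move=> t0; have h := pd t t0 (rshift n k).
  have -> : G (psi t) k = field f g (phi t) (rshift n k).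
    rewrite /field join_rshift /psi maxE; last lra.
    by rewrite [in RHS](gE t (Rlt_le _ _ t0)).
  apply: (dpl_near (f := fun s => phi s (rshift n k)) t0) => // s hs.
  by rewrite /psi maxE //; exact: near t0 hs.
exists psi; split; last first.
  rewrite /psi maxE; last lra.
  by apply: functional_extensionality => k; rewrite /zpart p0 /gam /gmap join_rshift.
split=> [t|]; first by have [] := pG _ (max0 t).
split=> [t k|].
  case: (Rtotal_order t 0) => [tn|[->|tp]]; last exact: cont_of_dpl (der t k tp).
    apply/cont_eps => eps he; exists (- t); split; first lra.
    move=> y hy; have yn : y <= 0 by move: hy; split_Rabs; lra.
    by rewrite /psi !Rmax_left ?Rminus_diag ?Rabs_R0 //; lra.
  apply/cont_eps => eps he; have [d [d0 Hd]] := pc eps he.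
  exists d; split=> // y hy; rewrite /psi (Rmax_left 0 0); last lra.
  have hm : 0 <= Rmax 0 y < d.
    split; first exact: max0.
    by rewrite /Rmax; case: Rle_dec => _ //; move: hy; split_Rabs; lra.
  by apply: Rle_lt_trans (Hd _ hm); apply: (nrm_coord (vsub (phi _) (phi 0))).
split=> // t i t0.
have h := pd t t0 (lshift m i).
have -> : f (gam (psi t)) i = field f g (phi t) (lshift m i).
  rewrite /field join_lshift /psi maxE; last lra.
  by rewrite [in RHS](gE t (Rlt_le _ _ t0)).
apply: (dpl_near (f := fun s => phi s (lshift m i)) t0) => // s hs.
have s0 := near t s t0 hs.
by rewrite /psi maxE // [in LHS](gE s s0) /gam /gmap join_lshift.
Qed.

(* [Y] collects the partial derivatives of [h0] of order [k]; along trajectories they evolve by [Phi], whose linearisation in [Y] has coefficient [M]. *)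
Definition level k : Prop :=
  exists (I : finType) (Y Phi : I -> vec m -> R) (M : I -> I -> vec m -> R)
    (Rr : I -> 'I_m -> vec m -> R) (L : R),
  (forall q, hreg (q + k) -> forall i, CB K0 q (Y i)) /\
  (forall q, (forall i, CrB q K0 (Y i)) -> hreg (q + k)) /\
  (forall phi t i, Tr phi -> 0 < t ->
     derivable_pt_lim (fun s => Y i (phi s)) t (Phi i (phi t))) /\
  0 < L /\
  (forall x y, K0 x -> K0 y -> nrm (delta Y x y) <= L * vnorm (vsub y x)) /\
  (forall z i, K0 z -> sdiff Y (Phi i) z (fun p => M i p z) (fun j => Rr i j z)) /\
  (forall z y, K0 z -> beta k z * nsq y <= dot y (mulmv (fun i p => M i p z) y)) /\
  (forall q i p, (q.+1 <= r)%nat -> hreg q.+1 -> CB K0 q (M i p)) /\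
  (forall q i j, (q + k < r)%nat -> hreg (q + k) -> CB K0 q (Rr i j)).

Lemma bounded_vec (I : finType) (Y : I -> vec m -> R) : (forall i, bounded_on K0 (Y i)) ->
  exists c, forall z, K0 z -> nrm (fun i => Y i z) <= c.
Proof.
move=> H; have [c [_ Hc]] := fin_bound (Q := K0) (F := fun i z => Rabs (Y i z)) H.
by exists (INR #|I| * c) => z Kz; apply: nrm_bound => i; apply: Hc.
Qed.

(** [N] may depend on both end points, so that the quadratic order-1 equation and the affine ones of
    higher order go through the same cone argument. *)
Lemma level_lipschitz k (I : finType) (Y Phi : I -> vec m -> R)
    (N : vec m -> vec m -> I -> I -> R) (E : I -> vec m -> vec m -> R) :
  (k < r)%nat -> (forall i, CB K0 0 (Y i)) ->
  (forall phi t i, Tr phi -> 0 < t ->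
     derivable_pt_lim (fun s => Y i (phi s)) t (Phi i (phi t))) ->
  (forall p x y, K0 x -> K0 y ->
     Phi p y - Phi p x = mulmv (N x y) (delta Y x y) p + E p x y) ->
  (forall p, lip_incr K0 (E p)) ->
  (forall x y v, K0 x -> K0 y -> beta k x * nsq v <= dot v (mulmv (N x y) v)) ->
  exists L, 0 < L /\ forall x y, K0 x -> K0 y -> nrm (delta Y x y) <= L * vnorm (vsub y x).
Proof.
move=> kr YC hder hPhi hE hN.
have [c Hc] := bounded_vec (fun i => (YC i).1).
have [c' [c'0 Hc']] := expansion_of_increments hPhi hE hN.
exact: (Y_lipschitz Tr_in Tr_cont Tr_dpl Tr_ex (fun i => (YC i).2) hder Hcr rate_ge0
  (fun z => @gap k z kr) Hc c'0 Hc' G_one_sided).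
Qed.

Lemma sylvester_CB q (I : finType) (M : I -> I -> vec m -> R) p p' :
  (forall i k, CB K0 q (M i k)) -> (q.+1 <= r)%nat -> hreg q.+1 ->
  CB K0 q (fun z => sylvester (fun i k => M i k z) (fun l j => DG l j z) p p').
Proof.
move=> hM qr hq; rewrite /sylvester; apply: CB_minus => //.
  by case: eqP => _ //; apply: CB_const.
by case: eqP => _; [apply: DG_CB | apply: CB_const].
Qed.

Lemma strictd_CB u z : CB K0 1 u -> K0 z -> strictd u z (fun j => pd j u z).
Proof. by move=> [_ uC] Kz; exact: (CrB_strictd Ko uC Kz). Qed.

(* Order [k.+1] inherits a linear equation, since differentiating along the flow acts on the new index by [- DG]. *)
Lemma level_next k : (1 <= k)%nat -> (k.+1 < r)%nat -> level k -> hreg k.+1 -> level k.+1.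
Proof.
move=> k1 kr [I [Y [Phi [M [Rr [L [Yreg [Yrec [hder [L0 [Ylip [Psd [Mexp [MC RC]]]]]]]]]]]]]] hk.
have hk1 : hreg (1 + k) by rewrite add1n.
have h2 : hreg 2 by apply: hreg_le hk.
have kr' : (k < r)%nat by apply: ltnW.
have [Lam [Lam0 HLam]] := vec_lip G_CrB.
have YC1 i : CrB 1 K0 (Y i) by have [] := Yreg 1%nat hk1 i.
have M1 i p : CB K0 1 (M i p) by apply: MC.
have R1 i j : CB K0 1 (Rr i j) by apply: RC; rewrite ?add1n.
pose Y' (p : I * 'I_m) := pd p.2 (Y p.1).
(* [pd_traj] yields [M Y' + Rr - Y' DG]. Its two linear terms form one Sylvester matrix, whose
   expansion rate is that of [M] less [rate]. *)
pose M' (p p' : I * 'I_m) z := sylvester (fun i k => M i k z) (fun l j => DG l j z) p p'.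
pose Phi' (p : I * 'I_m) z := \sum_p' (M' p p' z * Y' p' z) + Rr p.1 p.2 z.
have Y'C p : CB K0 0 (Y' p) by apply: CrB_pd.
have M'C p p' : CB K0 1 (M' p p') by apply: sylvester_CB.
have hder' phi t p : Tr phi -> 0 < t ->
    derivable_pt_lim (fun s => Y' p (phi s)) t (Phi' p (phi t)).
  move=> hphi t0; case: p => i j.
  apply: dpl_eq.
    apply: (pd_traj (Rlt_le _ _ Lam0) Ko Tr_in Tr_cont Tr_dpl Tr_shift Tr_ex HLam
      (fun i => CrB_cont (YC1 i)) hder L0 Ylip Psd (fun z l => @G_strictd z l)
      (fun i p => CrB_cont (M1 i p).2) (fun i j => CrB_cont (R1 i j).2)
      (fun l j => CrB_cont (DG_CB l j (ltnW Hr) hreg1).2) i j YC1 hphi) => //.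
  have := sylvesterE (fun i k => M i k (phi t)) (fun l j => DG l j (phi t))
    (fun p => Y' p (phi t)) i j.
  rewrite /mulmv /Phi' /M' /= => ->; rewrite /Y' /=; ring.
(* With the matrix frozen at [x], the remainder is [Y' y] times an increment of [M'], plus an
   increment of [Rr]: Lipschitz because [Y'] is bounded and [M'], [Rr] are C^1. *)
pose E p x y := \sum_p' (Y' p' y * (M' p p' y - M' p p' x)) + (Rr p.1 p.2 y - Rr p.1 p.2 x).
have [L' [L'0 Ylip']] : exists L, 0 < L /\ forall x y, K0 x -> K0 y ->
    nrm (delta Y' x y) <= L * vnorm (vsub y x).
  apply: (level_lipschitz (k := k.+1) (Phi := Phi') (N := fun x y p p' => M' p p' x) (E := E)) => //.
  - move=> p x y _ _; rewrite /Phi' /E /mulmv /delta.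
    have -> a a' c c' : a + c - (a' + c') = (a - a') + (c - c') by ring.
    rewrite -Rplus_assoc -sum_plus -sum_minus; congr (_ + _); apply: sum_ext => p'; ring.
  - move=> p; apply: lip_incr_plus; last exact: lip_incr_CB Ko Kc (R1 _ _).2.
    apply: lip_incr_sum => p'; apply: lip_incr_mul; first exact: (Y'C p').1.
    exact: lip_incr_CB Ko Kc (M'C p p').2.
  - move=> x y v Kx _.
    have := sylvester_expansive (fun w => Mexp x w Kx) (fun w => DG_rate w Kx) v.
    by rewrite /beta S_INR; have -> a : a - (INR k + 1) * rate x = a - INR k * rate x - rate x by ring.
exists (I * 'I_m)%type, Y', Phi', M'.
(* The new inhomogeneity is the derivative of [Phi'] in [z] with the values [Y'] held fixed. *)
exists (fun p j z => \sum_p' (Y' p' z * pd j (M' p p') z) + pd j (Rr p.1 p.2) z), L'.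
split=> [q hq p|].
  have hq' : hreg (q.+1 + k) by rewrite addSnnS.
  by apply: CrB_pd; have [] := Yreg q.+1 hq' p.1.
split=> [q hq|].
  rewrite -addSnnS; apply: Yrec => i; apply: CrB_of_pd => // j; exact: (hq (i, j)).
split=> //; split=> //; split=> //.
split=> [z p Kz|].
  have sM p' := sdiff_mult Ko L'0 Ylip' Kz (sdiff_strictd Y' (strictd_CB (M'C p p') Kz)) (sdiff_base Y' z p').
  apply: (sdiff_ext Ko Kz _ _ _ (sdiff_plus (sdiff_sum sM) (sdiff_strictd Y' (strictd_CB (R1 p.1 p.2) Kz)))) => //.
  - move=> p'; rewrite Rplus_0_r -(sum_delta p' (fun p' => M' p p' z)); apply: sum_ext => q.
    by rewrite (eq_sym p'); case: eqP => _; ring.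
  - move=> j; congr (_ + _); apply: sum_ext => q; ring.
split=> [z y Kz|].
  have := sylvester_expansive (fun w => Mexp z w Kz) (fun w => DG_rate w Kz) y.
  by rewrite /beta S_INR; have -> a : a - (INR k + 1) * rate z = a - INR k * rate z - rate z by ring.
split=> [q p p' qr hq|q p j qr hq]; first by apply: sylvester_CB => // i l; apply: MC.
have hq1 : hreg (q.+1 + k) by rewrite addSnnS.
(* [M'] contains [DG], hence [X], and is differentiated once more, which takes [q + 2] derivatives
   of [h0]; [1 <= k] makes them available. *)
have hq2 : hreg q.+2 by apply: hreg_le hq1; rewrite addSn ltnS -addn1 leq_add2l.
apply: CB_plus => //; last by apply: CrB_pd; have [] := RC q.+1 p.1 p.2 _ hq1; rewrite ?addSnnS.
apply: CB_sum => // p'; apply: CB_mult => //.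
  by apply: CrB_pd; have [] := Yreg q.+1 hq1 p'.1.
have qr2 : (q.+2 <= r)%nat by apply: leq_trans qr; rewrite ltnS -addn1 leq_add2l ltnW.
apply: CrB_pd; have [//] : CB K0 q.+1 (M' p p').
by apply: sylvester_CB => // i l; apply: MC.
Qed.

(** [Y_CrB1] makes the order-[k] array C^1 with bounded derivatives; the recovery clause of [level],
    taken at [q = 1], reads this as one more order for [h0]. *)
Lemma level_regularity k : (k < r)%nat -> level k -> hreg k -> hreg k.+1.
Proof.
move=> kr [I [Y [Phi [M [Rr [L [Yreg [Yrec [hder [L0 [Ylip [Psd [Mexp [MC RC]]]]]]]]]]]]]] hk.
rewrite -add1n; apply: Yrec.
have [Lam [Lam0 HLam]] := vec_lip G_CrB.
have r1 : (1 <= r)%nat by apply: ltnW.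
have RC0 i j := RC 0%nat i j kr hk.
have [CR [CR0 HCR]] := fin_bound (Q := K0) (F := fun (p : I * 'I_m) z => Rabs (Rr p.1 p.2 z))
  (fun p => (RC0 p.1 p.2).1).
apply: (Y_CrB1 (Rlt_le _ _ Lam0) Ko Tr_in Tr_cont Tr_dpl Tr_ex HLam
   (fun i => (Yreg 0%nat hk i).2) hder Hcr rate_ge0 (fun z => @gap k z kr) L0 Ylip Psd
   (fun z l => @G_strictd z l) (fun i p => CrB_cont (MC 0%nat i p r1 hreg1).2)
   (fun i j => CrB_cont (RC0 i j).2) (fun l j => CrB_cont (DG_CB l j r1 hreg1).2)
   (Rlt_le _ _ CR0) _ Mexp (fun z v => @DG_rate z v)).
by move=> i j z; apply: (HCR (i, j)).
Qed.

Lemma h0_lip : exists L, 0 < L /\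
  forall x y, K0 x -> K0 y -> vnorm (vsub (h0 y) (h0 x)) <= L * vnorm (vsub y x).
Proof. exact: vec_lip hreg1. Qed.

(** [pd_traj] at order 0, with [h0] as the array and [f] on the graph as its evolution. [X] becomes
    differentiable along trajectories while it is still only continuous in [z]. *)
Lemma X_derivative phi t i j : Tr phi -> 0 < t ->
  derivable_pt_lim (fun s => X i j (phi s)) t
    (\sum_k (A i k (phi t) * X k j (phi t)) + R0 i j (phi t)
      - \sum_l (X i l (phi t) * DG l j (phi t))).
Proof.
move=> hphi t0.
have [Lam [Lam0 HLam]] := vec_lip G_CrB; have [L [L0 HL]] := h0_lip.
have r1 : (1 <= r)%nat by apply: ltnW.
have h00 : hreg 0 := hreg_le (leq0n 1) hreg1.
have Ac l k : cont_on K0 (A l k) by have [] := coef_CB (lshift m k) (HfCr l) r1 h00.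
have Rc l k : cont_on K0 (R0 l k) by have [] := coef_CB (rshift n k) (HfCr l) r1 h00.
have Dc l k : cont_on K0 (DG l k) by have [] := DG_CB l k r1 hreg1.
have hc k : cont_on K0 (fun z => h0 z k) by apply: CrB_cont (hreg1 k).
have sd z k : K0 z ->
    sdiff (fun i z => h0 z i) (fun z => f (gam z) k) z (fun i => A k i z) (fun i => R0 k i z).
  move=> Kz; have st := CrB_strictd Uo (CrB_le r1 (HfCr k)) (gam_U Kz).
  exact: (sdiff_gmap Ko st Kz L0 HL).
apply: (pd_traj (Rlt_le _ _ Lam0) Ko Tr_in Tr_cont Tr_dpl Tr_shift Tr_ex HLam hc
  (fun phi t k => @Tr_h0 phi t k) L0 HL sd (fun z l => @G_strictd z l) Ac Rc Dc i j hreg1 hphi) => //.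
Qed.

Lemma sum_delta_pair (I J : finType) (F : I -> R) (p : I * J) j :
  \sum_k (F k * (if p == (k, j) then 1 else 0)) = if j == p.2 then F p.1 else 0.
Proof.
case: p => i l /=; rewrite -(sum_delta i (fun k => if j == l then F k else 0)).
apply: sum_ext => k; rewrite xpair_eqE (eq_sym i) (eq_sym l).
by case: (k == i); case: (j == l) => /=; ring.
Qed.

(** The increment of [X DG] is split exactly into [(X y - X x) DG x], [X y B x (X y - X x)] and a
    part Lipschitz in the base point. The secant operator is therefore the Sylvester operator of
    [A x - X y B x] and [DG x], to which [normal_rate] and [DG_rate] apply. *)
Lemma level_one : level 1.
Proof.
pose Y (p : 'I_n * 'I_m) := X p.1 p.2.
pose Q x y i k := A i k x - \sum_l (X i l y * B l k x).
pose Phi (p : 'I_n * 'I_m) z :=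
  \sum_k (A p.1 k z * X k p.2 z) + R0 p.1 p.2 z - \sum_l (X p.1 l z * DG l p.2 z).
have h00 : hreg 0 := hreg_le (leq0n 1) hreg1.
have YC p : CB K0 0 (Y p) by apply: X_CB hreg1.
have Xb i j : bounded_on K0 (X i j) := (YC (i, j)).1.
have fC1 i k : CB K0 1 (fun z => pd k (fun x => f x i) (gam z)) := coef_CB k (HfCr i) Hr hreg1.
have gC1 l k : CB K0 1 (fun z => pd k (fun x => g x l) (gam z)) := coef_CB k (HgCr l) Hr hreg1.
have hder phi t p : Tr phi -> 0 < t ->
    derivable_pt_lim (fun s => Y p (phi s)) t (Phi p (phi t)).
  by move=> hphi t0; apply: X_derivative.
pose E (p : 'I_n * 'I_m) x y := \sum_k (X k p.2 y * (A p.1 k y - A p.1 k x))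
  + (R0 p.1 p.2 y - R0 p.1 p.2 x)
  - \sum_l (X p.1 l y * (\sum_i (X i p.2 y * (B l i y - B l i x)) + (C l p.2 y - C l p.2 x))).
have [L [L0 Ylip]] : exists L, 0 < L /\ forall x y, K0 x -> K0 y ->
    nrm (delta Y x y) <= L * vnorm (vsub y x).
  apply: (level_lipschitz (k := 1) (Phi := Phi)
    (N := fun x y => sylvester (Q x y) (fun l j => DG l j x)) (E := E)) => //.
  - move=> [i j] x y _ _; rewrite sylvesterE /Phi /E /delta /Y /Q /=.
    have e1 : \sum_k ((A i k x - \sum_l (X i l y * B l k x)) * (X k j y - X k j x)) =
        \sum_k (A i k x * (X k j y - X k j x)) -
        \sum_l (X i l y * \sum_k (B l k x * (X k j y - X k j x))).
      rewrite [X in _ = _ - X](_ : _ = \sum_k \sum_l (X i l y * (B l k x * (X k j y - X k j x)))).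
        rewrite -sum_minus; apply: sum_ext => k; rewrite Rmult_minus_distr_r -sum_scalr.
        by congr (_ - _); apply: sum_ext => l; ring.
      by rewrite sum_exchange; apply: sum_ext => l; rewrite sum_scal.
    rewrite e1.
    have e2 l : DG l j y = DG l j x + \sum_k (B l k x * (X k j y - X k j x))
        + (\sum_i (X i j y * (B l i y - B l i x)) + (C l j y - C l j x)).
      have e3 : \sum_k (B l k y * X k j y) = \sum_k (B l k x * X k j x)
          + \sum_k (B l k x * (X k j y - X k j x)) + \sum_k (X k j y * (B l k y - B l k x)).
        by rewrite -!sum_plus; apply: sum_ext => k; ring.
      rewrite /DG e3; ring.
    rewrite (sum_ext (F := fun l => X i l y * DG l j y) (H := fun l =>
      X i l x * DG l j x + (X i l y - X i l x) * DG l j x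
      + X i l y * \sum_k (B l k x * (X k j y - X k j x))
      + X i l y * (\sum_i (X i j y * (B l i y - B l i x)) + (C l j y - C l j x)))); last first.
      by move=> l; rewrite e2; ring.
    rewrite !sum_plus.
    rewrite (sum_ext (F := fun k => A i k y * X k j y) (H := fun k =>
      A i k x * X k j x + A i k x * (X k j y - X k j x) + X k j y * (A i k y - A i k x))); last first.
      by move=> k; ring.
    rewrite !sum_plus.
    have assemble a1 a2 a3 q q' d1 d2 d3 d4 : a1 + a2 + a3 + q' - (d1 + d2 + d3 + d4) - (a1 + q - d1)
        = a2 - d3 - d2 + (a3 + (q' - q) - d4) by ring.
    exact: assemble.
  - move=> [i j]; apply: lip_incr_minus.
      apply: lip_incr_plus; last exact: lip_incr_CB Ko Kc (fC1 _ _).2.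
      apply: lip_incr_sum => k; apply: lip_incr_mul => //; exact: lip_incr_CB Ko Kc (fC1 _ _).2.
    apply: lip_incr_sum => l; apply: lip_incr_mul => //; apply: lip_incr_plus.
      apply: lip_incr_sum => k; apply: lip_incr_mul => //; exact: lip_incr_CB Ko Kc (gC1 _ _).2.
    exact: lip_incr_CB Ko Kc (gC1 _ _).2.
  - move=> x y v Kx Ky.
    have := sylvester_expansive (fun a => normal_rate a Kx Ky) (fun w => DG_rate w Kx) v.
    by rewrite /beta /= Rmult_1_l.
exists ('I_n * 'I_m)%type, Y, Phi.
exists (fun p p' z => sylvester (Q z z) (fun l j => DG l j z) p p').
exists (fun p j' z => \sum_k (X k p.2 z * pd j' (A p.1 k) z) + pd j' (R0 p.1 p.2) z
  - \sum_l (X p.1 l z * (\sum_i (X i p.2 z * pd j' (B l i) z) + pd j' (C l p.2) z))), L.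
split=> [q hq p|]; first by apply: X_CB; rewrite -addn1.
split=> [q hq i|].
  by rewrite addn1; apply: CrB_of_pd (hreg1 i) _ => j; apply: (hq (i, j)).
split=> //; split=> //; split=> //.
split=> [z [i j] Kz|].
  have base k l := sdiff_base Y z (k, l).
  have sf k k' := sdiff_strictd Y (strictd_CB (fC1 k k') Kz).
  have sg l k' := sdiff_strictd Y (strictd_CB (gC1 l k') Kz).
  (* The entries of [X] count as the coordinates of [Y], the other factors as strictly
     differentiable functions of [z]; the product rule then delivers the Sylvester matrix with both
     points equal to [z]. *)
  have s1 := sdiff_sum (fun k => sdiff_mult Ko L0 Ylip Kz (sf i (lshift m k)) (base k j)).
  have s2 l := sdiff_plus (sdiff_sum (fun k => sdiff_mult Ko L0 Ylip Kz (sg l (lshift m k)) (base k j)))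
    (sg l (rshift n j)).
  have s3 := sdiff_sum (fun l => sdiff_mult Ko L0 Ylip Kz (base i l) (s2 l)).
  apply: (sdiff_ext Ko Kz _ _ _ (sdiff_minus (sdiff_plus s1 (sf i (rshift n j))) s3)) => //.
  - move=> p; rewrite /sylvester /=.
    have e1 : \sum_k (A i k z * (if p == (k, j) then 1 else 0) + Y (k, j) z * 0) =
        if j == p.2 then A i p.1 z else 0.
      by rewrite -(sum_delta_pair (fun k => A i k z)); apply: sum_ext => k; rewrite Rmult_0_r Rplus_0_r.
    have e2 l : \sum_k (B l k z * (if p == (k, j) then 1 else 0) + Y (k, j) z * 0) + 0 =
        if j == p.2 then B l p.1 z else 0.
      by rewrite Rplus_0_r -(sum_delta_pair (fun k => B l k z)); apply: sum_ext => k; rewrite Rmult_0_r Rplus_0_r.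
    have e3 : \sum_l (DG l j z * (if p == (i, l) then 1 else 0)) =
        if i == p.1 then DG p.2 j z else 0.
      rewrite -(sum_delta p.2 (fun l => if i == p.1 then DG l j z else 0)).
      apply: sum_ext => l; case: (p) => k' l'; rewrite xpair_eqE (eq_sym k') (eq_sym l') /=.
      by case: (i == k'); case: (l == l') => /=; ring.
    rewrite -e3 Rplus_0_r.
    have -> : (if j == p.2 then Q z z i p.1 else 0) = (if j == p.2 then A i p.1 z else 0) -
        \sum_l (X i l z * (if j == p.2 then B l p.1 z else 0)).
      by case: (j == p.2) => //; rewrite sum_zero => [|l]; ring.
    rewrite -e1; have -> a a' a'' : a - a' - a'' = a - (a' + a'') by ring.
    rewrite -sum_plus; congr (_ - _); apply: sum_ext => l; congr (_ * _ + _); exact: e2.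
  - move=> j'; congr (_ + _ - _).
      by apply: sum_ext => k; rewrite Rmult_0_r Rplus_0_l.
    apply: sum_ext => l; rewrite Rmult_0_r Rplus_0_r; congr (_ * (_ + _)).
    by apply: sum_ext => k; rewrite Rmult_0_r Rplus_0_l.
split=> [z y Kz|].
  have := sylvester_expansive (fun a => normal_rate a Kz Kz) (fun w => DG_rate w Kz) y.
  by rewrite /beta /= Rmult_1_l.
split=> [q p p' qr hq|q p j qr hq].
  apply: sylvester_CB => // i k; have hq' := hreg_le (leqnSn q) hq.
  apply: CB_minus => //; first exact: coef_CB.
  by apply: CB_sum => // l; apply: CB_mult => //; [exact: X_CB | exact: coef_CB].
rewrite addn1 in qr hq.
have fC i k : CB K0 q.+1 (fun z => pd k (fun x => f x i) (gam z)) by apply: coef_CB.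
have gC l k : CB K0 q.+1 (fun z => pd k (fun x => g x l) (gam z)) by apply: coef_CB.
have XC i j' : CB K0 q (X i j') by apply: X_CB.
apply: CB_minus => //; first apply: CB_plus => //.
- apply: CB_sum => // k; apply: CB_mult => //; exact: CrB_pd (fC _ _).2.
- exact: CrB_pd (fC _ _).2.
- apply: CB_sum => // l; apply: CB_mult => //; apply: CB_plus => //; last exact: CrB_pd (gC _ _).2.
  apply: CB_sum => // k; apply: CB_mult => //; exact: CrB_pd (gC _ _).2.
Qed.

(** The two claims advance alternately: order [k] yields [hreg k.+1], which the construction of the
    next level presupposes. The range ends at [r - 1], where [Rr] already contains derivatives of
    [f] and [g] of order [r]. *)
Lemma regularity k : (1 <= k < r)%nat -> level k /\ hreg k.
Proof.
elim: k => [//|k IH /andP[_ kr]].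
case: k => [|k] in IH kr *; first by split; [exact: level_one | exact: hreg1].
have [lk hk] := IH (ltnW kr).
have hk' := level_regularity (ltnW kr) lk hk.
by split=> //; apply: level_next.
Qed.

(** The last order is read off from level [r - 1]; no evolution equation for the [r]-th derivatives
    is formed. *)
Lemma hreg_r : hreg r.
Proof.
have r1 : (1 <= r.-1 < r)%nat by case: (r) Hr => [//|[//|k]] _ /=; rewrite ltnSn.
have [lv hr] := regularity r1; case/andP: r1 => _ r1.
by have := level_regularity r1 lv hr; rewrite prednK // ltnW.
Qed.

End SlowManifold.

Theorem theorem1p2
  (n m r : nat) (Hr : (2 <= r)%nat)
  (f : vec (n + m) -> vec n) (g : vec (n + m) -> vec m)
  (K0 : vec m -> Prop) (h0 : vec m -> vec n) (eta : R)
  (U0 : vec (n + m) -> Prop) (alpha ell : vec (n + m) -> R) (cr : R)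
  (* Hypothesis 4 *)
  (HK0open : is_open K0) (HK0conv : is_convex K0)
  (Hh0C1 : forall k, Ck 1 K0 (fun z => h0 z k))
  (Heta : 0 < eta)
  (Hh0bd : forall z, K0 z -> opnorm (Dh h0 z) < eta)
  (* Hypothesis 5 *)
  (HU0open : is_open U0)
  (HU0nbhd : forall x, graph K0 h0 x -> U0 x)
  (HfCr : forall k, CrB r U0 (fun x => f x k))
  (HgCr : forall k, CrB r U0 (fun x => g x k))
  (Halpha_cont : cont_on U0 alpha) (Halpha_pos : forall x, U0 x -> 0 < alpha x)
  (Hell_cont : cont_on U0 ell) (Hell_nn : forall x, U0 x -> 0 <= ell x)
  (Hcr : 0 < cr)
  (Hfa : forall x, U0 x -> forall a' : vec n,
      inner a' (matapp (Da_f f x) a') >= alpha x * (vnorm a') ^ 2)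
  (Hgz : forall x, U0 x -> forall z' : vec m,
      inner z' (matapp (Dz_g g x) z') <= ell x * (vnorm z') ^ 2)
  (Hgap : forall x, U0 x ->
      alpha x >= INR r * ell x + INR (r + 1) * eta * opnorm (Da_g g x) + cr)
  (* positive invariance of Gamma *)
  (Hinv : pos_invariant (field f g) (graph K0 h0)) :
  forall k : 'I_n, CrB r K0 (fun z => h0 z k).
Proof.
exact: (hreg_r Hr HK0open HK0conv Hh0C1 Heta Hh0bd HU0open HU0nbhd HfCr HgCr
  Hell_nn Hcr Hfa Hgz Hgap Hinv).
Qed.
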